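(* Let $\Lambda$ be a basic Artin algebra with Jacobson radical $J$ and $e\in\Lambda$ an idempotent such that $\operatorname{pdim}_\Lambda\Lambda(1-e)/J(1-e)<\infty$, $\operatorname{pdim}_{e\Lambda e}e\Lambda(1-e)<\infty$, and $\mathcal{P}^{<\infty}(e\Lambda e\text{-mod})$ is contravariantly finite in $e\Lambda e\text{-mod}$. Let $T=T'\oplus T''$ be the basic strong tilting module in $\Lambda\text{-mod}$, decomposed as described in the context, $\widetilde{\Lambda}=\operatorname{End}_\Lambda(T)^{\mathrm{op}}$, and let $\widetilde{e}\in\widetilde{\Lambda}$ be the idempotent given by the projection $T\to T'\subseteq T$ along $T''$. Then contravariant finiteness of $\mathcal{P}^{<\infty}(\text{mod-}\widetilde{\Lambda})$ in $\text{mod-}\widetilde{\Lambda}$ is equivalent to contravariant finiteness of $\mathcal{P}^{<\infty}(\text{mod-}\widetilde{e}\widetilde{\Lambda}\widetilde{e})$ in $\text{mod-}\widetilde{e}\widetilde{\Lambda}\widetilde{e}$.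
   Context: For an Artin algebra $A$, $A\text{-mod}$ (resp. $\text{mod-}A$) is the category of finitely generated left (resp. right) $A$-modules and $\mathcal{P}^{<\infty}(A\text{-mod})$ (resp. $\mathcal{P}^{<\infty}(\text{mod-}A)$) its full subcategory of modules of finite projective dimension. $A$ is basic if $A/J(A)$ is a product of division rings; a module is basic if it has no indecomposable direct summand of multiplicity $>1$. $\operatorname{add}(M)$ denotes the direct summands of finite direct sums of copies of $M$. A (right) $\mathcal{P}^{<\infty}(A\text{-mod})$-approximation of $M\in A\text{-mod}$ is a map $\phi:X\to M$ with $X\in\mathcal{P}^{<\infty}(A\text{-mod})$ through which every homomorphism from an object of $\mathcal{P}^{<\infty}(A\text{-mod})$ to $M$ factors. It is minimal if every endomorphism $u$ of $X$ with $\phi\circ u=\phi$ is an automorphism; the minimal one is unique up to isomorphism, and its domain is also called the minimal approximation. $\mathcal{P}^{<\infty}(A\text{-mod})$ is contravariantly finite in $A\text{-mod}$ if every $M\in A\text{-mod}$ has an approximation. Similarly for right modules. Under the hypotheses of the claim, $\mathcal{P}^{<\infty}(\Lambda\text{-mod})$ is contravariantly finite in $\Lambda\text{-mod}$. $T\in A\text{-mod}$ is a tilting module if (1) $T\in\mathcal{P}^{<\infty}(A\text{-mod})$, (2) $\operatorname{Ext}^i_A(T,T)=0$ for $i\ge1$, (3) there is an exact sequence $0\to A\to T_0\to\cdots\to T_s\to0$ with all $T_j\in\operatorname{add}(T)$. It is strong if, in addition, $\operatorname{Ext}^i_A(M,T)=0$ for all $M\in\mathcal{P}^{<\infty}(A\text{-mod})$,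 $i\ge1$. A strong tilting module exists in $A\text{-mod}$ if and only if $\mathcal{P}^{<\infty}(A\text{-mod})$ is contravariantly finite, and the basic one is unique up to isomorphism. Decomposition of $T$: write $e=e_1+\cdots+e_m$ and $1-e=e_{m+1}+\cdots+e_n$ with orthogonal primitive idempotents, $S_i=\Lambda e_i/Je_i$, and let $\mathcal{A}_i$ be the minimal $\mathcal{P}^{<\infty}(\Lambda\text{-mod})$-approximation of the injective envelope $E(S_i)$. Then $\operatorname{add}(\bigoplus_{1\le i\le m}\mathcal{A}_i)$ contains precisely $m$ isomorphism classes of indecomposable modules, represented by $T_1,\dots,T_m$, and $T'=\bigoplus_{1\le i\le m}T_i$. For $m+1\le i\le n$, $\mathcal{A}_i=T_i\oplus U_i$ with $U_i\in\operatorname{add}(T')$ and $T_i$ the indecomposable summand having $S_i$ in its socle; $T''=\bigoplus_{m+1\le i\le n}T_i$. Then $T=T'\oplus T''$ up to isomorphism. *)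

(* Defs.v *)
From HB Require Import structures.
From mathcomp Require Import all_boot all_order all_algebra.
From mathcomp Require Import boolp classical_sets.

Set Implicit Arguments.
Unset Strict Implicit.
Unset Printing Implicit Defensive.

Import GRing.Theory.
Local Open Scope classical_set_scope.
Local Open Scope ring_scope.
Local Open Scope quotient_scope.

(* Conventions.  Rings are [pzRingType]s, so that the zero ring is allowed (it  *)
(* occurs as a corner ring).  Left R-modules are [lmodType R]; right R-modules  *)
(* are left modules over the converse ring, [lmodType R^c].  Module-theoretic   *)
(* notions (projective, injective, ...) refer to the category of all modules;   *)
(* finite generation is required explicitly where needed.                       *)

Section Modules.
Variable R : pzRingType.
Implicit Types M N X Y P E : lmodType R.

Definition submodule M (K : set M) : Prop :=
  K 0 /\ forall (a : R) x y, K x -> K y -> K (a *: x + y).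

Definition zero_module M : Prop := forall x : M, x = 0.

Definition isomorphic M N : Prop := exists f : {linear M -> N}, bijective f.

Definition surjective M N (f : M -> N) : Prop := forall y, exists x, f x = y.

Definition exact_at M N X (f : M -> N) (g : N -> X) : Prop :=
  forall y, g y = 0 <-> exists x, f x = y.

Definition finitely_generated M : Prop :=
  exists (n : nat) (s : 'I_n -> M),
    forall x, exists c : 'I_n -> R, x = \sum_(i < n) c i *: s i.

Definition artinian M : Prop :=
  forall C : nat -> set M,
    (forall n, submodule (C n)) -> (forall n, C n.+1 `<=` C n) ->
    exists n0, forall n, (n0 <= n)%N -> C n = C n0.

Definition indecomposable M : Prop :=
  ~ zero_module M /\
  forall X Y, isomorphic M (X * Y)%type -> zero_module X \/ zero_module Y.

Definition basic_module M : Prop :=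
  forall X Y, indecomposable X -> ~ isomorphic M (X * X * Y)%type.

Definition simple_submodule M (K : set M) : Prop :=
  [/\ submodule K, K <> [set 0] &
      forall K', submodule K' -> K' `<=` K -> K' = [set 0] \/ K' = K].

(* The sum of all simple submodules, as the smallest submodule containing them. *)
Definition socle M : set M :=
  [set x | forall L : set M, submodule L ->
    (forall K : set M, simple_submodule K -> K `<=` L) -> L x].

Definition embeds_in_socle X M : Prop :=
  exists2 f : {linear X -> M}, injective f & forall x, socle (f x).

Definition projective P : Prop :=
  forall M N (g : {linear M -> N}) (f : {linear P -> N}), surjective g ->
    exists h : {linear P -> M}, forall x, g (h x) = f x.

Definition injective_module E : Prop :=
  forall M N (g : {linear M -> N}) (f : {linear M -> E}), injective g ->
    exists h : {linear N -> E}, forall x, h (g x) = f x.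

Definition injective_envelope M E (i : {linear M -> E}) : Prop :=
  [/\ injective_module E, injective i &
      forall K : set E, submodule K -> K <> [set 0] ->
        exists x, i x <> 0 /\ K (i x)].

Record proj_resolution M := ProjResolution {
  res_obj : nat -> lmodType R;
  res_d : forall i, {linear res_obj i.+1 -> res_obj i};
  res_aug : {linear res_obj 0 -> M};
  res_proj : forall i, projective (res_obj i);
  res_surj : surjective res_aug;
  res_exact0 : exact_at (res_d 0) res_aug;
  res_exactS : forall i, exact_at (res_d i.+1) (res_d i) }.

Definition pdim_le M (n : nat) : Prop :=
  exists P : proj_resolution M, forall i, (n < i)%N -> zero_module (res_obj P i).

Definition pdim_finite M : Prop := exists n, pdim_le M n.

(* Cocycles and coboundaries of degree i in Hom_R(P, N), without augmentation. *)
Definition cocycle M N (P : proj_resolution M) i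
    (g : {linear res_obj P i -> N}) : Prop :=
  forall x, g (res_d P i x) = 0.

Definition coboundary M N (P : proj_resolution M) i :
    {linear res_obj P i -> N} -> Prop :=
  match i return {linear res_obj P i -> N} -> Prop with
  | 0 => fun g => forall x, g x = 0
  | j.+1 => fun g => exists h : {linear res_obj P j -> N},
                       forall x, g x = h (res_d P j x)
  end.

(* Ext^i_R(M, N) = 0 *)
Definition ext_vanish i M N : Prop :=
  forall (P : proj_resolution M) (g : {linear res_obj P i -> N}),
    cocycle g -> coboundary g.

Definition Pfin M : Prop := finitely_generated M /\ pdim_finite M.

Definition approximation X M (phi : {linear X -> M}) : Prop :=
  Pfin X /\ forall Y (f : {linear Y -> M}), Pfin Y ->
    exists h : {linear Y -> X}, forall y, phi (h y) = f y.

Definition minimal_approximation X M (phi : {linear X -> M}) : Prop :=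
  approximation phi /\
  forall u : {linear X -> X}, (forall x, phi (u x) = phi x) -> bijective u.

Definition contravariantly_finite : Prop :=
  forall M, finitely_generated M ->
    exists X (phi : {linear X -> M}), approximation phi.

End Modules.

Section DirectSum.
Variables (R : pzRingType) (I : finType) (M : I -> lmodType R).

Definition dsum : Type := forall i, M i.

HB.instance Definition _ := gen_eqMixin dsum.
HB.instance Definition _ := gen_choiceMixin dsum.

Let zero : dsum := fun=> 0.
Let opp (x : dsum) : dsum := fun i => - x i.
Let add (x y : dsum) : dsum := fun i => x i + y i.
Let scale (a : R) (x : dsum) : dsum := fun i => a *: x i.

Fact dsum_addA : associative add.
Proof. by move=> x y z; apply: functional_extensionality_dep => i; rewrite /add addrA. Qed.
Fact dsum_addC : commutative add.
Proof. by move=> x y; apply: functional_extensionality_dep => i; rewrite /add addrC. Qed.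
Fact dsum_add0 : left_id zero add.
Proof. by move=> x; apply: functional_extensionality_dep => i; rewrite /add add0r. Qed.
Fact dsum_addN : left_inverse zero opp add.
Proof. by move=> x; apply: functional_extensionality_dep => i; rewrite /add addNr. Qed.

HB.instance Definition _ :=
  GRing.isZmodule.Build dsum dsum_addA dsum_addC dsum_add0 dsum_addN.

Fact dsum_scaleA a b x : scale a (scale b x) = scale (a * b) x.
Proof. by apply: functional_extensionality_dep => i; rewrite /scale scalerA. Qed.
Fact dsum_scale1 : left_id 1 scale.
Proof. by move=> x; apply: functional_extensionality_dep => i; rewrite /scale scale1r. Qed.
Fact dsum_scaleDr : right_distributive scale +%R.
Proof. by move=> a x y; apply: functional_extensionality_dep => i; rewrite /scale scalerDr. Qed.
Fact dsum_scaleDl x : {morph scale^~ x : a b / a + b}.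
Proof. by move=> a b; apply: functional_extensionality_dep => i; rewrite /scale scalerDl. Qed.

HB.instance Definition _ := GRing.Zmodule_isLmodule.Build R dsum
  dsum_scaleA dsum_scale1 dsum_scaleDr dsum_scaleDl.

End DirectSum.

Definition in_add (R : pzRingType) (M N : lmodType R) : Prop :=
  exists (n : nat) (N' : lmodType R),
    isomorphic (N * N')%type (dsum (fun _ : 'I_n => M)).

Section Rings.
Variable R : pzRingType.

(* R is an Artin algebra: it is module-finite over a commutative artinian ring  *)
(* k acting through a ring morphism with central image.                         *)
Definition artin_algebra : Prop :=
  exists (k : comPzRingType) (phi : {rmorphism k -> R}),
    [/\ artinian k^o,
        forall a x, phi a * x = x * phi a &
        exists (n : nat) (s : 'I_n -> R),
          forall x, exists c : 'I_n -> k, x = \sum_(i < n) phi (c i) * s i].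

Definition maximal_left_ideal (I : set R^o) : Prop :=
  [/\ submodule I, I <> setT &
      forall I' : set R^o, submodule I' -> I `<=` I' -> I' = I \/ I' = setT].

Definition jacobson : set R^o :=
  [set x | forall I, maximal_left_ideal I -> I x].

Fact jacobson_submodule : submodule jacobson.
Proof.
split=> [I [[I0 _] _ _] //|a x y Jx Jy I mI].
by have [[_ IS] _ _] := mI; apply: IS; [apply: Jx | apply: Jy].
Qed.

Definition division_ring (D : nzRingType) : Prop :=
  forall x : D, x != 0 -> exists y, y * x = 1 /\ x * y = 1.

(* R / J(R) is a finite product of division rings D i, the isomorphism being    *)
(* given by its components f i : R -> D i.                                      *)
Definition basic_ring : Prop :=
  exists (n : nat) (D : 'I_n -> nzRingType)
         (f : forall i, {rmorphism R -> D i}),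
    [/\ forall i, division_ring (D i),
        forall x, jacobson x <-> forall i, f i x = 0 &
        forall y : (forall i, D i), exists x, forall i, f i x = y i].

Record idempotent_elt := Idempotent {
  idem_val :> R;
  idemP : idem_val * idem_val = idem_val }.

Fact idem_compl_subproof (e : idempotent_elt) : (1 - (e : R)) * (1 - (e : R)) = 1 - (e : R).
Proof. by rewrite mulrBl mul1r mulrBr mulr1 idemP subrr subr0. Qed.

Definition idem_compl (e : idempotent_elt) : idempotent_elt :=
  Idempotent (idem_compl_subproof e).

Definition primitive (e : idempotent_elt) : Prop :=
  (e : R) <> 0 /\
  forall f g : idempotent_elt, (f : R) * (g : R) = 0 -> (g : R) * (f : R) = 0 ->
    (e : R) = (f : R) + (g : R) -> (f : R) = 0 \/ (g : R) = 0.

End Rings.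

Section LeftProjective.
Variables (R : pzRingType) (e : idempotent_elt R).

Definition lproj_pred : {pred R^o} := fun x => (x : R) * (e : R) == x.

Fact lproj_closed : submod_closed lproj_pred.
Proof.
split=> [|a x y]; rewrite !unfold_in ?mul0r // => /eqP xe /eqP ye.
by apply/eqP; rewrite [LHS]mulrDl ye -[a *: x]/((a : R) * x) -mulrA xe.
Qed.
HB.instance Definition _ :=
  GRing.isSubmodClosed.Build R R^o lproj_pred lproj_closed.

Definition lproj := {x : R^o | x \in lproj_pred}.
HB.instance Definition _ := SubChoice.on lproj.
HB.instance Definition _ := [SubChoice_isSubLmodule of lproj by <:].

Definition lproj_rad : {pred lproj} :=
  fun x => `[< exists2 j : R, jacobson j & (val x : R) = j * (e : R) >].

Fact lproj_rad_closed : submod_closed lproj_rad.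
Proof.
have [J0 JS] := jacobson_submodule R.
split=> [|a x y]; first by apply/asboolP; exists 0; rewrite ?mul0r.
move=> /asboolP[j Jj xj] /asboolP[k Jk yk]; apply/asboolP.
exists (a * j + k); first exact: JS.
by rewrite linearP /= xj yk mulrDl -mulrA.
Qed.
HB.instance Definition _ :=
  GRing.isSubmodClosed.Build R lproj lproj_rad lproj_rad_closed.

Local Notation Q := (Quotient.quot lproj_rad).
Definition ltop : Type := Q.
HB.instance Definition _ := GRing.Zmodule.on ltop.

Definition ltop_scale (a : R) (x : Q) : Q := \pi_Q (a *: repr x).

Fact ltop_scale_pi a x : ltop_scale a (\pi_Q x) = \pi_Q (a *: x).
Proof.
apply/eqP; rewrite /ltop_scale -Quotient.idealrBE -scalerBr rpredZ //.
by rewrite Quotient.idealrBE reprK.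
Qed.
Fact ltop_scaleA a b x : ltop_scale a (ltop_scale b x) = ltop_scale (a * b) x.
Proof.
elim/quotW: x => x.
by rewrite (ltop_scale_pi b x) (ltop_scale_pi a) (ltop_scale_pi _ x) scalerA.
Qed.
Fact ltop_scale1 : left_id 1 ltop_scale.
Proof. by elim/quotW => x; rewrite ltop_scale_pi scale1r. Qed.
Fact ltop_scaleDr : right_distributive ltop_scale +%R.
Proof.
move=> a; elim/quotW => x; elim/quotW => y.
rewrite -raddfD (ltop_scale_pi a (x + y)) (ltop_scale_pi a x).
by rewrite (ltop_scale_pi a y) scalerDr raddfD.
Qed.
Fact ltop_scaleDl x : {morph ltop_scale^~ x : a b / a + b}.
Proof.
elim/quotW: x => x a b.
by rewrite (ltop_scale_pi (a + b)) (ltop_scale_pi a) (ltop_scale_pi b) scalerDl raddfD.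
Qed.
HB.instance Definition _ := GRing.Zmodule_isLmodule.Build R ltop
  ltop_scaleA ltop_scale1 ltop_scaleDr ltop_scaleDl.

End LeftProjective.

Section Peirce.
Variables (R : pzRingType) (e f : idempotent_elt R).

Definition peirce_pred : {pred R} := fun x => (e : R) * x * (f : R) == x.

Fact peirce_closed : zmod_closed peirce_pred.
Proof.
split=> [|x y]; rewrite !unfold_in ?mulr0 ?mul0r // => /eqP xe /eqP ye.
by rewrite mulrBr mulrBl xe ye.
Qed.
HB.instance Definition _ := GRing.isZmodClosed.Build R peirce_pred peirce_closed.

Definition peirce := {x : R | x \in peirce_pred}.
HB.instance Definition _ := SubChoice.on peirce.
HB.instance Definition _ := [SubChoice_isSubZmodule of peirce by <:].

Fact peirceP (x : peirce) : (e : R) * val x * (f : R) = val x.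
Proof. exact/eqP/(valP x). Qed.
Fact peirce_l (x : peirce) : (e : R) * val x = val x.
Proof. by rewrite -{1}peirceP !mulrA idemP peirceP. Qed.
Fact peirce_r (x : peirce) : val x * (f : R) = val x.
Proof. by rewrite -{1}peirceP -!mulrA idemP mulrA peirceP. Qed.

End Peirce.

Fact peirce_mul_subproof (R : pzRingType) (e f g : idempotent_elt R)
  (x : peirce e f) (y : peirce f g) : val x * val y \in peirce_pred e g.
Proof. by rewrite unfold_in mulrA peirce_l -mulrA peirce_r. Qed.

Definition peirce_mul (R : pzRingType) (e f g : idempotent_elt R)
    (x : peirce e f) (y : peirce f g) : peirce e g :=
  exist _ (val x * val y) (peirce_mul_subproof x y).

(* The ring e R e, with unit e (not 1). *)
Section Corner.
Variables (R : pzRingType) (e : idempotent_elt R).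

Definition corner : Type := peirce e e.
HB.instance Definition _ := GRing.Zmodule.on corner.

Fact corner_one_subproof : (e : R) \in peirce_pred e e.
Proof. by rewrite unfold_in !idemP. Qed.

Let one : corner := exist _ (e : R) corner_one_subproof.
Let mul (x y : corner) : corner := peirce_mul x y.

Fact corner_mulA : associative mul.
Proof. by move=> x y z; apply: val_inj; rewrite /= mulrA. Qed.
Fact corner_mul1l : left_id one mul.
Proof. by move=> x; apply: val_inj; rewrite /= peirce_l. Qed.
Fact corner_mul1r : right_id one mul.
Proof. by move=> x; apply: val_inj; rewrite /= peirce_r. Qed.
Fact corner_mulDl : left_distributive mul +%R.
Proof. by move=> x y z; apply: val_inj; rewrite /= mulrDl. Qed.
Fact corner_mulDr : right_distributive mul +%R.
Proof. by move=> x y z; apply: val_inj; rewrite /= mulrDr. Qed.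
HB.instance Definition _ := GRing.Zmodule_isPzRing.Build corner
  corner_mulA corner_mul1l corner_mul1r corner_mulDl corner_mulDr.

End Corner.

Section PeirceModule.
Variables (R : pzRingType) (e f : idempotent_elt R).

Let scale (a : corner e) (x : peirce e f) : peirce e f := peirce_mul a x.

Fact peirce_scaleA a b x : scale a (scale b x) = scale (a * b) x.
Proof. by apply: val_inj; rewrite /= mulrA. Qed.
Fact peirce_scale1 : left_id 1 scale.
Proof. by move=> x; apply: val_inj; rewrite /= peirce_l. Qed.
Fact peirce_scaleDr : right_distributive scale +%R.
Proof. by move=> a x y; apply: val_inj; rewrite /= mulrDr. Qed.
Fact peirce_scaleDl x : {morph scale^~ x : a b / a + b}.
Proof. by move=> a b; apply: val_inj; rewrite /= mulrDl. Qed.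
HB.instance Definition _ := GRing.Zmodule_isLmodule.Build (corner e) (peirce e f)
  peirce_scaleA peirce_scale1 peirce_scaleDr peirce_scaleDl.

End PeirceModule.

(* In endo T, f * g is the composite f \o g, so T is a left (endo T)-module and *)
(* a right module over the opposite ring endo_op T.                             *)
Section Endo.
Variables (R : pzRingType) (T : lmodType R).

Definition endo : Type := {linear T -> T}.
HB.instance Definition _ := gen_eqMixin endo.
HB.instance Definition _ := gen_choiceMixin endo.

Definition endo_fun (f : endo) : T -> T := (f : {linear T -> T}).

Fact endo_ext (f g : endo) : endo_fun f =1 endo_fun g -> f = g.
Proof.
rewrite /endo_fun; case: f g => [f [[f1] [f2]]] [g [[g1] [g2]]] /= /funext fg.
by case: _ / fg in g1 g2 *; rewrite (Prop_irrelevance f1 g1) (Prop_irrelevance f2 g2).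
Qed.

Let zero : endo := (\0 : {linear T -> T}).
Let one : endo := (idfun : {linear T -> T}).
Let opp (f : endo) : endo := (\- endo_fun f : {linear T -> T}).
Let add (f g : endo) : endo := (endo_fun f \+ endo_fun g : {linear T -> T}).
Let mul (f g : endo) : endo := (endo_fun f \o endo_fun g : {linear T -> T}).

Fact endo_addA : associative add.
Proof. by move=> f g h; apply: endo_ext => x; rewrite /= addrA. Qed.
Fact endo_addC : commutative add.
Proof. by move=> f g; apply: endo_ext => x; rewrite /= addrC. Qed.
Fact endo_add0 : left_id zero add.
Proof. by move=> f; apply: endo_ext => x; rewrite /= add0r. Qed.
Fact endo_addN : left_inverse zero opp add.
Proof. by move=> f; apply: endo_ext => x; rewrite /= addNr. Qed.
HB.instance Definition _ :=
  GRing.isZmodule.Build endo endo_addA endo_addC endo_add0 endo_addN.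

Fact endo_mulA : associative mul.
Proof. by move=> f g h; apply: endo_ext. Qed.
Fact endo_mul1l : left_id one mul.
Proof. by move=> f; apply: endo_ext. Qed.
Fact endo_mul1r : right_id one mul.
Proof. by move=> f; apply: endo_ext. Qed.
Fact endo_mulDl : left_distributive mul +%R.
Proof. by move=> f g h; apply: endo_ext. Qed.
Fact endo_mulDr : right_distributive mul +%R.
Proof. by move=> f g h; apply: endo_ext => x; rewrite /= /endo_fun /= raddfD. Qed.
HB.instance Definition _ := GRing.Zmodule_isPzRing.Build endo
  endo_mulA endo_mul1l endo_mul1r endo_mulDl endo_mulDr.

End Endo.

Definition endo_op (R : pzRingType) (T : lmodType R) : pzRingType := (endo T)^c.

Definition contravariantly_finite_right (R : pzRingType) : Prop :=
  contravariantly_finite R^c.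

Section Tilting.
Variable R : pzRingType.
Implicit Type T : lmodType R.

(* An exact sequence 0 -> R -> X 0 -> X 1 -> ... -> X s -> 0 in add(T). *)
Definition add_coresolution T : Prop :=
  exists (s : nat) (X : nat -> lmodType R) (eta : {linear R^o -> X 0})
         (d : forall i, {linear X i -> X i.+1}),
    [/\ forall i, in_add T (X i),
        forall i, (s < i)%N -> zero_module (X i),
        injective eta, exact_at eta (d 0) &
        forall i, exact_at (d i) (d i.+1)].

Definition tilting T : Prop :=
  [/\ Pfin T, forall i, (0 < i)%N -> ext_vanish i T T & add_coresolution T].

Definition strong_tilting T : Prop :=
  tilting T /\
  forall M : lmodType R, Pfin M -> forall i, (0 < i)%N -> ext_vanish i M T.

(* The modules T i represent, without repetition, the isomorphism classes of    *)
(* indecomposable modules in add(A).                                            *)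
Definition represent_indecomposables (A : lmodType R) m
    (T : 'I_m -> lmodType R) : Prop :=
  [/\ forall i, indecomposable (T i) /\ in_add A (T i),
      forall i j, isomorphic (T i) (T j) -> i = j &
      forall X : lmodType R, indecomposable X -> in_add A X ->
        exists i, isomorphic X (T i)].

End Tilting.

(* Main.v *)
(* Consider an Artin algebra A with an idempotent e such that modules killed by e and *)
(* the eAe-module eA have finite projective dimension. Then a finitely generated M    *)
(* has finite projective dimension if and only if eM has. The functor M |-> eM has a  *)
(* right adjoint, coinduction N |-> Hom_eAe(eA, N), with e coind(N) = N. Hence        *)
(* P^<oo-approximations pass from A to eAe (apply e to an approximation of coind(N))  *)
(* and from eAe to A (pull back along the unit M -> coind(eM)).                       *)
(*   This applies to the left End(T)-modules and the projection et : T -> T':         *)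
(* - a simple End(T)-module killed by et is Hom(S, T) for a simple Lambda-module S    *)
(*   killed by e;                                                                     *)
(* - et End(T) = Hom(T, T') = Hom_{e Lambda e}(eT, eT'), since T' has no submodule    *)
(*   killed by e (the approximations are minimal) and Ext^1(S, T') = 0 for these S,   *)
(*   so that T' = coind(eT').                                                         *)
(* Both have finite projective dimension: if W is Ext-injective in P^<oo, cogenerates *)
(* P^<oo and the finitistic dimension is finite, then embedding Y in powers of W and  *)
(* iterating on the cokernels yields a finite add(W)-coresolution of every Y in       *)
(* P^<oo, which Hom(-, W) turns into a finite projective resolution over End(W).      *)

(* Right modules over the opposite ring of End(T) are left modules over End(T), so the claim
   compares an Artin algebra A = End(T) with a corner eAe, where e is the projection onto T'. The
   general criterion is [contravariantly_finite_corner]: it asks that the finitely generated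
   A-modules killed by e, and the eAe-module eA, have finite projective dimension. Then M has finite
   projective dimension exactly when eM has ([pdfin_emodE]): going down, each syzygy step adds one
   to the dimension of eA; going up, M is presented by powers of Ae, and the kernels and cokernels
   left over are killed by e. Hence both M |-> eM and its right adjoint [coind] preserve P^<oo, and
   approximations travel in both directions.

   Both conditions on End(T) become statements about a module Hom(Y, W) over End(W), settled by
   [pdfin_hom]. Let W in P^<oo be Ext-injective there and cogenerate it, and let d bound all finite
   projective dimensions. Embed Y in a power of W and repeat with the cokernel. Each cokernel has
   vanishing Ext^1 against modules of projective dimension one larger than before, so after d steps
   the embedding splits, and Hom(-, W) turns the coresolution into a projective resolution of length
   at most d.

   With W = T over Lambda and Y = S simple, eS = 0, this treats the simple End(T)-modules killed by
   the projection, each of which is some Hom(S, T) ([simple_endo_iso]). With W = eT' and Y = eT over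
   e Lambda e it treats the second condition: T' is coinduced from eT' ([coind_unit_bij]), so Hom(T,
   T') = Hom(eT, eT') and End(T') = End(eT') ([pdfin_endo_corner], [endo_corner_morphism]).

   The hypotheses on W come from tilting theory. The coresolution of Lambda by add(T) bounds the
   finite projective dimensions ([findim_bound]). Cogeneration comes from the approximations A_i of
   the envelopes E(S_i): an embedding of a simple submodule of M in P^<oo into E(S_i) extends to M
   and lifts to A_i, which embeds in a power of T, and in a power of T' when i <= m. *)
Require Import Defs.
From HB Require Import structures.
From mathcomp Require Import all_boot all_order all_algebra.
From mathcomp Require Import boolp classical_sets.

Set Implicit Arguments.
Unset Strict Implicit.
Unset Printing Implicit Defensive.

Import GRing.Theory.
Local Open Scope ring_scope.
Local Open Scope quotient_scope.

(** * Submodules, quotients and factorizations *)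

Section LinearMaps.
Variable R : pzRingType.
Implicit Types M N X Y Q S : lmodType R.

(** The packaging of a raw function as a linear map is done once, here; later constructions supply a
    function, often obtained by choice, and a proof of linearity. *)
Lemma linear_of M N (f : M -> N) :
  linear f -> {h : {linear M -> N} | forall x, h x = f x}.
Proof.
move=> hf; pose L := GRing.isLinear.Build R M N *:%R f hf.
by exists (HB.pack_for {linear M -> N} f L).
Qed.

Lemma inj_ker0 M N (f : {linear M -> N}) :
  (forall x, f x = 0 -> x = 0) -> injective f.
Proof.
move=> f0 x y fxy; apply/eqP; rewrite -subr_eq0; apply/eqP/f0.
by rewrite linearB /= fxy subrr.
Qed.

Lemma ker0_inj M N (f : {linear M -> N}) x : injective f -> f x = 0 -> x = 0.
Proof. by move=> fi; rewrite -(linear0 f) => /fi. Qed.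

Lemma inj_surj_bij M N (f : {linear M -> N}) :
  injective f -> surjective f -> bijective f.
Proof.
move=> fi fs; have [g gK] := choice fs.
by exists g => // x; apply: fi; rewrite gK.
Qed.

Lemma bij_surj M N (f : M -> N) : bijective f -> surjective f.
Proof. by case=> g _ gK y; exists (g y). Qed.

Lemma linear_inverse M N (f : {linear M -> N}) : bijective f ->
  exists2 g : {linear N -> M}, cancel f g & cancel g f.
Proof.
case=> g fK gK; have lg : linear g.
  by move=> a x y; apply: (can_inj fK); rewrite linearP !gK.
by have [h hE] := linear_of lg; exists h => x; rewrite hE.
Qed.

Lemma iso_sym M N : isomorphic M N -> isomorphic N M.
Proof. by case=> f /linear_inverse[g fK gK]; exists g; exists f. Qed.

Lemma iso_trans M N X : isomorphic M N -> isomorphic N X -> isomorphic M X.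
Proof. by case=> f fb [g gb]; exists (g \o f); apply: bij_comp. Qed.

Lemma iso_prodC M N : isomorphic (M * N)%type (N * M)%type.
Proof.
have [|f fE] := @linear_of (M * N)%type (N * M)%type (fun x => (x.2, x.1)).
  by move=> a [x y] [z t].
by exists f; exists (fun x => (x.2, x.1)) => -[x y]; rewrite fE.
Qed.

Lemma submodule0 M (K : set M) : submodule K -> K 0.
Proof. by case. Qed.
Lemma submoduleZ M (K : set M) a x : submodule K -> K x -> K (a *: x).
Proof. by case=> K0 KS Kx; rewrite -[_ *: _]addr0; apply: KS. Qed.
Lemma submoduleD M (K : set M) x y : submodule K -> K x -> K y -> K (x + y).
Proof. by case=> K0 KS Kx; rewrite -[x]scale1r; apply: KS. Qed.
Lemma submoduleB M (K : set M) x y : submodule K -> K x -> K y -> K (x - y).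
Proof.
by move=> Ks Kx Ky; rewrite -scaleN1r; apply: submoduleD => //; apply: submoduleZ.
Qed.
Lemma submodule_preimage M N (f : {linear M -> N}) (K : set N) :
  submodule K -> submodule (fun x => K (f x)).
Proof.
case=> K0 KS; split=> [|a x y Kx Ky]; rewrite ?linear0 ?linearP //=.
exact: KS.
Qed.

Lemma submodule_image M N (f : {linear M -> N}) (K : set M) :
  submodule K -> submodule (fun y => exists2 x, K x & f x = y).
Proof.
case=> K0 KS; split=> [|a _ _ [x Kx <-] [y Ky <-]]; first by exists 0; rewrite ?linear0.
by exists (a *: x + y); rewrite ?linearP //; apply: KS.
Qed.

Lemma submodule_range M N (f : {linear M -> N}) :
  submodule (fun y => exists x, f x = y).
Proof.
split=> [|a _ _ [x <-] [y <-]]; first by exists 0; rewrite linear0.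
by exists (a *: x + y); rewrite linearP.
Qed.

Lemma submodule_ker M N (f : {linear M -> N}) : submodule (fun x => f x = 0).
Proof.
split=> [|a x y fx fy]; first exact: linear0.
by rewrite linearP fx fy scaler0 addr0.
Qed.

Lemma submodule_setT M : submodule (fun _ : M => True).
Proof. by []. Qed.

End LinearMaps.

Section SubQuotient.
Variables (R : pzRingType) (M : lmodType R) (K : set M) (Ks : submodule K).

(** Indexed by the proof that [K] is a submodule, so that the closure instance, and with it the
    module structures on [sub_mod] and [quot_mod], can be inferred. *)
Definition sub_pred (_ : submodule K) : {pred M} := fun x => `[< K x >].

Fact sub_pred_closed : submod_closed (sub_pred Ks).
Proof.
split=> [|a x y /asboolP Kx /asboolP Ky]; apply/asboolP; first exact: submodule0.
by case: Ks => _; apply.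
Qed.
HB.instance Definition _ :=
  GRing.isSubmodClosed.Build R M (sub_pred Ks) sub_pred_closed.

Definition sub_mod := {x : M | x \in sub_pred Ks}.
HB.instance Definition _ := SubChoice.on sub_mod.
HB.instance Definition _ := [SubChoice_isSubLmodule of sub_mod by <:].

Local Notation Q := (Quotient.quot (sub_pred Ks)).
Definition quot_mod : Type := Q.
HB.instance Definition _ := GRing.Zmodule.on quot_mod.

Let scale (a : R) (x : Q) : Q := \pi_Q (a *: repr x).

Let scale_pi a x : scale a (\pi_Q x) = \pi_Q (a *: x).
Proof.
apply/eqP; rewrite /scale -Quotient.idealrBE -scalerBr rpredZ //.
by rewrite Quotient.idealrBE reprK.
Qed.

Fact quot_scaleA a b x : scale a (scale b x) = scale (a * b) x.
Proof. by elim/quotW: x => x; rewrite (scale_pi b x) (scale_pi a) (scale_pi _ x) scalerA. Qed.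
Fact quot_scale1 : left_id 1 scale.
Proof. by elim/quotW => x; rewrite scale_pi scale1r. Qed.
Fact quot_scaleDr : right_distributive scale +%R.
Proof.
move=> a; elim/quotW => x; elim/quotW => y.
by rewrite -raddfD (scale_pi a (x + y)) (scale_pi a x) (scale_pi a y) scalerDr raddfD.
Qed.
Fact quot_scaleDl x : {morph scale^~ x : a b / a + b}.
Proof. by elim/quotW: x => x a b; rewrite (scale_pi (a + b)) (scale_pi a) (scale_pi b) scalerDl raddfD. Qed.
HB.instance Definition _ := GRing.Zmodule_isLmodule.Build R quot_mod
  quot_scaleA quot_scale1 quot_scaleDr quot_scaleDl.

Lemma sub_modP x : K x <-> exists y : sub_mod, val y = x.
Proof.
split=> [Kx|[y <-]]; last exact/asboolP/(valP y).
have xK : x \in sub_pred Ks by apply/asboolP.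
by exists (exist _ x xK).
Qed.

Lemma submod_exists : exists (S : lmodType R) (i : {linear S -> M}),
  injective i /\ forall x, K x <-> exists y, i y = x.
Proof.
exists sub_mod, (val : {linear sub_mod -> M}).
by split; [apply: val_inj | apply: sub_modP].
Qed.

Lemma quot_exists : exists (Q : lmodType R) (p : {linear M -> Q}),
  surjective p /\ forall x, p x = 0 <-> K x.
Proof.
have [|p pE] := @linear_of R M quot_mod (\pi_Q).
  by move=> a x y; rewrite raddfD /= -scale_pi.
exists quot_mod, p; split=> [|x]; first by elim/quotW => x; exists x; rewrite pE.
have pi0 : \pi_Q (0 : M) = 0 by rewrite raddf0.
rewrite pE -{1}pi0; split=> [/eqP|Kx].
  by rewrite -Quotient.idealrBE subr0 => /asboolP.
by apply/eqP; rewrite -Quotient.idealrBE subr0; apply/asboolP.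
Qed.

End SubQuotient.

Section Factor.
Variable R : pzRingType.
Implicit Types M N X Y Q S : lmodType R.

(** Choose a set-theoretic section [s] of [p]: the composite [f \o s] is linear because [f] kills
    the kernel of [p]. *)
Lemma factor_surj M Q X (p : {linear M -> Q}) (f : {linear M -> X}) :
  surjective p -> (forall x, p x = 0 -> f x = 0) ->
  exists h : {linear Q -> X}, forall x, h (p x) = f x.
Proof.
move=> ps pf; have [s sK] := choice ps.
have fs x : f (s (p x)) = f x.
  apply/eqP; rewrite -subr_eq0 -linearB /=; apply/eqP/pf.
  by rewrite linearB /= sK subrr.
have lh : linear (f \o s).
  by move=> a x y /=; rewrite -linearP -[RHS]fs linearP /= !sK.
by have [h hE] := linear_of lh; exists h => x; rewrite hE /= fs.
Qed.

Lemma factor_inj S M X (i : {linear S -> M}) (f : {linear X -> M}) :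
  injective i -> (forall x, exists y, i y = f x) ->
  exists h : {linear X -> S}, forall x, i (h x) = f x.
Proof.
move=> ii fi; have [h hK] := choice fi.
have lh : linear h by move=> a x y; apply: ii; rewrite linearP !hK linearP.
by have [g gE] := linear_of lh; exists g => x; rewrite gE.
Qed.

Lemma ker_exists M N (f : {linear M -> N}) :
  exists (K : lmodType R) (i : {linear K -> M}), injective i /\ exact_at i f.
Proof.
have [K [i [ii iE]]] := submod_exists (submodule_ker f).
by exists K, i; split.
Qed.

Lemma im_exists M N (f : {linear M -> N}) :
  exists (I : lmodType R) (p : {linear M -> I}) (i : {linear I -> N}),
    [/\ surjective p, injective i & forall x, i (p x) = f x].
Proof.
have [I [i [ii iE]]] := submod_exists (submodule_range f).
have [|p pE] := @factor_inj I N M i f ii; first by move=> x; apply/iE; exists x.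
exists I, p, i; split=> // y.
have /iE[x fx] : exists z, i z = i y by exists y.
by exists x; apply: ii; rewrite pE.
Qed.

Lemma cok_exists M N (f : {linear M -> N}) :
  exists (Q : lmodType R) (p : {linear N -> Q}), surjective p /\ exact_at f p.
Proof. exact: quot_exists (submodule_range f). Qed.

Lemma pullback_exists M N X (f : {linear M -> X}) (g : {linear N -> X}) :
  exists (Z : lmodType R) (p : {linear Z -> M}) (q : {linear Z -> N}),
    [/\ forall z, f (p z) = g (q z),
        forall x y, f x = g y -> exists z, p z = x /\ q z = y &
        forall z, p z = 0 -> q z = 0 -> z = 0].
Proof.
have Ks : submodule (fun z : M * N => f z.1 = g z.2).
  split=> [|a x y hx hy] /=; first by rewrite !linear0.
  by rewrite !linearP hx hy.
have [Z [i [ii iE]]] := submod_exists Ks.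
exists Z, (fst \o i), (snd \o i); split=> [z|x y fg|z z1 z2] /=.
- by apply/iE; exists z.
- by have /iE[z zE] : f (x, y).1 = g (x, y).2 by []; exists z; rewrite zE.
- by apply: (ker0_inj ii); move: z1 z2 => /=; case: (i z) => x y /= -> ->.
Qed.

End Factor.

(** * Projective dimension *)

Section ShortExact.
Variable R : pzRingType.
Implicit Types K M N P X Y Z Q : lmodType R.

Definition ses K M N (i : {linear K -> M}) (p : {linear M -> N}) : Prop :=
  [/\ injective i, surjective p & exact_at i p].

Lemma ses_comp0 K M N (i : {linear K -> M}) (p : {linear M -> N}) x :
  ses i p -> p (i x) = 0.
Proof. by case=> _ _ ip; apply/ip; exists x. Qed.

Lemma ses_ker M N (p : {linear M -> N}) : surjective p ->
  exists (K : lmodType R) (i : {linear K -> M}), ses i p.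
Proof. by have [K [i [ii ip]]] := ker_exists p; exists K, i; split. Qed.

Lemma ses_cok M N (i : {linear M -> N}) : injective i ->
  exists (Q : lmodType R) (p : {linear N -> Q}), ses i p.
Proof. by have [Q [p [ps ip]]] := cok_exists i; exists Q, p; split. Qed.

Lemma pair_map X Y Z (f : {linear X -> Y}) (g : {linear X -> Z}) :
  exists h : {linear X -> (Y * Z)%type}, forall x, h x = (f x, g x).
Proof.
have [|h hE] := @linear_of R X (Y * Z)%type (fun x => (f x, g x)).
  by move=> a x y; rewrite !linearP.
by exists h.
Qed.

Definition is_pullback M N X Z (f : {linear M -> X}) (g : {linear N -> X})
    (p : {linear Z -> M}) (q : {linear Z -> N}) : Prop :=
  [/\ forall z, f (p z) = g (q z),
      forall x y, f x = g y -> exists z, p z = x /\ q z = y &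
      forall z, p z = 0 -> q z = 0 -> z = 0].

Lemma pullback_sym M N X Z (f : {linear M -> X}) (g : {linear N -> X})
    (p : {linear Z -> M}) (q : {linear Z -> N}) :
  is_pullback f g p q -> is_pullback g f q p.
Proof.
case=> fg ex inj; split=> [z|x y gf|z z1 z2]; first by rewrite fg.
- by have [z [z1 z2]] := ex _ _ (esym gf); exists z.
- exact: inj.
Qed.

(** Base change of a short exact sequence: the kernel of [f] enters the pullback as the pairs (i x,
    0). *)
Lemma pullback_ses K M N X Z (i : {linear K -> M}) (f : {linear M -> X})
    (g : {linear N -> X}) (p : {linear Z -> M}) (q : {linear Z -> N}) :
  is_pullback f g p q -> ses i f ->
  exists j : {linear K -> Z}, ses j q /\ forall x, p (j x) = i x.
Proof.
move=> [fg ex inj] sif; have [ii fs ei] := sif.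
have jex x : exists z, p z = i x /\ q z = 0.
  by apply: ex; rewrite linear0 (ses_comp0 _ sif).
have [j jE] := choice jex.
have pq z z' : p z = p z' -> q z = q z' -> z = z'.
  move=> pz qz; apply/eqP; rewrite -subr_eq0; apply/eqP/inj.
    by rewrite linearB /= pz subrr.
  by rewrite linearB /= qz subrr.
have [|h hE] := @linear_of _ _ _ j.
  move=> a x y; apply: pq; first by rewrite linearP !(jE _).1 linearP.
  by rewrite linearP !(jE _).2 scaler0 addr0.
exists h; split=> [|x]; last by rewrite hE (jE x).1.
split=> [x y|y|z].
- by rewrite !hE => jxy; apply: ii; rewrite -!(jE _).1 jxy.
- by have [x fx] := fs (g y); have [z [_ <-]] := ex _ _ fx; exists z.
split=> [qz|[x <-]]; last by rewrite hE (jE x).2.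
have /ei[x ix] : f (p z) = 0 by rewrite fg qz linear0.
by exists x; rewrite hE; apply: pq; rewrite ?(jE x).1 ?(jE x).2.
Qed.

Lemma ses_split_iso K M N (i : {linear K -> M}) (p : {linear M -> N})
    (s : {linear N -> M}) :
  ses i p -> (forall x, p (s x) = x) -> isomorphic (K * N)%type M.
Proof.
move=> [ii ps ip] sK.
exists ((i \o fst) \+ (s \o snd) : {linear (K * N)%type -> M}).
apply: inj_surj_bij => [|y] /=.
  apply: inj_ker0 => -[x y] /= xy0.
  have y0 : y = 0.
    have := congr1 p xy0; rewrite linearD /= sK linear0.
    by rewrite (_ : p (i x) = 0) ?add0r //; apply/ip; exists x.
  by move: xy0; rewrite y0 linear0 addr0 => /(ker0_inj ii) ->.
have /ip[x xE] : p (y - s (p y)) = 0 by rewrite linearB /= sK subrr.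
by exists (x, p y); rewrite /= xE subrK.
Qed.

Lemma ses_retract_iso K M N (i : {linear K -> M}) (p : {linear M -> N})
    (r : {linear M -> K}) :
  ses i p -> (forall x, r (i x) = x) -> isomorphic (K * N)%type M.
Proof.
move=> sip rK; have [ii ps ip] := sip.
have [|s sE] := @factor_surj _ _ _ _ p (idfun \- (i \o r) : {linear M -> M}) ps.
  by move=> x /ip[y <-] /=; rewrite rK subrr.
apply: (ses_split_iso (s := s) sip) => x; have [y <-] := ps x.
by rewrite sE /= linearB /= (ses_comp0 _ sip) subr0.
Qed.

Definition retract X Y : Prop :=
  exists (f : {linear X -> Y}) (g : {linear Y -> X}), forall x, g (f x) = x.

Lemma retract_iso X Y : isomorphic X Y -> retract X Y.
Proof. by case=> f /linear_inverse[g fK _]; exists f, g. Qed.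

Lemma retract_trans X Y Z : retract X Y -> retract Y Z -> retract X Z.
Proof.
move=> [f [g gf]] [f' [g' gf']].
by exists (f' \o f), (g \o g') => x /=; rewrite gf' gf.
Qed.

Lemma retract_prod X Y : retract X (X * Y)%type.
Proof.
have [h hE] := pair_map (idfun : {linear X -> X}) (\0 : {linear X -> Y}).
by exists h, fst => x; rewrite hE.
Qed.

Lemma ses_prod X Y : exists i : {linear X -> (X * Y)%type},
  ses i (snd : {linear (X * Y)%type -> Y}).
Proof.
have [i iE] := pair_map (idfun : {linear X -> X}) (\0 : {linear X -> Y}).
exists i; split=> [x y|y|[x y]] /=; first by rewrite !iE => -[].
- by exists (0, y).
- by split=> [->|[z]]; [exists x; rewrite iE | rewrite iE => -[_ <-]].
Qed.

Lemma retract_split X Y : retract X Y ->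
  exists Z : lmodType R, isomorphic (X * Z)%type Y.
Proof.
move=> [f [g gf]].
have fi : injective f by apply: (can_inj gf).
by have [Z [p fp]] := ses_cok fi; exists Z; apply: (ses_retract_iso fp gf).
Qed.

End ShortExact.

Section Projective.
Variable R : pzRingType.
Implicit Types K M N P X Y Z Q : lmodType R.

Lemma projective_retract P X : retract X P -> projective P -> projective X.
Proof.
move=> [f [g gf]] pP M N p h ps.
by have [k kE] := pP _ _ p (h \o g) ps; exists (k \o f) => x /=; rewrite kE /= gf.
Qed.

Lemma projective_iso P Q : isomorphic P Q -> projective P -> projective Q.
Proof. by move=> /iso_sym/retract_iso/projective_retract. Qed.

Lemma projective_prod P Q : projective P -> projective Q -> projective (P * Q)%type.
Proof.
move=> pP pQ M N p f ps.
have [i1 i1E] := pair_map (idfun : {linear P -> P}) (\0 : {linear P -> Q}).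
have [i2 i2E] := pair_map (\0 : {linear Q -> P}) (idfun : {linear Q -> Q}).
have [h1 h1E] := pP _ _ p (f \o i1) ps.
have [h2 h2E] := pQ _ _ p (f \o i2) ps.
exists ((h1 \o fst) \+ (h2 \o snd) : {linear (P * Q)%type -> M}) => -[x y] /=.
rewrite linearD /= h1E h2E /= i1E i2E -linearD /=; congr (f _).
by congr pair; rewrite /= ?addr0 ?add0r.
Qed.

Lemma projective_zero P : zero_module P -> projective P.
Proof.
move=> P0 M N p f _; exists (\0 : {linear P -> M}) => x /=.
by rewrite (P0 x) !linear0.
Qed.

Lemma projective_section P M (p : {linear M -> P}) : projective P -> surjective p ->
  exists s : {linear P -> M}, forall x, p (s x) = x.
Proof. by move=> pP ps; apply: (pP _ _ p (idfun : {linear P -> P})). Qed.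

Definition free n : lmodType R := dsum (fun _ : 'I_n => R^o).

Lemma free_map n M (s : 'I_n -> M) :
  exists f : {linear free n -> M}, forall c, f c = \sum_i (c i : R) *: s i.
Proof.
have [|f fE] := @linear_of R (free n) M (fun c => \sum_i (c i : R) *: s i).
  move=> a x y; rewrite scaler_sumr -big_split /=; apply: eq_bigr => i _.
  by rewrite scalerA -scalerDl.
by exists f.
Qed.

Lemma free_basis n : exists b : 'I_n -> free n,
  (forall i M (s : 'I_n -> M), \sum_j (b i j : R) *: s j = s i) /\
  forall c : free n, c = \sum_i (c i : R) *: b i.
Proof.
exists (fun i j => (j == i)%:R); split=> [i M s|c].
  rewrite (bigD1 i) //= eqxx scale1r big1 ?addr0 // => j /negPf->.
  by rewrite scale0r.
have ev j (c' : 'I_n -> free n) : (\sum_i c' i) j = \sum_i c' i j.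
  by elim/big_ind2: _ => // x1 x2 y1 y2 <- <-.
apply: functional_extensionality_dep => j; rewrite ev (bigD1 j) //= big1.
  by rewrite addr0 -[RHS]/((c j : R) * (j == j)%:R) eqxx mulr1.
by move=> i /negPf; rewrite eq_sym => ij; rewrite -[LHS]/((c i : R) * (j == i)%:R) ij mulr0.
Qed.

Lemma free_projective n : projective (free n).
Proof.
move=> M N p f ps; have [b [bE cE]] := free_basis n.
have [s sE] := choice (fun i => ps (f (b i))).
have [h hE] := free_map s; exists h => c; rewrite hE linear_sum {2}[c]cE linear_sum.
by apply: eq_bigr => i _; rewrite !linearZ /= sE.
Qed.

Lemma fg_free M : finitely_generated M <->
  exists n (p : {linear free n -> M}), surjective p.
Proof.
split=> [[n [s sE]]|[n [p ps]]].
  have [p pE] := free_map s; exists n, p => x.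
  by have [c ->] := sE x; exists c; rewrite pE.
have [b [_ cE]] := free_basis n; exists n, (fun i => p (b i)) => x.
have [c <-] := ps x; exists c; rewrite {1}[c]cE linear_sum.
by apply: eq_bigr => i _; rewrite linearZ.
Qed.

Lemma fg_free_mod n : finitely_generated (free n).
Proof. by apply/fg_free; exists n, idfun => x; exists x. Qed.

Lemma fg_surj M N (p : {linear M -> N}) :
  surjective p -> finitely_generated M -> finitely_generated N.
Proof.
move=> ps /fg_free[n [q qs]]; apply/fg_free; exists n, (p \o q) => y.
by have [x <-] := ps y; have [z <-] := qs x; exists z.
Qed.

Lemma fg_iso M N : isomorphic M N -> finitely_generated M -> finitely_generated N.
Proof. by case=> f /bij_surj; apply: fg_surj. Qed.

Lemma fg_ring : finitely_generated R^o.
Proof. exists 1%N, (fun=> 1 : R^o) => x; exists (fun=> x : R); rewrite big_ord1.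
exact/esym/mulr1. Qed.

Lemma fg_zero M : zero_module M -> finitely_generated M.
Proof. by move=> M0; exists 0%N, (fun=> 0) => x; exists (fun=> 0); apply: etrans (M0 x) (esym (M0 _)). Qed.

Lemma fg_ext K M N (i : {linear K -> M}) (p : {linear M -> N}) : ses i p ->
  finitely_generated K -> finitely_generated N -> finitely_generated M.
Proof.
move=> [_ ps ip] [n [s sE]] [m [t tE]].
have [t' t'E] := choice (fun j => ps (t j)).
pose u (j : 'I_(n + m)) := match split j with inl j => i (s j) | inr j => t' j end.
exists (n + m)%N, u => x; have [c cE] := tE (p x).
have /ip[y yE] : p (x - \sum_j c j *: t' j) = 0.
  rewrite linearB /= cE linear_sum -sumrB big1 // => j _.
  by rewrite linearZ /= t'E subrr.
have [d dE] := sE y.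
exists (fun j => match split j with inl j => d j | inr j => c j end).
rewrite -[LHS](subrK (\sum_j c j *: t' j)) -yE dE linear_sum big_split_ord /=.
congr (_ + _); apply: eq_bigr => j _; rewrite /u.
  by rewrite linearZ /= (unsplitK (inl _ j)).
by rewrite (unsplitK (inr _ j)).
Qed.

Lemma fg_prod M N :
  finitely_generated M -> finitely_generated N -> finitely_generated (M * N)%type.
Proof.
by have [i] := ses_prod M N; apply: fg_ext.
Qed.

(** The bound is witnessed by some chain of syzygies, a form suited to induction. Independence of
    the chosen cover is [pd_ker], and agreement with projective resolutions is [pdim_le_pd]. *)
Fixpoint pd n M : Prop :=
  if n is n'.+1 then
    exists (P : lmodType R) (p : {linear P -> M}) (K : lmodType R)
      (i : {linear K -> P}), [/\ projective P, ses i p & pd n' K]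
  else projective M.

Definition pdfin M : Prop := exists n, pd n M.

Lemma pd_iso n M N : isomorphic M N -> pd n M -> pd n N.
Proof.
case: n => [|n]; first exact: projective_iso.
move=> [f fb] [P [p [K [i [pP [ii ps ip] Kn]]]]].
have [g fK gK] := linear_inverse fb.
exists P, (f \o p), K, i; split=> //; split=> // [y|x] /=.
  by have [x px] := ps (g y); exists x; rewrite /= px gK.
rewrite -ip; split=> [|->]; last exact: linear0.
by apply: ker0_inj; apply: can_inj fK.
Qed.

Lemma pd_zero n M : zero_module M -> pd n M.
Proof.
elim: n M => [|n IHn] M M0; first exact: projective_zero.
exists M, idfun, M, idfun; split; [exact: projective_zero| |exact: IHn].
by split=> // x; [exists x | split=> [|_]; [exists x | apply: M0]].
Qed.

Lemma pd_proj n M : projective M -> pd n M.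
Proof.
case: n => // n pM; have [|K [i si]] := @ses_ker _ M M idfun; first by move=> x; exists x.
exists M, idfun, K, i; split=> //; apply: pd_zero => x.
by apply: (ker0_inj (f := i)); [case: si | apply: (ses_comp0 x si)].
Qed.

Lemma pdS n M : pd n M -> pd n.+1 M.
Proof.
elim: n M => [|n IHn] M; first exact: (@pd_proj 1).
by move=> [P [p [K [i [pP si Kn]]]]]; exists P, p, K, i; split=> //; apply: IHn.
Qed.

Lemma pd_le n m M : (n <= m)%N -> pd n M -> pd m M.
Proof. by move=> /subnK <-; elim: (m - n)%N => // k IH /IH; apply: pdS. Qed.

Lemma pd_prodproj n M P : pd n M -> projective P -> pd n (M * P)%type.
Proof.
case: n => [|n]; first exact: projective_prod.
move=> [Q [q [K [i [pQ si Kn]]]]] pP; have [ii qs ei] := si.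
have [h hE] := pair_map (q \o fst : {linear (Q * P)%type -> M}) snd.
have [j jE] := pair_map i (\0 : {linear K -> P}).
exists (Q * P)%type, h, K, j; split=> //; first exact: projective_prod.
split=> [x y|[x y]|[x y]].
- by rewrite !jE => -[/ii].
- by have [z <-] := qs x; exists (z, y); rewrite hE.
rewrite hE /=; split=> [[/ei[z <-] ->]|[z]]; first by exists z; rewrite jE.
by rewrite jE => -[<- <-]; rewrite (ses_comp0 _ si).
Qed.

(** The pullback of the two covers splits over [P] and over [P'], which computes it in two ways. *)
Lemma schanuel M P K P' K' (i : {linear K -> P}) (p : {linear P -> M})
    (i' : {linear K' -> P'}) (p' : {linear P' -> M}) :
  projective P -> projective P' -> ses i p -> ses i' p' ->
  isomorphic (K * P')%type (K' * P)%type.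
Proof.
move=> pP pP' si si'; have [Z [q [q' pb]]] := pullback_exists p p'.
have [j [sj _]] := pullback_ses pb si.
have [j' [sj' _]] := pullback_ses (pullback_sym pb) si'.
have [s sE] : exists s : {linear P' -> Z}, forall x, q' (s x) = x.
  by apply: projective_section => //; case: sj.
have [s' s'E] : exists s : {linear P -> Z}, forall x, q (s x) = x.
  by apply: projective_section => //; case: sj'.
apply: iso_trans (ses_split_iso sj sE) _.
exact: iso_sym (ses_split_iso sj' s'E).
Qed.

(** The first hypothesis is the induction hypothesis of [pd_summand]; discharging it with that lemma
    gives [pd_ker]. *)
Lemma pd_ker_summand n M P K (i : {linear K -> P}) (p : {linear P -> M}) :
  (forall X Y, pd n (X * Y)%type -> pd n X) ->
  projective P -> ses i p -> pd n.+1 M -> pd n K.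
Proof.
move=> sum pP si [P' [p' [K' [i' [pP' si' Kn]]]]].
apply: (sum _ P'); apply: pd_iso (pd_prodproj Kn pP).
exact: schanuel pP' pP si' si.
Qed.

(** Cover [X] and [Y] separately by the same projective [P]. The product of the two kernels is a
    syzygy of [X * Y], hence has smaller dimension by Schanuel, and the first kernel is a summand of
    it. *)
Lemma pd_summand n X Y : pd n (X * Y)%type -> pd n X.
Proof.
elim: n X Y => [|n IHn] X Y.
  by apply: projective_retract; apply: retract_prod.
move=> pXY; have [P [p [_ [_ [pP [_ ps _] _]]]]] := pXY.
have [|K1 [i1 s1]] := @ses_ker _ P X (fst \o p).
  by move=> x; have [z zE] := ps (x, 0); exists z; rewrite /= zE.
have [|K2 [i2 s2]] := @ses_ker _ P Y (snd \o p).
  by move=> x; have [z zE] := ps (0, x); exists z; rewrite /= zE.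
exists P, (fst \o p), K1, i1; split=> //; apply: (IHn _ K2).
have [i iE] := pair_map (i1 \o fst : {linear (K1 * K2)%type -> P}) (i2 \o snd).
have [q qE] := pair_map (fst \o p \o fst : {linear (P * P)%type -> X})
                        (snd \o p \o snd).
apply: (pd_ker_summand (p := q) (i := i) IHn) pXY; first exact: projective_prod.
have [ii1 ps1 e1] := s1; have [ii2 ps2 e2] := s2.
split=> [[x y] [x' y']|[x y]|[x y]].
- by rewrite !iE => -[/ii1/= -> /ii2/= ->].
- by have [z zE] := ps1 x; have [t tE] := ps2 y; exists (z, t); rewrite qE /= -zE -tE.
rewrite qE; split=> [[/e1[z <-] /e2[t <-]]|[[z t]]]; first by exists (z, t); rewrite iE.
rewrite iE => -[<- <-] /=.
by congr pair; [apply: (ses_comp0 z s1) | apply: (ses_comp0 t s2)].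
Qed.

Lemma pd_retract n X Y : retract X Y -> pd n Y -> pd n X.
Proof.
by move=> /retract_split[Z XZ] /(pd_iso (iso_sym XZ)) /pd_summand.
Qed.

Lemma pd_ker n M P K (i : {linear K -> P}) (p : {linear P -> M}) :
  projective P -> ses i p -> pd n.+1 M -> pd n K.
Proof. exact/pd_ker_summand/pd_summand. Qed.

(** Horseshoe lemma: lift the cover of [Z] to [Y] and add the cover of [X]; the kernels again form a
    short exact sequence. *)
Lemma pd_ext n X Y Z (i : {linear X -> Y}) (p : {linear Y -> Z}) :
  ses i p -> pd n X -> pd n Z -> pd n Y.
Proof.
elim: n X Y Z i p => [|n IHn] X Y Z i p si.
  move=> pX pZ; have [|s sE] := projective_section (p := p) pZ; first by case: si.
  exact: projective_iso (ses_split_iso si sE) (projective_prod pX pZ).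
move=> [P1 [p1 [K1 [i1 [pP1 s1 Kn1]]]]] [P2 [p2 [K2 [i2 [pP2 s2 Kn2]]]]].
have [ii ps ei] := si; have [ii1 ps1 e1] := s1; have [ii2 ps2 e2] := s2.
have [l lE] := pP2 _ _ p p2 ps.
pose q : {linear (P1 * P2)%type -> Y} := (i \o p1 \o fst) \+ (l \o snd).
have pq x : p (q x) = p2 x.2 by rewrite /q /= linearD /= (ses_comp0 _ si) add0r lE.
have [|K [j sj]] := @ses_ker _ _ _ q.
  move=> y; have [b bE] := ps2 (p y).
  have /ei[x xE] : p (y - l b) = 0 by rewrite linearB /= lE bE subrr.
  by have [a aE] := ps1 x; exists (a, b); rewrite /q /= aE xE subrK.
have [ji qs ej] := sj.
exists (P1 * P2)%type, q, K, j; split=> //; first exact: projective_prod.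
have [g gE] := pair_map i1 (\0 : {linear K1 -> P2}).
have [|u uE] := @factor_inj _ K _ K1 j g ji.
  by move=> x; apply/ej; rewrite gE /q /= (ses_comp0 _ s1) !linear0 addr0.
have [|v vE] := @factor_inj _ K2 _ K i2 (snd \o j) ii2.
  by move=> x; apply/e2; rewrite /= -pq (ses_comp0 _ sj) linear0.
apply: (IHn K1 K K2 u v) => //; split=> [x y|y|x].
- by move=> /(congr1 j); rewrite !uE !gE => -[/ii1].
- have /ei[x xE] : p (l (i2 y)) = 0 by rewrite lE (ses_comp0 _ s2).
  have [a aE] := ps1 x.
  have /ej[z zE] : q (- a, i2 y) = 0 by rewrite /q /= !linearN /= aE xE addNr.
  by exists z; apply: ii2; rewrite vE /= zE.
split=> [vx|[y <-]]; last first.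
  by apply: ii2; rewrite vE /= uE gE linear0.
have j2 : (j x).2 = 0 by rewrite -[LHS]/((snd \o j) x) -vE vx linear0.
have /e1[y yE] : p1 (j x).1 = 0.
  by apply: (ker0_inj ii); have := ses_comp0 x sj; rewrite /q /= j2 linear0 addr0.
by exists y; apply: ji; rewrite uE gE yE [RHS]surjective_pairing j2.
Qed.

(** A cover of [Y] with kernel [K] also covers [Z], and the new kernel is an extension of [X] by
    [K]. *)
Lemma pd_cok n X Y Z (i : {linear X -> Y}) (p : {linear Y -> Z}) :
  ses i p -> pd n X -> pd n Y -> pd n.+1 Z.
Proof.
move=> si pX pY; have [ii ps ei] := si.
have [P [q [K [j [pP sj Kn]]]]] := pdS pY.
have [|L [l sl]] := @ses_ker _ _ _ (p \o q).
  by move=> z; have [y <-] := ps z; case: sj => _ /(_ y)[x <-] _; exists x.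
exists P, (p \o q), L, l; split=> //.
have [li _ el] := sl; have [ji qs ej] := sj.
have [|u uE] := @factor_inj _ L _ K l j li.
  by move=> x; apply/el; rewrite /= (ses_comp0 _ sj) linear0.
have [|v vE] := @factor_inj _ X _ L i (q \o l) ii.
  by move=> x; apply/ei; apply: (ses_comp0 x sl).
apply: (@pd_ext n K L X u v) => //; split=> [x y /(congr1 l)|y|x].
- by rewrite !uE => /ji.
- have [x xE] := qs (i y).
  have /el[z zE] : (p \o q) x = 0 by rewrite /= xE (ses_comp0 _ si).
  by exists z; apply: ii; rewrite vE /= zE.
split=> [vx|[y <-]].
  have /ej[y yE] : q (l x) = 0 by rewrite -[LHS]/((q \o l) x) -vE vx linear0.
  by exists y; apply: li; rewrite uE.
by apply: ii; rewrite vE /= uE (ses_comp0 _ sj) linear0.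
Qed.

(** The pullback of [Y] and a cover [P] of [Z] is isomorphic to [X * P], since [P] is projective,
    and is also an extension of [Y] by the syzygy of [Z]. *)
Lemma pd_ker_ses n X Y Z (i : {linear X -> Y}) (p : {linear Y -> Z}) :
  ses i p -> pd n Y -> pd n.+1 Z -> pd n X.
Proof.
move=> si pY [P [q [K [j [pP sj Kn]]]]].
have [W [a [b pb]]] := pullback_exists p q.
have [u [su _]] := pullback_ses pb si.
have [v [sv _]] := pullback_ses (pullback_sym pb) sj.
have [s sE] : exists s : {linear P -> W}, forall x, b (s x) = x.
  by apply: projective_section => //; case: su.
apply: (@pd_summand _ _ P); apply: pd_iso (iso_sym (ses_split_iso su sE)) _.
exact: pd_ext sv Kn pY.
Qed.

Lemma pdfin_retract X Y : retract X Y -> pdfin Y -> pdfin X.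
Proof. by move=> XY [n]; exists n; apply: pd_retract XY _. Qed.

Lemma pdfin_iso X Y : isomorphic X Y -> pdfin X -> pdfin Y.
Proof. by move=> XY [n]; exists n; apply: pd_iso XY _. Qed.

Lemma pdfin_ext X Y Z (i : {linear X -> Y}) (p : {linear Y -> Z}) :
  ses i p -> pdfin X -> pdfin Z -> pdfin Y.
Proof.
move=> si [n Xn] [m Zm]; exists (maxn n m); apply: pd_ext si _ _.
  exact: pd_le (leq_maxl _ _) Xn.
exact: pd_le (leq_maxr _ _) Zm.
Qed.

Lemma pdfin_cok X Y Z (i : {linear X -> Y}) (p : {linear Y -> Z}) :
  ses i p -> pdfin X -> pdfin Y -> pdfin Z.
Proof.
move=> si [n Xn] [m Ym]; exists (maxn n m).+1; apply: pd_cok si _ _.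
  exact: pd_le (leq_maxl _ _) Xn.
exact: pd_le (leq_maxr _ _) Ym.
Qed.

Lemma pdfin_ker X Y Z (i : {linear X -> Y}) (p : {linear Y -> Z}) :
  ses i p -> pdfin Y -> pdfin Z -> pdfin X.
Proof.
move=> si [n Yn] [m Zm]; exists (maxn n m); apply: pd_ker_ses si _ _.
  exact: pd_le (leq_maxl _ _) Yn.
by apply: pd_le Zm; rewrite leqW ?leq_maxr.
Qed.

End Projective.

(** * Vanishing of Ext^1 and finite powers *)

Section Resolutions.
Variable R : pzRingType.
Implicit Types K M N P X Y Z : lmodType R.

Section Cons.
Variables (K P M : lmodType R) (i : {linear K -> P}) (p : {linear P -> M}).
Hypotheses (pP : projective P) (si : ses i p).
Variable Q : proj_resolution K.

Definition cons_obj j : lmodType R := if j is j'.+1 then res_obj Q j' else P.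
Definition cons_d j : {linear cons_obj j.+1 -> cons_obj j} :=
  match j return {linear cons_obj j.+1 -> cons_obj j} with
  | 0 => i \o res_aug Q
  | j'.+1 => res_d Q j'
  end.

Lemma cons_proj j : projective (cons_obj j).
Proof. by case: j => //= j; apply: (@res_proj R K Q). Qed.
Lemma cons_exact0 : exact_at (cons_d 0) (p : {linear cons_obj 0 -> M}).
Proof.
move=> y; split=> [py|[x <-]]; last exact: (ses_comp0 _ si).
have [_ _ /(_ y)/iffLR/(_ py)[z <-]] := si.
by have [x <-] := res_surj Q z; exists x.
Qed.
Lemma cons_exactS j : exact_at (cons_d j.+1) (cons_d j).
Proof.
case: j => [|j]; last exact: (@res_exactS R K Q j).
move=> y; apply: iff_trans (@res_exact0 R K Q y); split=> [|/= ->]; last exact: linear0.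
have [ii _ _] := si; exact: (ker0_inj (f := i)).
Qed.

Definition cons_res : proj_resolution M :=
  @ProjResolution R M cons_obj cons_d p cons_proj (let: And3 _ ps _ := si in ps)
    cons_exact0 cons_exactS.

End Cons.

Lemma res_tail M (P : proj_resolution M) K (i : {linear K -> res_obj P 0}) :
  ses i (res_aug P) ->
  exists Q : proj_resolution K, forall j, res_obj Q j = res_obj P j.+1.
Proof.
move=> si; have [ii _ ei] := si.
have [|a aE] := @factor_inj _ K _ _ i (res_d P 0) ii.
  by move=> x; apply/ei/res_exact0; exists x.
have as_ : surjective a.
  move=> y; have /res_exact0[x xE] : res_aug P (i y) = 0 by rewrite (ses_comp0 _ si).
  by exists x; apply: ii; rewrite aE.
have e0 : exact_at (res_d P 1) a.
  move=> y; apply: iff_trans (@res_exactS R M P 0 y); rewrite -aE.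
  by split=> [->|/(ker0_inj ii)//]; rewrite linear0.
by exists (@ProjResolution R K (fun j => res_obj P j.+1) (fun j => res_d P j.+1) a
  (fun j => @res_proj R M P j.+1) as_ e0 (fun j => @res_exactS R M P j.+1)).
Qed.

Lemma zero_module_free0 : zero_module (free R 0).
Proof. by move=> x; apply: functional_extensionality_dep => -[]. Qed.

(** Dropping degree 0 of a resolution ([res_tail]) and splicing a new degree 0 onto one ([cons_res])
    mirror the recursion of [pd]. *)
Lemma pdim_le_pd n M : pdim_le M n <-> pd n M.
Proof.
elim: n M => [|n IHn] M; split.
- move=> [P P0]; apply: projective_iso (@res_proj R M P 0).
  exists (res_aug P); apply: inj_surj_bij (res_surj P).
  by apply: inj_ker0 => x /res_exact0[y <-]; rewrite (P0 1%N isT y) linear0.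
- move=> pM; have Z0 := zero_module_free0.
  (* A projective [M] is resolved by itself, spliced onto the zero resolution of the zero module
     [free R 0]. *)
  pose Z (j : nat) := free R 0; pose d j : {linear Z j.+1 -> Z j} := \0.
  have ex (X Y : lmodType R) (f : {linear Z 0 -> X}) (g : {linear X -> Y}) :
      injective g -> exact_at f g.
    move=> gi x; split=> [/(ker0_inj gi)->|[z <-]]; first by exists 0; rewrite linear0.
    by rewrite (Z0 z) !linear0.
  have ei : injective (d 0) by move=> x y _; rewrite (Z0 x) (Z0 y).
  pose Q := @ProjResolution R (free R 0) Z d idfun (fun=> projective_zero Z0)
    (fun x => ex_intro _ x erefl) (ex _ _ _ idfun (fun x y => id)) (fun=> ex _ _ _ _ ei).
  have si : ses (\0 : {linear free R 0 -> M}) (idfun : {linear M -> M}).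
    split=> [x y _|x|]; [by rewrite (Z0 x) (Z0 y) | by exists x |].
    exact: (ex _ _ _ idfun (fun x y => id)).
  by exists (cons_res pM si Q) => -[|j] _ //=; apply: Z0.
- move=> [P Pn].
  have [K [i si]] := ses_ker (res_surj P); have [Q QE] := res_tail si.
  exists (res_obj P 0), (res_aug P), K, i; split=> //; first exact: (@res_proj R M P).
  by apply/IHn; exists Q => j nj; rewrite QE; apply: Pn.
move=> [P [p [K [i [pP si /IHn[Q Qn]]]]]].
by exists (cons_res pP si Q) => -[|j] //=; apply: Qn.
Qed.

Lemma pdim_finiteE M : pdim_finite M <-> pdfin M.
Proof. by split=> -[n /pdim_le_pd]; exists n. Qed.

Lemma PfinE M : Pfin M <-> finitely_generated M /\ pdfin M.
Proof. by split=> -[fM /pdim_finiteE]. Qed.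

End Resolutions.

Section Ext1.
Variable R : pzRingType.
Implicit Types K M N P X Y Z W : lmodType R.

(* Ext^1(N, Y) = 0, tested on all short exact sequences ending in N. *)
Definition ext1 N Y : Prop :=
  forall K M (i : {linear K -> M}) (p : {linear M -> N}), ses i p ->
  forall f : {linear K -> Y}, exists h : {linear M -> Y}, forall x, h (i x) = f x.

(** One projective presentation suffices: the middle term of any other sequence ending in [N] is a
    quotient of [K' * P], and [f] on [K'] together with the extension [h] on [P] descends to that
    quotient. *)
Lemma ext1_of_pres N Y K P (i : {linear K -> P}) (p : {linear P -> N}) :
  projective P -> ses i p ->
  (forall f : {linear K -> Y}, exists h : {linear P -> Y}, forall x, h (i x) = f x) ->
  ext1 N Y.
Proof.
move=> pP si ext K' M i' p' si' f.
have [ii ps ei] := si; have [ii' ps' ei'] := si'.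
have [l lE] := pP _ _ p' p ps'.
have [|k kE] := @factor_inj _ K' _ K i' (l \o i) ii'.
  by move=> x; apply/ei'; rewrite /= lE (ses_comp0 _ si).
have [h hE] := ext (f \o k).
pose q : {linear (K' * P)%type -> M} := (i' \o fst) \+ (l \o snd).
have qs : surjective q.
  move=> y; have [b bE] := ps (p' y).
  have /ei'[x xE] : p' (y - l b) = 0 by rewrite linearB /= lE bE subrr.
  by exists (x, b); rewrite /q /= xE subrK.
have [|u uE] := @factor_surj _ _ _ _ q ((f \o fst) \+ (h \o snd) : {linear (K' * P)%type -> Y}) qs.
  move=> [x b]; rewrite /q /= => qxb.
  have /ei[c cE] : p b = 0.
    by have := congr1 p' qxb; rewrite linearD /= (ses_comp0 _ si') add0r lE linear0.
  have -> : x = - k c.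
    by apply: ii'; rewrite linearN kE /= cE; apply/eqP; rewrite -addr_eq0 qxb.
  by rewrite -cE hE /= linearN addNr.
by exists u => x; have := uE (x, 0); rewrite /q /= !linear0 !addr0.
Qed.

(** A map on the syzygy [K], composed with the augmentation of a resolution of [K], is a cocycle of
    degree 1; bounding it means extending the map to [P]. *)
Lemma ext1_vanish N Y : pdfin N -> ext_vanish 1 N Y -> ext1 N Y.
Proof.
move=> [n /pdS[P [p [K [i [pP si /pdim_le_pd[Q _]]]]]]] ev.
apply: (ext1_of_pres pP si) => f.
have [|h hE] := ev (cons_res pP si Q) (f \o res_aug Q : {linear res_obj Q 0 -> Y}).
  move=> x /=; have /= -> := iffRL (@res_exact0 R K Q _) (ex_intro _ x erefl).
  exact: linear0.
by exists h => x; have [y <-] := res_surj Q x; rewrite -[RHS]/((f \o res_aug Q) y) hE.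
Qed.

Lemma ext1_proj P Y : projective P -> ext1 P Y.
Proof.
move=> pP K M i p si f; have [ii ps ei] := si.
have [s sE] := projective_section pP ps.
have [|r rE] := @factor_inj _ K M M i (idfun \- (s \o p) : {linear M -> M}) ii.
  by move=> x; apply/ei; rewrite /= linearB /= sE subrr.
exists (f \o r) => x /=; congr (f _).
by apply: ii; rewrite rE /= (ses_comp0 _ si) linear0 subr0.
Qed.

Lemma ext1_retraction N Y M (i : {linear Y -> M}) (p : {linear M -> N}) :
  ext1 N Y -> ses i p -> exists r : {linear M -> Y}, forall x, r (i x) = x.
Proof. by move=> e si; apply: (e _ _ _ _ si idfun). Qed.

(** The pullback of the sequence along [g] ends in [N], hence splits, and a splitting is a lift of
    [g]. *)
Lemma ext1_lift N K M X (i : {linear K -> M}) (p : {linear M -> X}) :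
  ext1 N K -> ses i p -> forall g : {linear N -> X},
  exists h : {linear N -> M}, forall x, p (h x) = g x.
Proof.
move=> e si g; have [Z [a [b pb]]] := pullback_exists p g.
have [j [sj jE]] := pullback_ses pb si.
have [r rE] := ext1_retraction e sj.
have [ji bs ej] := sj; have [pg _ _] := pb.
have [|h hE] := @factor_surj _ _ _ _ b (a \- (i \o r) : {linear Z -> M}) bs.
  by move=> z /ej[k <-] /=; rewrite jE rE subrr.
exists h => x; have [z <-] := bs x.
by rewrite hE /= linearB /= (ses_comp0 _ si) subr0 pg.
Qed.

Lemma ext1_prod N X Y : ext1 N X -> ext1 N Y -> ext1 N (X * Y)%type.
Proof.
move=> eX eY K M i p si f.
have [h hE] := eX _ _ _ _ si (fst \o f); have [k kE] := eY _ _ _ _ si (snd \o f).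
have [u uE] := pair_map h k; exists u => x.
by rewrite uE hE kE [RHS]surjective_pairing.
Qed.

Lemma ext1_zero N Z : zero_module Z -> ext1 N Z.
Proof.
move=> Z0 K M i p si f; exists (\0 : {linear M -> Z}) => x.
by rewrite (Z0 (f x)).
Qed.

End Ext1.

Section Finiteness.
Variable R : pzRingType.
Implicit Types M N V X Y Z : lmodType R.

(* [X] is a direct summand of [V^n]; the maps to and from [V^n] are given as families. *)
Definition fin_retract V X : Prop :=
  exists n (f : 'I_n -> {linear X -> V}) (g : 'I_n -> {linear V -> X}),
    forall x, x = \sum_i g i (f i x).

(* [X] embeds in [V^n]. *)
Definition fin_cogen V X : Prop :=
  exists n (f : 'I_n -> {linear X -> V}), forall x, (forall i, f i x = 0) -> x = 0.

Lemma fin_retract_cogen V X : fin_retract V X -> fin_cogen V X.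
Proof.
move=> [n [f [g gf]]]; exists n, f => x fx.
by rewrite [x]gf big1 // => i _; rewrite fx linear0.
Qed.

Lemma fin_cogen_refl V : fin_cogen V V.
Proof. by exists 1%N, (fun=> idfun) => x; apply; apply: ord0. Qed.

Lemma fin_cogen_inj V X Y (f : {linear X -> Y}) :
  injective f -> fin_cogen V Y -> fin_cogen V X.
Proof.
move=> fi [n [g gE]]; exists n, (fun i => g i \o f) => x gx.
exact/(ker0_inj fi)/gE.
Qed.

Lemma fin_cogen_family V X (I : finType) (f : I -> {linear X -> V}) :
  (forall x, (forall i, f i x = 0) -> x = 0) -> fin_cogen V X.
Proof.
move=> fE; exists #|I|, (fun j => f (enum_val j)) => x fx; apply: fE => i.
by rewrite -[i]enum_rankK.
Qed.

Lemma fin_cogen_joint V X n (Y : 'I_n -> lmodType R) (f : forall i, {linear X -> Y i}) :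
  (forall i, fin_cogen V (Y i)) -> (forall x, (forall i, f i x = 0) -> x = 0) ->
  fin_cogen V X.
Proof.
move=> cY fE; pose m i := sval (cid (cY i)).
pose gP i := cid (svalP (cid (cY i))).
pose g i : 'I_(m i) -> {linear Y i -> V} := sval (gP i).
have gE i y : (forall j, g i j y = 0) -> y = 0 := svalP (gP i) y.
apply: (@fin_cogen_family _ _ {i : 'I_n & 'I_(m i)} (fun s => g (tag s) (tagged s) \o f (tag s))).
move=> x gx; apply: fE => i; apply: gE => j.
exact: (gx (Tagged _ j)).
Qed.

Lemma fin_cogen_trans V X Y : fin_cogen V X -> fin_cogen X Y -> fin_cogen V Y.
Proof. by move=> VX [n [f fE]]; apply: (fin_cogen_joint (f := f)). Qed.

Lemma fin_cogen_prod V X Y : fin_cogen V X -> fin_cogen V Y -> fin_cogen V (X * Y)%type.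
Proof.
move=> VX VY; pose Z (b : 'I_2) : lmodType R := if val b == 0%N then X else Y.
have [u [u1 u2]] : exists u : forall b, {linear (X * Y)%type -> Z b},
    (forall x, u ord0 x = x.1) /\ forall x, u (Ordinal (isT : 1 < 2)%N) x = x.2.
  by exists (fun b => match val b == 0%N as c
    return {linear (X * Y)%type -> (if c then X else Y : lmodType R)} with
    | true => fst | false => snd end).
apply: (fin_cogen_joint (f := u)) => [b|[x y] uxy]; first by rewrite /Z; case: ifP.
by rewrite -[x]/((x, y).1) -[y in (_, y)]/((x, y).2) -u1 -u2 !uxy.
Qed.

Lemma dsum_maps (I : finType) (M : I -> lmodType R) :
  exists (p : forall i, {linear dsum M -> M i}) (q : forall i, {linear M i -> dsum M}),
  [/\ forall i x, p i x = x i, forall i x, p i (q i x) = x,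
      forall i j x, i != j -> p j (q i x) = 0 & forall x, x = \sum_i q i (p i x)].
Proof.
have pex i : {p : {linear dsum M -> M i} | forall x, p x = x i} by apply: linear_of.
(* The summands depend on the index, so the inclusion of the [i]-th one transports [x] along a proof
   of [i = j]; [eq_axiomK] removes the transport on the diagonal. *)
pose qf i (x : M i) : dsum M := fun j =>
  if i =P j is ReflectT e then ecast z (M z) e x else 0.
have qf1 i x : qf i x i = x by rewrite /qf; case: eqP => // e; rewrite (eq_axiomK e).
have qf2 i j x : i != j -> qf i x j = 0 by rewrite /qf; case: eqP.
have qex i : {q : {linear M i -> dsum M} | forall x, q x = qf i x}.
  apply: linear_of => a x y; apply: functional_extensionality_dep => j.
  have [<-|ij] := eqVneq i j.
    by rewrite -[RHS]/(a *: qf i x i + qf i y i) !qf1.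
  by rewrite -[RHS]/(a *: qf i x j + qf i y j) !qf2 // scaler0 addr0.
exists (fun i => sval (pex i)), (fun i => sval (qex i)); split=> [i x|i x|i j x ij|x].
- by rewrite (svalP (pex i)).
- by rewrite (svalP (pex i)) (svalP (qex i)) qf1.
- by rewrite (svalP (pex j)) (svalP (qex i)) qf2.
have ev j (c' : I -> dsum M) : (\sum_i c' i) j = \sum_i c' i j.
  by elim/big_ind2: _ => // x1 x2 y1 y2 <- <-.
apply: functional_extensionality_dep => j; rewrite ev (bigD1 j) //= big1.
  by rewrite addr0 (svalP (qex j)) qf1 (svalP (pex j)).
by move=> i ij; rewrite (svalP (qex i)) qf2.
Qed.

Lemma in_add_fin_retract V X : in_add V X -> fin_retract V X.
Proof.
move=> [n [X' [f /linear_inverse[g fK gK]]]].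
have [p [q [_ _ _ pq]]] := dsum_maps (fun _ : 'I_n => V).
have [i iE] := pair_map (idfun : {linear X -> X}) (\0 : {linear X -> X'}).
exists n, (fun j => p j \o f \o i), (fun j => fst \o g \o q j) => x /=.
by rewrite -2!linear_sum -pq fK iE.
Qed.

Lemma in_add_iso V X Y : isomorphic X Y -> in_add V X -> in_add V Y.
Proof.
move=> /iso_sym[f fb] [n [X' [h hb]]]; exists n, X'; apply: iso_trans (ex_intro _ h hb).
have [g gE] := pair_map (f \o fst : {linear (Y * X')%type -> X}) snd.
have [f' fK f'K] := linear_inverse fb.
exists g; exists (fun z => (f' z.1, z.2)) => -[x y]; rewrite gE /= ?fK ?f'K //.
Qed.

Lemma in_add_summand V X Y : in_add V (X * Y)%type -> in_add V X.
Proof.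
move=> [n [Z [h hb]]]; exists n, (Y * Z)%type; apply: iso_trans (ex_intro _ h hb).
have [|f fE] := @linear_of R (X * (Y * Z))%type (X * Y * Z)%type
  (fun z => ((z.1, z.2.1), z.2.2)) => //.
exists f; exists (fun z => (z.1.1, (z.1.2, z.2))) => [[x [y z]]|[[x y] z]]; rewrite fE //.
Qed.

Lemma in_add_refl V : in_add V V.
Proof.
exists 1%N, (free R 0); apply: iso_sym.
have [p [q [pE pq _ qp]]] := dsum_maps (fun _ : 'I_1 => V).
have [f fE] := pair_map (p ord0) (\0 : {linear dsum (fun _ : 'I_1 => V) -> free R 0}).
exists f; exists (fun z => q ord0 z.1) => [x|[x y]]; rewrite fE /=.
  by rewrite {2}[x]qp big_ord1.
by congr pair; [apply: pq | apply/esym/(@zero_module_free0 R)].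
Qed.

(** Powers as iterated binary products, so that closure under products and zero passes to them by
    [mpow_ind]. *)
Fixpoint mpow V n : lmodType R := if n is m.+1 then (V * mpow V m)%type else free R 0.

Lemma mpow_ind (Q : lmodType R -> Prop) V :
  (forall Z, zero_module Z -> Q Z) -> (forall X Y, Q X -> Q Y -> Q (X * Y)%type) ->
  Q V -> forall n, Q (mpow V n).
Proof.
move=> Q0 QP QV; elim=> [|n IHn] /=; first exact/Q0/zero_module_free0.
exact: QP.
Qed.

Lemma fin_cogen_mpow V X : fin_cogen V X ->
  exists n (f : {linear X -> mpow V n}), injective f.
Proof.
move=> [n [f fE]]; suff [h hE] : exists h : {linear X -> mpow V n},
    forall x, h x = 0 -> forall i, f i x = 0.
  by exists n, h; apply: inj_ker0 => x /hE/fE.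
elim: n f {fE} => [|n IHn] f; first by exists \0 => x _ [].
have [h hE] := IHn (fun i => f (lift ord0 i)).
have [u uE] := pair_map (f ord0) h; exists u => x; rewrite uE => -[f0 /hE hx] i.
by case: (unliftP ord0 i) => [j|] ->.
Qed.

Lemma projective_fin_retract M :
  finitely_generated M -> projective M -> fin_retract R^o M.
Proof.
move=> /fg_free[n [p ps]] pM; have [s sE] := projective_section pM ps.
have [u [v [_ _ _ uv]]] := dsum_maps (fun _ : 'I_n => R^o).
exists n, (fun j => u j \o s), (fun j => p \o v j) => x /=.
by rewrite -linear_sum -uv sE.
Qed.

Lemma projective_ring : projective R^o.
Proof.
have [p [q [_ pq _ _]]] := dsum_maps (fun _ : 'I_1 => R^o).
apply: (@projective_retract _ (free R 1)); last exact: free_projective.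
by exists (q ord0), (p ord0).
Qed.

Lemma fin_retract_mpow V X : fin_retract V X -> exists n, retract X (mpow V n).
Proof.
move=> [n [f [g gf]]]; exists n.
suff [h [k kh]] : exists (h : {linear X -> mpow V n}) (k : {linear mpow V n -> X}),
    forall x, k (h x) = \sum_i g i (f i x) by exists h, k => x; rewrite kh -gf.
elim: n f g {gf} => [|n IHn] f g; first by exists \0, \0 => x; rewrite big_ord0.
have [h [k kh]] := IHn (fun i => f (lift ord0 i)) (fun i => g (lift ord0 i)).
have [u uE] := pair_map (f ord0) h.
exists u, ((g ord0 \o fst) \+ (k \o snd)) => x /=.
by rewrite uE /= kh big_ord_recl.
Qed.

Lemma ext1_retract N X Y : retract X Y -> ext1 N Y -> ext1 N X.
Proof.
move=> [f [g gf]] e K M i p si h.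
have [k kE] := e _ _ _ _ si (f \o h); exists (g \o k) => x /=.
by rewrite kE /= gf.
Qed.

Lemma ext1_mpow N V n : ext1 N V -> ext1 N (mpow V n).
Proof. by move=> e; apply: mpow_ind => //; [apply: ext1_zero | apply: ext1_prod]. Qed.

Lemma ext1_fin_retract N V X : fin_retract V X -> ext1 N V -> ext1 N X.
Proof.
by move=> /fin_retract_mpow[n XV] e; apply: ext1_retract XV _; apply: ext1_mpow.
Qed.

Lemma pd_mpow n V k : pd n V -> pd n (mpow V k).
Proof.
move=> Vn; apply: mpow_ind => // [Z|X Y Xn Yn]; first exact: pd_zero.
by have [i si] := ses_prod X Y; apply: pd_ext si _ _.
Qed.

Lemma pd_fin_retract n V X : fin_retract V X -> pd n V -> pd n X.
Proof.
by move=> /fin_retract_mpow[k XV] Vn; apply: pd_retract XV _; apply: pd_mpow.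
Qed.

Lemma Pfin_iso X Y : isomorphic X Y -> Pfin X -> Pfin Y.
Proof.
move=> XY /PfinE[fX pX]; apply/PfinE.
by split; [apply: fg_iso XY fX | apply: pdfin_iso XY pX].
Qed.

Lemma fg_retract X Y : retract X Y -> finitely_generated Y -> finitely_generated X.
Proof. by move=> [f [g gf]]; apply: (@fg_surj _ _ _ g) => x; exists (f x). Qed.

Lemma Pfin_retract X Y : retract X Y -> Pfin Y -> Pfin X.
Proof.
move=> XY /PfinE[fY pY]; apply/PfinE.
by split; [apply: fg_retract XY fY | apply: pdfin_retract XY pY].
Qed.

Lemma Pfin_cok X Y Z (i : {linear X -> Y}) (p : {linear Y -> Z}) :
  ses i p -> Pfin X -> Pfin Y -> Pfin Z.
Proof.
move=> si /PfinE[fX pX] /PfinE[fY pY]; apply/PfinE; split; last exact: pdfin_cok si pX pY.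
by have [_ ps _] := si; apply: fg_surj ps fY.
Qed.

Lemma Pfin_mpow V k : Pfin V -> Pfin (mpow V k).
Proof.
move=> /PfinE[fV [n pV]]; apply/PfinE; split; last by exists n; apply: pd_mpow.
by apply: mpow_ind => //; [apply: fg_zero | move=> X Y; apply: fg_prod].
Qed.

End Finiteness.

(** * Chain conditions *)

Section ChainConditions.
Variable R : pzRingType.
Implicit Types K M N S X Y Z : lmodType R.

Definition setle (b : bool) T (A B : set T) : Prop :=
  if b then forall x, A x -> B x else forall x, B x -> A x.

(* Maximum condition on submodules for [b = true], minimum condition for [b = false]. *)
Definition chain_cond b M : Prop :=
  forall F : set M -> Prop, (forall A, F A -> submodule A) -> (exists A, F A) ->
  exists A, F A /\ forall B, F B -> setle b A B -> forall x, A x <-> B x.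

Definition noeth := chain_cond true.
Definition artin := chain_cond false.

Lemma chain_cond_inj b K M (i : {linear K -> M}) :
  injective i -> chain_cond b M -> chain_cond b K.
Proof.
move=> ii cM F Fs [A FA]; pose im (C : set K) : set M := fun y => exists2 x, C x & i x = y.
have [| |_ [[B FB ->] Bmin]] := cM (fun D => exists2 C, F C & D = im C).
- by move=> _ [C FC ->]; apply: submodule_image; apply: Fs.
- by exists (im A), A.
have imE C x : im C (i x) <-> C x.
  by split=> [[y Cy /ii <-]|Cx] //; exists x.
exists B; split=> // C FC BC x; rewrite -!imE; apply: (Bmin (im C)); first by exists C.
by case: b BC {cM Bmin} => BC _ [y yC <-]; exists y => //; apply: BC.
Qed.

Lemma chain_cond_surj b M N (p : {linear M -> N}) :
  surjective p -> chain_cond b M -> chain_cond b N.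
Proof.
move=> ps cM F Fs [A FA]; pose pre (C : set N) : set M := fun x => C (p x).
have [| |_ [[B FB ->] Bmin]] := cM (fun D => exists2 C, F C & D = pre C).
- by move=> _ [C FC ->]; apply: submodule_preimage; apply: Fs.
- by exists (pre A), A.
exists B; split=> // C FC BC y; have [x <-] := ps y; apply: (Bmin (pre C)).
  by exists C.
by case: b BC {cM Bmin} => BC z; apply: BC.
Qed.

(** Take members of [F] with extremal image in [N] and, among those with this image, one with
    extremal trace on [K]. Nested submodules with equal image and equal trace coincide ([key]). *)
Lemma chain_cond_ses b K M N (i : {linear K -> M}) (p : {linear M -> N}) :
  ses i p -> chain_cond b K -> chain_cond b N -> chain_cond b M.
Proof.
move=> [ii ps ip] cK cN F Fs [A FA].
pose im (C : set M) : set N := fun y => exists2 x, C x & p x = y.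
pose pre (C : set M) : set K := fun x => C (i x).
have [| |_ [[B FB ->] Bmin]] := cN (fun D => exists2 C, F C & D = im C).
- by move=> _ [C FC ->]; apply: submodule_image; apply: Fs.
- by exists (im A), A.
have [| |_ [[C [FC BC] ->] Cmin]] := cK
    (fun D => exists2 C, F C /\ (forall y, im B y <-> im C y) & D = pre C).
- by move=> _ [C [FC _] ->]; apply: submodule_preimage; apply: Fs.
- by exists (pre B), B.
exists C; split=> // D FD CD.
have imCD y : im C y <-> im D y.
  rewrite -BC; apply: (Bmin (im D)); first by exists D.
  move: CD BC; case: b {cK cN Bmin Cmin} => CD BC z.
    by move=> /BC[x Cx <-]; exists x => //; apply: CD.
  by move=> [x Dx <-]; apply/BC; exists x => //; apply: CD.
have preCD x : pre C x <-> pre D x.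
  apply: (Cmin (pre D)); first by exists D => //; split=> // y; rewrite BC.
  by case: b CD {cK cN Bmin Cmin} => CD z; apply: CD.
have key (U V : set M) : submodule U -> submodule V -> (forall x, U x -> V x) ->
    (forall y, im V y -> im U y) -> (forall x, pre V x -> pre U x) ->
    forall x, V x -> U x.
  move=> Us Vs UV iUV pUV x Vx.
  have [|y Uy py] := iUV (p x); first by exists x.
  have /ip[k kE] : p (x - y) = 0 by rewrite linearB /= py subrr.
  have Uk : U (i k) by apply: pUV; rewrite /pre kE; apply: submoduleB => //; apply: UV.
  by rewrite -(subrK y x) -kE; apply: submoduleD.
have Cs := Fs _ FC; have Ds := Fs _ FD.
move=> x; split; last first.
  case: b CD {cK cN Bmin Cmin} => CD; last exact: CD.
  by apply: key => // [y /imCD//|y /preCD].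
case: b CD {cK cN Bmin Cmin} => CD; first exact: CD.
by apply: key => // [y /imCD//|y /preCD].
Qed.

Lemma chain_cond_two b M :
  (forall K : set M, submodule K -> (forall x, K x -> x = 0) \/ forall x, K x) ->
  chain_cond b M.
Proof.
move=> M2 F Fs [A FA].
have [[B [FB Bb]]|nb] := pselect (exists B, F B /\
    if b then forall x, B x else forall x, B x -> x = 0).
  exists B; split=> // C FC; case: b Bb => Bb BC x; first by split=> // _; apply: BC.
  by split=> [/Bb ->|/BC //]; apply: submodule0; apply: Fs.
have AE B : F B -> if b then forall x, B x -> x = 0 else forall x, B x.
  by move=> FB; case: (M2 _ (Fs _ FB)) => Bb; case: b nb => // nb; case: nb; exists B.
exists A; split=> // C FC _ x; have As := Fs _ FA; have Cs := Fs _ FC.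
have := AE _ FA; have := AE _ FC; case: b {nb AE} => C0 A0 //.
by split=> [/A0|/C0] ->; apply: submodule0.
Qed.

Lemma chain_cond_zero b M : zero_module M -> chain_cond b M.
Proof. by move=> M0; apply: chain_cond_two => K _; left=> x _; apply: M0. Qed.

Lemma chain_cond_prod b M N :
  chain_cond b M -> chain_cond b N -> chain_cond b (M * N)%type.
Proof.
by have [i] := ses_prod M N; apply: chain_cond_ses.
Qed.

Lemma chain_cond_cogen b V X : fin_cogen V X -> chain_cond b V -> chain_cond b X.
Proof.
move=> /fin_cogen_mpow[m [f fi]] cV.
apply: chain_cond_inj fi _; apply: mpow_ind => //; first exact: chain_cond_zero.
exact: chain_cond_prod.
Qed.

Lemma chain_cond_fg b M : chain_cond b R^o -> finitely_generated M -> chain_cond b M.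
Proof.
move=> cR /fg_free[n [p ps]]; apply: chain_cond_surj ps _.
have [u [v [_ _ _ uv]]] := dsum_maps (fun _ : 'I_n => R^o).
apply: chain_cond_cogen cR; exists n, u => x ux; rewrite [x]uv big1 // => i _.
by have /= -> := ux i; apply: linear0.
Qed.

Lemma noeth_fg M : noeth M -> finitely_generated M.
Proof.
move=> nM; pose F (A : set M) := exists n (f : {linear free R n -> M}),
  forall y, A y <-> exists x, f x = y.
have [| |A [[n [f fE]] Amax]] := nM F.
- move=> A [n [f fE]]; have [f0 fS] := submodule_range f.
  split=> [|a x y]; first exact/fE.
  by move=> /fE fx /fE fy; apply/fE/fS.
- by exists (fun y => exists x : free R 0, (\0 : {linear free R 0 -> M}) x = y), 0%N, \0.
apply/fg_free; exists n, f => x; apply/fE.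
have [g gE] := free_map (fun _ : 'I_1 => x).
have fg1 : finitely_generated (free R n * free R 1)%type.
  exact: fg_prod (fg_free_mod _ n) (fg_free_mod _ 1).
have [k [p ps]] := iffLR (fg_free _) fg1.
pose h : {linear (free R n * free R 1)%type -> M} := (f \o fst) \+ (g \o snd).
apply/(Amax (fun y => exists z, (h \o p) z = y)).
- by exists k, (h \o p).
- move=> y /fE[z <-]; have [t tE] := ps (z, 0); exists t.
  by rewrite /= tE /h /= linear0 addr0.
have [t tE] := ps (0, (fun=> 1)); exists t; rewrite /= tE /h /= linear0 add0r gE.
by rewrite big_ord1 scale1r.
Qed.

(** Induction over proper quotients: if [Q] fails for [M], a maximal kernel among the quotients of
    [M] violating [Q] gives a counterexample all of whose proper quotients satisfy [Q]. *)
Lemma noeth_ind (Q : lmodType R -> Prop) :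
  (forall M, (forall X (f : {linear M -> X}), surjective f -> ~ injective f -> Q X) ->
     Q M) ->
  forall M, noeth M -> Q M.
Proof.
move=> IH M nM; apply: contrapT => nQM.
pose F (A : set M) := exists X (f : {linear M -> X}),
  [/\ surjective f, ~ Q X & forall x, A x <-> f x = 0].
have [| |A [[X [f [fs nQX fE]]] Amax]] := nM F.
- move=> A [X [f [_ _ fE]]]; have [f0 fS] := submodule_ker f.
  split=> [|a x y]; first exact/fE.
  by move=> /fE fx /fE fy; apply/fE/fS.
- by exists (fun x => x = 0), M, idfun; split=> // x; exists x.
apply: (nQX); apply: IH => Y g gs gi; apply: contrapT => nQY; apply: gi.
apply: inj_ker0 => x; have [y <-] := fs x => gfy.
apply/fE/(Amax (fun z => (g \o f) z = 0)) => //.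
  exists Y, (g \o f); split=> // z; have [t <-] := gs z.
  by have [u <-] := fs t; exists u.
by move=> z /fE /= ->; rewrite linear0.
Qed.

Definition simple_mod S : Prop := ~ zero_module S /\
  forall K : set S, submodule K -> (forall x, K x -> x = 0) \/ forall x, K x.

Lemma simple_inj S M (f : {linear S -> M}) :
  simple_mod S -> (forall x, f x = 0) \/ injective f.
Proof.
move=> [_ /(_ _ (submodule_ker f))[f0|f0]]; last by left.
by right; apply: inj_ker0.
Qed.

Lemma simple_surj S M (f : {linear M -> S}) :
  simple_mod S -> (forall x, f x = 0) \/ surjective f.
Proof.
move=> [_ /(_ _ (submodule_range f))[f0|f0]]; last by right.
by left=> x; apply: f0; exists x.
Qed.

Lemma nzero_exists M : ~ zero_module M -> exists x : M, x <> 0.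
Proof.
by move=> nz; apply: contrapT => nx; apply: nz => x; apply: contrapT => x0; apply: nx; exists x.
Qed.

Lemma simple_gen S (x y : S) : simple_mod S -> x <> 0 -> exists a, a *: x = y.
Proof.
move=> sS x0; have [|h hE] := @linear_of R R^o S (fun a => (a : R) *: x).
  by move=> a u v; rewrite scalerDl scalerA.
have [h0|/(_ y)[a aE]] := simple_surj h sS; last by exists a; rewrite -hE.
by case: x0; rewrite -[x]scale1r -hE.
Qed.

Lemma gen_simple S (x0 : S) : x0 <> 0 ->
  (forall x y : S, x <> 0 -> exists a, a *: x = y) -> simple_mod S.
Proof.
move=> x0n gen; split=> [/(_ x0)//|K Ks].
have [K0|/existsNP[x /not_implyP[Kx xn]]] := pselect (forall x, K x -> x = 0); first by left.
by right=> y; have [a <-] := gen x y xn; apply: submoduleZ.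
Qed.

Lemma artin_simple M : artin M -> ~ zero_module M ->
  exists S (i : {linear S -> M}), simple_mod S /\ injective i.
Proof.
move=> aM /nzero_exists[x0 x0n].
have [| |A [[As [x Ax xn]] Amin]] := aM (fun A => submodule A /\ exists2 x, A x & x <> 0).
- by move=> A [].
- by exists (fun=> True); split=> //; exists x0.
have [S [i [ii iE]]] := submod_exists As; exists S, i; split=> //.
have /iE[y yE] := Ax; split=> [S0|K Ks].
  by apply: xn; rewrite -yE (S0 y) linear0.
have [K0|/existsNP[z /not_implyP[Kz zn]]] := pselect (forall x, K x -> x = 0); first by left.
pose B := fun y => exists2 x, K x & i x = y.
have AB : forall y, A y <-> B y.
  apply: Amin => [|_ [u _ <-]]; last by apply/iE; exists u.
  split; first exact: submodule_image.
  by exists (i z); [exists z | move=> /(ker0_inj ii)].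
by right=> t; have /iE/AB[u Ku /ii <-] : exists u, i u = i t by exists t.
Qed.

(** For a large power [H] of [h] the kernel and the image no longer change, so [M] is their direct
    sum and one of them vanishes; the kernel does not, as it contains that of [h]. *)
Lemma fitting M (h : {linear M -> M}) : noeth M -> artin M -> indecomposable M ->
  ~ injective h -> exists n, forall x, iter n h x = 0.
Proof.
move=> nM aM [_ ind] hi.
have hn n : {H : {linear M -> M} | forall x, H x = iter n h x}.
  apply: linear_of; elim: n => [|n IH] a x y //=.
  have iE : iter n h (a *: x + y) = a *: iter n h x + iter n h y := IH a x y.
  by rewrite iE linearP.
have iterD n m x : iter (n + m) h x = iter n h (iter m h x) by rewrite iterD.
have [| |_ [[n ->] nmin]] := aM (fun A => exists n, A = fun y => exists x, iter n h x = y).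
- move=> _ [n ->]; have [H HE] := hn n; have := submodule_range H.
  by under eq_fun do under eq_exists do rewrite HE.
- by exists (fun y => exists x, iter 0 h x = y), 0%N.
have [| |_ [[m ->] mmax]] := nM (fun A => exists n, A = fun x => iter n h x = 0).
- move=> _ [n' ->]; have [H HE] := hn n'; have := submodule_ker H.
  by under eq_fun do rewrite HE.
- by exists (fun x => iter 0 h x = 0), 0%N.
(* The exponent is past both stabilization points, and positive so that the kernel of [h] lies in
   that of [H]. *)
pose N := (n + m).+1; have [H HE] := hn N.
have iter0 k : iter k h 0 = 0 by elim: k => //= k ->; rewrite linear0.
have H2 x : H (H x) = 0 -> H x = 0.
  rewrite !HE -iterD => Nx; have mN : (m <= N)%N by rewrite /N leqW ?leq_addl.
  suff mx : iter m h x = 0 by rewrite -(subnK mN) iterD mx iter0.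
  apply/(mmax (fun x => iter (N + N) h x = 0)) => //; first by exists (N + N)%N.
  move=> y my; by rewrite -{2}(subnK mN) addnA iterD my iter0.
have HI x : exists y, H (H y) = H x.
  have nN : (n <= N)%N by rewrite /N leqW ?leq_addr.
  have E y : (exists x, iter n h x = y) <-> exists x, iter (N + N) h x = y.
    apply: (nmin (fun y => exists x, iter (N + N) h x = y)); first by exists (N + N)%N.
    move=> _ [z <-]; exists (iter (N - n + N) h z).
    by rewrite -iterD addnA subnKC.
  have [|y yE] := iffLR (E (H x)).
    by exists (iter (N - n) h x); rewrite -iterD subnKC.
  by exists y; rewrite !HE -iterD yE.
have [I [p [i [ps ii ipE]]]] := im_exists H.
have [K [k sk]] := ses_ker ps.
have [|q qE1 qE2] := @linear_inverse _ _ _ (p \o i : {linear I -> I}).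
  apply: inj_surj_bij => [|y].
    apply: inj_ker0 => y; have [x <-] := ps y => /= /(congr1 i).
    by rewrite linear0 !ipE => /H2; rewrite -ipE => /(ker0_inj ii).
  have [x <-] := ps y; have [z zE] := HI x; exists (p z).
  by apply: ii; rewrite /= !ipE.
have [|K0|I0] := ind K I.
- by apply/iso_sym/(ses_split_iso (s := i \o q) sk) => y; apply: qE2.
- case: hi; apply: inj_ker0 => x hx.
  have [_ _ /(_ x)/iffLR ek] := sk.
  have [|y <-] := ek; last by rewrite (K0 y) linear0.
  by apply: (ker0_inj ii); rewrite ipE HE /N iterSr hx iter0.
by exists N => x; rewrite -HE -ipE (I0 (p x)) linear0.
Qed.

End ChainConditions.

(** * Algebras over a commutative artinian ring *)

(** Without a minimal member, iterating a choice of strictly smaller members gives a descending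
    chain that never stops. *)
Lemma artinian_artin (R : pzRingType) (M : lmodType R) : artinian M -> artin M.
Proof.
move=> aM F Fs [A0 FA0]; apply: contrapT => nmin.
have step (A : {A | F A}) : exists B : {B | F B},
    (forall x, sval B x -> sval A x) /\ ~ (forall x, sval A x <-> sval B x).
  apply: contrapT => nB; apply: nmin; exists (sval A); split; first exact: (svalP A).
  move=> B FB BA; apply: contrapT => AB; apply: nB.
  by exists (exist _ B FB).
have [s sP] := choice step.
pose C n := sval (iter n s (exist _ A0 FA0)).
have [|n|n0 Cn] := aM C; first by move=> n; apply: Fs; apply: svalP.
  by move=> x; apply: (sP _).1.
have := Cn n0.+1 (leqnSn _); have [_ nE] := sP (iter n0 s (exist _ A0 FA0)).
by move=> CE; apply: nE => x; change (C n0 x <-> C n0.+1 x); rewrite CE.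
Qed.

Section Hopkins.
Variable k : comPzRingType.

(* In an artinian [k], an ideal [I] minimal among the non-noetherian ones satisfies *)
(* [a I = 0] or [a I = I] for all [a], so its annihilator is maximal: [I] is a      *)
(* vector space all of whose proper subspaces are noetherian, which is absurd.     *)
Section MinimalBad.
Variable N : lmodType k.
Hypothesis nN : ~ noeth N.
Hypothesis Nmin : forall (S : lmodType k) (i : {linear S -> N}),
  injective i -> ~ surjective i -> noeth S.
Hypothesis ak : artin k^o.

Let mul_lin a : {f : {linear N -> N} | forall x, f x = a *: x}.
Proof.
by apply: linear_of => b x y; rewrite scalerDr !scalerA mulrC.
Qed.

Let bad_mul a : (forall x : N, a *: x = 0) \/ forall y : N, exists x, a *: x = y.
Proof.
have [f fE] := mul_lin a.
have [I [p [i [ps ii ipE]]]] := im_exists f; have [K [j sj]] := ses_ker ps.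
have [is_|nis] := pselect (surjective i).
  by right=> y; have [z <-] := is_ y; have [x <-] := ps z; exists x; rewrite ipE fE.
have [js|njs] := pselect (surjective j).
  by left=> x; have [y <-] := js x; rewrite -fE -ipE (ses_comp0 _ sj) linear0.
have [ji _ _] := sj; case: nN.
exact: chain_cond_ses sj (Nmin ji njs) (Nmin ii nis).
Qed.

(** The powers of [a] generate a stationary chain of ideals, so a^n = a^(n+1) b for some [b]. When
    aN = N every element of [N] is a multiple of a^n, and on such elements [b] inverts [a]. *)
Let bad_inv a : (forall x : N, a *: x = 0) \/ exists b, forall x : N, (b * a) *: x = x.
Proof.
have [a0|as_] := bad_mul a; first by left.
right; have [| |_ [[n ->] nmin]] := ak
    (F := fun A => exists n, A = fun y : k^o => exists x, a ^+ n * x = y).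
- move=> _ [n ->]; split=> [|c _ _ [x <-] [y <-]]; first by exists 0; rewrite mulr0.
  by exists (c * x + y); rewrite mulrDr mulrCA.
- by exists (fun y => exists x, a ^+ 0 * x = y), 0%N.
have E (y : k) : (exists x : k, a ^+ n * x = y) <-> exists x : k, a ^+ n.+1 * x = y.
  apply: (nmin (fun y : k^o => exists x, a ^+ n.+1 * x = y)); first by exists n.+1.
  by move=> _ [x <-]; exists (a * x); rewrite mulrA -exprSr.
have [|b bE] := iffLR (E (a ^+ n)); first by exists 1; rewrite mulr1.
exists b => x; have asn : exists y, a ^+ n *: y = x.
  elim: n x {nmin E bE} => [|n IH] x; first by exists x; rewrite scale1r.
  have [y <-] := as_ x; have [z <-] := IH y; exists z.
  by rewrite scalerA -exprS.
by have [y <-] := asn; rewrite scalerA -mulrA -exprS mulrC bE.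
Qed.

Let bad_hyperplane (x : N) : x <> 0 -> exists C : set N,
  [/\ submodule C, ~ C x & forall D : set N, submodule D -> (forall y, C y -> D y) ->
      ~ D x -> forall y, D y -> C y].
Proof.
(* Adjoining 0 makes the empty set admissible, as Zorn's lemma also requires the union of the empty
   chain to satisfy [P]. *)
move=> x0; pose P (A : set N) := submodule (fun z => A z \/ z = 0) /\ ~ A x.
have [|A [[As Ax] Amax]] := @Zorn_bigcup N P.
  move=> F FP tot; split; last by move=> [A FA Ax]; case: (FP A FA).
  split; first by right.
  have one A c u v : F A -> (A u \/ u = 0) -> (A v \/ v = 0) ->
      (exists2 B, F B & B (c *: u + v)) \/ c *: u + v = 0.
    move=> FA uA vA; have [[_ AS] _] := FP A FA.
    by case: (AS c u v uA vA) => [?|]; [left; exists A | right].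
  move=> c u v [[A FA Au]|->] [[B FB Bv]|->].
  - case: (tot A B FA FB) => [AB|BA].
      by apply: (one B) => //; left; [apply: AB|].
    by apply: (one A) => //; left; [|apply: BA].
  - by apply: (one A) => //; [left|right].
  - by rewrite scaler0 add0r; left; exists B.
  - by rewrite scaler0 addr0; right.
exists (fun z => A z \/ z = 0); split=> // [[|]//|D Ds AD Dx y Dy].
apply: contrapT => /not_orP[nAy _]; apply: (Amax D).
  by split=> [z Az|/(_ y Dy)]; [apply: AD; left|].
split=> //; case: Ds => D0 DS; split; first by right.
move=> c u v uD vD; left; apply: DS; first by case: uD => [//|->].
by case: vD => [//|->].
Qed.

(** A submodule [C] maximal among those missing some [x <> 0] is proper, hence noetherian. Its
    quotient has no proper nonzero submodule, because [x] lies in C + ky for every [y] outside [C]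
    and nonzero actions of scalars are invertible. So [N] would be noetherian. *)
Lemma no_minimal_bad : False.
Proof.
have [N0|/nzero_exists[x x0]] := pselect (zero_module N).
  by apply: nN; apply: chain_cond_zero.
have [C [Cs Cx Cmax]] := bad_hyperplane x0.
have [S [i [ii iE]]] := submod_exists Cs; have [Q [p si]] := ses_cok ii.
have [_ ps ip] := si; apply: nN; apply: chain_cond_ses si _ _.
  by apply: Nmin ii _ => /(_ x)/iE.
have nC y : ~ C y -> exists c b, x = c + b *: y /\ C c.
  move=> nCy; apply: contrapT => nx; apply: nCy.
  pose D z := exists c b, z = c + b *: y /\ C c.
  apply: (Cmax D) => //; last first.
  - by exists 0, 1; rewrite scale1r add0r; split=> //; apply: submodule0.
  - by move=> z Cz; exists z, 0; rewrite scale0r addr0.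
  split; first by exists 0, 0; rewrite scale0r addr0; split=> //; apply: submodule0.
  move=> a _ _ [c [b [-> Cc]]] [d [b' [-> Cd]]]; exists (a *: c + d), (a * b + b').
  split; last by case: Cs => _; apply.
  by rewrite scalerDr scalerDl scalerA addrACA.
apply: chain_cond_two => K Ks.
have [K0|/existsNP[q /not_implyP[Kq q0]]] := pselect (forall y, K y -> y = 0); first by left.
right=> z; have [y yq] := ps q; have [z' <-] := ps z.
have Cp c : C c -> p c = 0 by move=> Cc; apply/ip/iE.
have [|c [b [xE Cc]]] := nC y; first by move=> /Cp; rewrite yq.
have Kx : K (p x).
  by rewrite xE linearD /= Cp // add0r linearZ /= yq; apply: submoduleZ.
have [Cz|nCz] := pselect (C z'); first by rewrite Cp //; apply: submodule0.
have [d [b' [xE' Cd]]] := nC _ nCz.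
have [b0|[a aE]] := bad_inv b'; first by case: Cx; rewrite xE' b0 addr0.
have bz : b' *: z' = x - d by rewrite xE' addrC addKr.
by rewrite -(aE z') -scalerA bz linearZ /= linearB /= (Cp d) // subr0; apply: submoduleZ.
Qed.

End MinimalBad.

(** The minimum condition yields a minimal non-noetherian ideal, to which [no_minimal_bad]
    applies. *)
Lemma hopkins : artin k^o -> noeth k^o.
Proof.
move=> ak; apply: contrapT => nk.
pose bad (A : set k^o) := exists As : submodule A, ~ noeth (sub_mod As).
have [| |A [[As nA] Amin]] := ak bad.
- by move=> A [].
- exists (fun=> True), (submodule_setT _) => nT; apply: nk.
  apply: (chain_cond_surj (p := val : {linear sub_mod (submodule_setT k^o) -> k^o})) nT.
  by move=> y; apply/(sub_modP (submodule_setT k^o)).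
apply: (no_minimal_bad nA _ ak) => S i ii is_; apply: contrapT => nS; apply: is_.
pose v : {linear sub_mod As -> k^o} := val.
have Bs := submodule_range (v \o i); pose B y := exists x, (v \o i) x = y.
have badB : bad B.
  exists Bs => nB; apply: nS; pose w : {linear sub_mod Bs -> k^o} := val.
  have [||j jE] := @factor_inj _ _ _ S w (v \o i); first exact: val_inj.
    by move=> x; apply/(sub_modP Bs); exists x.
  apply: (chain_cond_inj (i := j)) nB => x y /(congr1 w).
  by rewrite !jE => h; apply: ii; apply: val_inj.
have AB : forall y, A y <-> B y.
  apply: Amin => // _ [x <-]; apply/(sub_modP As); by exists (i x).
move=> y; have /AB[z zE] : A (v y) by apply/(sub_modP As); exists y.
by exists z; apply: val_inj.
Qed.
End Hopkins.

Lemma fg_family (R : pzRingType) (M : lmodType R) (I : finType) (s : I -> M) :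
  (forall x, exists c : I -> R, x = \sum_i c i *: s i) -> finitely_generated M.
Proof.
move=> sE; exists #|I|, (fun j => s (enum_val j)) => x; have [c ->] := sE x.
exists (fun j => c (enum_val j)).
by rewrite (reindex _ (onW_bij _ (enum_val_bij I))).
Qed.

Section Restriction.
Variables (k R : pzRingType) (f : {rmorphism k -> R}).

(** Restriction of scalars on a copy of [M] labelled by the morphism, from which the [k]-module
    structure is inferred. *)
Definition restr (_ : {rmorphism k -> R}) (M : lmodType R) : Type := M.

Section Instances.
Variable M : lmodType R.
HB.instance Definition _ := GRing.Zmodule.on (restr f M).

Let scale (a : k) (x : restr f M) : restr f M := (f a *: (x : M)).

Fact restr_scaleA a b x : scale a (scale b x) = scale (a * b) x.
Proof. by rewrite /scale scalerA rmorphM. Qed.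
Fact restr_scale1 : left_id 1 scale.
Proof. by move=> x; rewrite /scale rmorph1 scale1r. Qed.
Fact restr_scaleDr : right_distributive scale +%R.
Proof. by move=> a x y; rewrite /scale scalerDr. Qed.
Fact restr_scaleDl x : {morph scale^~ x : a b / a + b}.
Proof. by move=> a b; rewrite /scale rmorphD scalerDl. Qed.
HB.instance Definition _ := GRing.Zmodule_isLmodule.Build k (restr f M)
  restr_scaleA restr_scale1 restr_scaleDr restr_scaleDl.

Lemma restr_scaleE a (x : restr f M) : a *: x = f a *: (x : M).
Proof. by []. Qed.

Lemma submodule_restr (A : set M) : submodule A -> submodule (A : set (restr f M)).
Proof. by move=> [A0 AS]; split=> // a x y; apply: AS. Qed.

Lemma chain_cond_restr b : chain_cond b (restr f M) -> chain_cond b M.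
Proof.
move=> cM F Fs Fex; apply: (cM F) => // A FA.
exact/submodule_restr/Fs.
Qed.

Lemma fg_unrestr : finitely_generated (restr f M) -> finitely_generated M.
Proof.
move=> [n [s sE]]; exists n, s => x; have [c cE] := sE x.
by exists (fun i => f (c i)).
Qed.

End Instances.

Lemma fg_restr (M : lmodType R) : finitely_generated (restr f R^o) ->
  finitely_generated M -> finitely_generated (restr f M).
Proof.
move=> [n [s sE]] [m [t tE]].
apply: (@fg_family k (restr f M) ('I_n * 'I_m)%type (fun ij => (s ij.1 : R) *: t ij.2)) => x.
have [d ->] := tE x; have [c cE] := choice (fun j => sE (d j)).
exists (fun ij => c ij.2 ij.1); rewrite -(pair_bigA _ (fun i j => c j i *: ((s i : R) *: t j : restr f M))) /=.
rewrite exchange_big /=; apply: eq_bigr => j _.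
rewrite {1}cE scaler_suml; apply: eq_bigr => i _.
by rewrite restr_scaleE scalerA.
Qed.

End Restriction.

Section ArtinAlgebras.
Variables (k : comPzRingType) (R : pzRingType) (phi : {rmorphism k -> R}).

Definition finite_algebra : Prop :=
  (forall a x, phi a * x = x * phi a) /\ finitely_generated (restr phi R^o).

Hypotheses (ak : artin k^o) (fR : finite_algebra).

Lemma algebra_chain_cond b (M : lmodType R) :
  finitely_generated M -> chain_cond b (restr phi M).
Proof.
move=> fM; apply: chain_cond_fg; last by apply: fg_restr => //; case: fR.
by case: b => //; apply: hopkins.
Qed.

(* Finite generation of [X] over any other algebra is tested over [k]. *)
Lemma fg_algebra_sub (S : pzRingType) (psi : {rmorphism k -> S}) (X : lmodType S)
    (M : lmodType R) (j : {linear restr psi X -> restr phi M}) :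
  injective j -> finitely_generated M -> finitely_generated X.
Proof.
move=> ji fM; apply: (@fg_unrestr k S psi); apply: noeth_fg.
exact: chain_cond_inj ji (algebra_chain_cond true fM).
Qed.

End ArtinAlgebras.

Section ArtinAlgebra.
Variable R : pzRingType.
Implicit Types M N X : lmodType R.

Definition finite_over_artin : Prop :=
  exists (k : comPzRingType) (phi : {rmorphism k -> R}), artin k^o /\ finite_algebra phi.

Lemma artin_algebra_finite : artin_algebra R -> finite_over_artin.
Proof. by case=> k [phi [/artinian_artin ak cphi fphi]]; exists k, phi. Qed.

Hypothesis aR : finite_over_artin.

Lemma artin_algebra_chain_cond b M : finitely_generated M -> chain_cond b M.
Proof.
have [k [phi [ak fR]]] := aR => fM.
exact/(chain_cond_restr (f := phi))/algebra_chain_cond.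
Qed.

Lemma fg_sub M N (i : {linear M -> N}) :
  injective i -> finitely_generated N -> finitely_generated M.
Proof.
by move=> ii fN; apply/noeth_fg/(chain_cond_inj ii)/artin_algebra_chain_cond.
Qed.

Lemma Pfin_ker M N X (i : {linear M -> N}) (p : {linear N -> X}) :
  ses i p -> Pfin N -> Pfin X -> Pfin M.
Proof.
move=> si /PfinE[fN pN] /PfinE[fX pX]; apply/PfinE; split; last exact: pdfin_ker si _ _.
by have [ii _ _] := si; apply: fg_sub ii fN.
Qed.

End ArtinAlgebra.

(** * Corner rings and coinduction *)

Lemma rmorphism_of (R S : pzRingType) (f : R -> S) :
  {morph f : x y / x + y} -> {morph f : x y / x * y} -> f 1 = 1 ->
  {g : {rmorphism R -> S} | forall x, g x = f x}.
Proof.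
move=> fD fM f1.
have f0 : f 0 = 0 by apply: (addrI (f 0)); rewrite -fD !addr0.
pose a := GRing.isNmodMorphism.Build R S f (conj f0 fD).
pose m := GRing.isMonoidMorphism.Build R S f (conj f1 fM).
by exists (HB.pack_for {rmorphism R -> S} f a m).
Qed.

Section HomModules.
Variables (R : pzRingType) (X T : lmodType R).

Definition homm : Type := {linear X -> T}.
HB.instance Definition _ := gen_eqMixin homm.
HB.instance Definition _ := gen_choiceMixin homm.

Definition hom_fun (f : homm) : {linear X -> T} := f.

Lemma homm_ext (f g : homm) : (forall x, hom_fun f x = hom_fun g x) -> f = g.
Proof.
rewrite /hom_fun; case: f g => [f [[f1] [f2]]] [g [[g1] [g2]]] /= /funext fg.
by case: _ / fg in g1 g2 *; rewrite (Prop_irrelevance f1 g1) (Prop_irrelevance f2 g2).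
Qed.

Let zero : homm := (\0 : {linear X -> T}).
Let opp (f : homm) : homm := (\- hom_fun f : {linear X -> T}).
Let add (f g : homm) : homm := (hom_fun f \+ hom_fun g : {linear X -> T}).

Fact homm_addA : associative add.
Proof. by move=> f g h; apply: homm_ext => x; rewrite /= addrA. Qed.
Fact homm_addC : commutative add.
Proof. by move=> f g; apply: homm_ext => x; rewrite /= addrC. Qed.
Fact homm_add0 : left_id zero add.
Proof. by move=> f; apply: homm_ext => x; rewrite /= add0r. Qed.
Fact homm_addN : left_inverse zero opp add.
Proof. by move=> f; apply: homm_ext => x; rewrite /= addNr. Qed.
HB.instance Definition _ :=
  GRing.isZmodule.Build homm homm_addA homm_addC homm_add0 homm_addN.

Lemma hom_funD f g x : hom_fun (f + g) x = hom_fun f x + hom_fun g x.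
Proof. by []. Qed.

End HomModules.

(* [cj] identifies B with the corner ring eAe, where e = cj 1. *)
Record corner_of (A B : pzRingType) := CornerOf {
  cj :> B -> A;
  cjD : {morph cj : x y / x + y};
  cjM : {morph cj : x y / x * y};
  cj_inj : injective cj;
  cj_img : forall x, cj 1 * x * cj 1 = x -> exists b, cj b = x }.

Section CornerModule.
Variables (A B : pzRingType) (c : corner_of A B).
Local Notation e := (c 1).

Lemma corner_idem : e * e = e. Proof. by rewrite -cjM mulr1. Qed.
Lemma corner_l b : e * c b = c b. Proof. by rewrite -cjM mul1r. Qed.
Lemma corner_r b : c b * e = c b. Proof. by rewrite -cjM mulr1. Qed.
Lemma corner0 : c 0 = 0. Proof. by apply: (addrI (c 0)); rewrite -cjD !addr0. Qed.

Lemma corner_idemZ (M : lmodType A) (x : M) : e *: (e *: x) = e *: x.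
Proof. by rewrite scalerA corner_idem. Qed.

Section Module.
Variable M : lmodType A.

Definition emod_pred : {pred M} := fun x => e *: x == x.

Fact emod_pred_closed : zmod_closed emod_pred.
Proof.
split=> [|x y]; rewrite !unfold_in ?scaler0 // => /eqP xe /eqP ye.
by rewrite scalerBr xe ye.
Qed.
HB.instance Definition _ := GRing.isZmodClosed.Build M emod_pred emod_pred_closed.

Definition emod := {x : M | x \in emod_pred}.
HB.instance Definition _ := SubChoice.on emod.
HB.instance Definition _ := [SubChoice_isSubZmodule of emod by <:].

Lemma emodP (x : emod) : e *: val x = val x. Proof. exact/eqP/(valP x). Qed.

Fact emod_scale_subproof b (x : M) : c b *: x \in emod_pred.
Proof. by rewrite unfold_in scalerA corner_l. Qed.

Let scale (b : B) (x : emod) : emod := exist _ (c b *: val x) (emod_scale_subproof b (val x)).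

Fact emod_scaleA a b x : scale a (scale b x) = scale (a * b) x.
Proof. by apply: val_inj; rewrite /= cjM scalerA. Qed.
Fact emod_scale1 : left_id 1 scale.
Proof. by move=> x; apply: val_inj; rewrite /= emodP. Qed.
Fact emod_scaleDr : right_distributive scale +%R.
Proof. by move=> a x y; apply: val_inj; rewrite /= scalerDr. Qed.
Fact emod_scaleDl x : {morph scale^~ x : a b / a + b}.
Proof. by move=> a b; apply: val_inj; rewrite /= cjD scalerDl. Qed.
HB.instance Definition _ := GRing.Zmodule_isLmodule.Build B emod
  emod_scaleA emod_scale1 emod_scaleDr emod_scaleDl.

Definition eval (x : emod) : M := val x.

Lemma evalZ b (x : emod) : eval (b *: x) = c b *: eval x. Proof. by []. Qed.
Lemma evalD (x y : emod) : eval (x + y) = eval x + eval y. Proof. by []. Qed.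
Lemma eval0 : eval 0 = 0. Proof. by []. Qed.
Lemma eval_inj : injective eval. Proof. exact: val_inj. Qed.
Lemma evalP x : e *: eval x = eval x. Proof. exact: emodP. Qed.

Lemma emod_of (x : M) : e *: x = x -> {y : emod | eval y = x}.
Proof.
move=> ex; have xP : x \in emod_pred by apply/eqP.
by exists (exist _ x xP).
Qed.

End Module.

Section Functor.
Variables (M N : lmodType A) (f : {linear M -> N}).

Fact emap_subproof (x : emod M) : f (eval x) \in @emod_pred N.
Proof. by rewrite unfold_in -linearZ /= evalP. Qed.

Definition emap_fun (x : emod M) : emod N := exist _ (f (eval x)) (emap_subproof x).

Fact emap_linear : linear emap_fun.
Proof. by move=> b x y; apply: val_inj; rewrite /= linearP. Qed.
HB.instance Definition _ := GRing.isLinear.Build B (emod M) (emod N) _ emap_fun emap_linear.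

Definition emap : {linear emod M -> emod N} := emap_fun.

Lemma evalE x : eval (emap x) = f (eval x). Proof. by []. Qed.

End Functor.

(** Preimages found in the whole module are multiplied by [e] to bring them into the corner. *)
Lemma emap_ses (X Y Z : lmodType A) (i : {linear X -> Y}) (p : {linear Y -> Z}) :
  ses i p -> ses (emap i) (emap p).
Proof.
move=> si; have [ii ps ip] := si; split=> [x y /(congr1 (@eval _)) /ii /eval_inj //|z|y].
  have [y py] := ps (eval z); have [x xE] := emod_of (corner_idemZ y).
  by exists x; apply: eval_inj; rewrite evalE xE linearZ /= py evalP.
split=> [/(congr1 (@eval _))|[x <-]]; last first.
  by apply: eval_inj; rewrite !evalE (ses_comp0 _ si).
rewrite evalE eval0 => /ip[x xE]; have [x' x'E] := emod_of (corner_idemZ x).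
by exists x'; apply: eval_inj; rewrite evalE x'E linearZ /= xE evalP.
Qed.

Lemma emod_fin_retract (V X : lmodType A) : fin_retract V X ->
  fin_retract (emod V) (emod X).
Proof.
move=> [n [f [g gf]]]; exists n, (fun i => emap (f i)), (fun i => emap (g i)) => x.
apply: eval_inj; rewrite {1}[eval x]gf.
elim/big_rec2: _ => //= i y _ _ ->; rewrite evalD //.
Qed.

Lemma emod_iso_prod (X Y : lmodType A) :
  isomorphic (emod X * emod Y)%type (emod (X * Y)%type).
Proof.
have [h hE] := pair_map (emap (fst : {linear (X * Y)%type -> X}))
                        (emap (snd : {linear (X * Y)%type -> Y})).
apply: iso_sym; exists h; apply: inj_surj_bij => [x y|[x y]].
  rewrite !hE => xy; apply: eval_inj.
  have h1 : (eval x).1 = (eval y).1 := congr1 (fun z => eval z.1) xy.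
  have h2 : (eval x).2 = (eval y).2 := congr1 (fun z => eval z.2) xy.
  by rewrite [LHS]surjective_pairing [RHS]surjective_pairing h1 h2.
have [|z zE] := @emod_of (X * Y)%type (eval x, eval y).
  by congr pair; rewrite /= evalP.
by exists z; rewrite hE; congr pair; apply: eval_inj; rewrite evalE zE.
Qed.

End CornerModule.

Section Coinduction.
Variables (A B : pzRingType) (c : corner_of A B).
Local Notation e := (c 1).
Local Notation eA := (emod c A^o).

Definition rmulA (a : A) (x : A^o) : A^o := (x : A) * a.

Fact rmulA_linear (a : A) : linear (rmulA a).
Proof. by move=> b x y; rewrite [LHS]mulrDl -mulrA. Qed.
HB.instance Definition _ (a : A) :=
  GRing.isLinear.Build A A^o A^o _ (rmulA a) (rmulA_linear a).

Definition rmule (a : A) : {linear eA -> eA} :=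
  emap c (rmulA a : {linear A^o -> A^o}).

Lemma rmuleE a y : eval (rmule a y) = (eval y : A) * a. Proof. by []. Qed.

Section Module.
Variable N : lmodType B.

(** Coinduction Hom_B(eA, N), a left A-module through right multiplication of A on eA. *)
Definition coind : Type := homm eA N.
HB.instance Definition _ := GRing.Zmodule.on coind.

Definition coind_fun (h : coind) : {linear eA -> N} := hom_fun h.

Let scale (a : A) (h : coind) : coind := (coind_fun h \o rmule a : {linear eA -> N}).

Fact coind_scaleA a b h : scale a (scale b h) = scale (a * b) h.
Proof.
apply: homm_ext => x; congr (coind_fun h _).
by apply: eval_inj; rewrite !rmuleE mulrA.
Qed.
Fact coind_scale1 : left_id 1 scale.
Proof.
move=> h; apply: homm_ext => x; congr (coind_fun h _).
by apply: eval_inj; rewrite rmuleE mulr1.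
Qed.
Fact coind_scaleDr : right_distributive scale +%R.
Proof. by move=> a h k; apply: homm_ext. Qed.
Fact coind_scaleDl h : {morph scale^~ h : a b / a + b}.
Proof.
move=> a b; apply: homm_ext => x; rewrite hom_funD.
transitivity (coind_fun h (rmule a x + rmule b x)); last exact: linearD.
by congr (coind_fun h _); apply: eval_inj; rewrite evalD !rmuleE mulrDr.
Qed.
HB.instance Definition _ := GRing.Zmodule_isLmodule.Build A coind
  coind_scaleA coind_scale1 coind_scaleDr coind_scaleDl.

Lemma coind_scaleE a (h : coind) y : coind_fun (a *: h) y = coind_fun h (rmule a y).
Proof. by []. Qed.

End Module.

Lemma eA_of (x : A) : e * x = x -> {y : eA | eval y = x}.
Proof. exact: (@emod_of _ _ c A^o x). Qed.

Definition eA1 : eA := sval (eA_of (corner_idem c)).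
Lemma eA1E : eval eA1 = e. Proof. exact: (svalP (eA_of (corner_idem c))). Qed.

Lemma eAZ b : exists y : eA, eval y = c b /\ y = b *: eA1.
Proof.
have [y yE] := eA_of (corner_l c b); exists y; split=> //.
by apply: eval_inj; rewrite yE evalZ eA1E -[RHS]/(c b * e) corner_r.
Qed.

(** Evaluation at [e], the counit of the adjunction between M |-> eM and coinduction. *)
Definition coind_ev_fun (N : lmodType B) (h : emod c (coind N)) : N :=
  coind_fun (eval h) eA1.

Fact coind_ev_linear (N : lmodType B) : linear (@coind_ev_fun N).
Proof.
move=> b h k; rewrite /coind_ev_fun evalD evalZ -linearZ.
rewrite [LHS]/(coind_fun (c b *: eval h) eA1 + coind_fun (eval k) eA1).
rewrite coind_scaleE; congr (coind_fun (eval h) _ + _); apply: eval_inj.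
by rewrite rmuleE evalZ eA1E -[RHS]/(c b * e) corner_l corner_r.
Qed.
HB.instance Definition _ (N : lmodType B) :=
  GRing.isLinear.Build B (emod c (coind N)) N _ (@coind_ev_fun N) (@coind_ev_linear N).

Definition coind_ev (N : lmodType B) : {linear emod c (coind N) -> N} := @coind_ev_fun N.
Arguments coind_ev {N}.

(** If [h] is fixed by [e] then h(y) = h(ye), and ye lies in eAe, so h(ye) is a B-multiple of
    h(e). *)
Lemma coind_ev_inj N : injective (@coind_ev N).
Proof.
apply: inj_ker0 => h h0; apply: eval_inj; rewrite -[LHS]evalP; apply: homm_ext => y.
rewrite -[LHS]/(coind_fun (e *: eval h) y) coind_scaleE.
have [|b bE] := @cj_img _ _ c (eval (rmule e y)).
  rewrite rmuleE -mulrA -mulrA corner_idem mulrA.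
  by rewrite -[e * eval y]/(e *: eval y) evalP.
have [z [zE zb]] := eAZ b.
have -> : rmule e y = b *: eA1 by rewrite -zb; apply: eval_inj; rewrite zE bE.
have hz : coind_fun (eval h) eA1 = 0 := h0.
by rewrite linearZ /= hz scaler0.
Qed.

(** For [y] in eA, the value h(y) is that of e(yh) at [e]. Hence a coinduced module has no nonzero
    submodule killed by [e]. *)
Lemma coind_faithful N (h : coind N) : (forall a, e *: (a *: h) = 0) -> h = 0.
Proof.
move=> h0; apply: homm_ext => y.
transitivity (coind_fun (e *: ((eval y : A) *: h)) eA1); last by rewrite h0.
rewrite !coind_scaleE; congr (coind_fun h _); apply: eval_inj.
by rewrite !rmuleE eA1E corner_idem -[LHS](evalP y).
Qed.

(** The adjoint map sends [x] to the homomorphism y |-> f(yx). Its uniqueness is [coind_map_eq]. *)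
Lemma coind_adj (M : lmodType A) (N : lmodType B) (f : {linear emod c M -> N}) :
  exists F : {linear M -> coind N}, forall x, coind_ev (emap c F x) = f x.
Proof.
have act (y : eA) (x : M) : {z : emod c M | eval z = (eval y : A) *: x}.
  by apply: emod_of; rewrite scalerA -[e * _]/(e *: eval y) evalP.
pose az y x := sval (act y x); have azE y x : eval (az y x) = (eval y : A) *: x := svalP (act y x).
have Fx x : {F : {linear eA -> N} | forall y, F y = f (az y x)}.
  apply: linear_of => b y z; rewrite -linearP; congr (f _); apply: eval_inj.
  by rewrite evalD evalZ !azE evalD evalZ scalerDl scalerA.
have [|F FE] := @linear_of A M (coind N) (fun x => sval (Fx x) : coind N).
  move=> a x y; apply: homm_ext => z.
  change (sval (Fx (a *: x + y)) z = sval (Fx x) (rmule a z) + sval (Fx y) z).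
  rewrite !(svalP (Fx _)) -linearD; congr (f _); apply: eval_inj.
  by rewrite evalD !azE rmuleE scalerDr scalerA.
exists F => x; rewrite /coind_ev /= /coind_ev_fun evalE FE.
rewrite -[LHS]/(sval (Fx (eval x)) eA1) (svalP (Fx _)); congr (f _); apply: eval_inj.
by rewrite azE eA1E evalP.
Qed.

Lemma coind_ev_bij N : bijective (@coind_ev N).
Proof.
apply: inj_surj_bij => [|n]; first exact: coind_ev_inj.
have yb (y : eA) : exists b, c b = (eval y : A) * e.
  apply: cj_img; rewrite -mulrA -mulrA corner_idem mulrA.
  by rewrite -[e * eval y]/(e *: eval y) evalP.
have [b bE] := choice yb.
(* The preimage of [n] is y |-> (ye)n, with ye read as the element [b y] of [B]. *)
have [|h hE] := @linear_of B eA N (fun y => b y *: n).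
  move=> a y z; rewrite scalerA -scalerDl; congr (_ *: _); apply: (cj_inj (c := c)).
  by rewrite bE cjD cjM !bE evalD evalZ mulrDl -mulrA.
have eh : e *: (h : coind N) = h.
  apply: homm_ext => y; rewrite -[LHS]/(h (rmule e y)) -[RHS]/(h y) !hE.
  by congr (_ *: _); apply: (cj_inj (c := c)); rewrite !bE rmuleE -mulrA corner_idem.
have [k kE] := emod_of eh; exists k.
rewrite /coind_ev /= /coind_ev_fun kE -[LHS]/(h eA1) hE.
rewrite (_ : b eA1 = 1) ?scale1r //; apply: (cj_inj (c := c)).
by rewrite bE eA1E corner_idem.
Qed.

Lemma coind_map_eq (M : lmodType A) N (F G : {linear M -> coind N}) :
  (forall x, coind_ev (emap c F x) = coind_ev (emap c G x)) -> forall x, F x = G x.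
Proof.
move=> FG x; apply/eqP; rewrite -subr_eq0; apply/eqP/coind_faithful => a.
have [y yE] := emod_of (corner_idemZ c (a *: x)).
have /(@coind_ev_inj N)/(congr1 (@eval _ _ _ _)) := FG y.
rewrite !evalE yE !linearZ /= => Fy; rewrite scalerBr scalerBr.
by apply/eqP; rewrite subr_eq0; apply/eqP.
Qed.

Lemma coind_map (N N' : lmodType B) (f : {linear N -> N'}) :
  exists F : {linear coind N -> coind N'},
    forall x, coind_ev (emap c F x) = f (coind_ev x).
Proof. exact: coind_adj (f \o @coind_ev N). Qed.

End Coinduction.

Arguments coind_ev {A B} c {N}.

(** * Finite projective dimension over a corner ring *)

Section CornerFinite.
Variables (k : comPzRingType) (A B : pzRingType) (c : corner_of A B).
Variable phi : {rmorphism k -> A}.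
Hypotheses (ak : artin k^o) (fA : finite_algebra phi).
Local Notation e := (c 1).

Lemma corner_algebra : exists psi : {rmorphism k -> B},
  (forall a, c (psi a) = phi a * e) /\ finite_algebra psi.
Proof.
have [cphi fg] := fA.
have ex a : exists b, c b = phi a * e.
  by apply: cj_img; rewrite mulrA -cphi -!mulrA !corner_idem.
have [f fE] := choice ex.
have [|||psi psiE] := @rmorphism_of k B f.
- by move=> x y; apply: (cj_inj (c := c)); rewrite cjD !fE rmorphD mulrDl.
- move=> x y; apply: (cj_inj (c := c)); rewrite cjM !fE rmorphM.
  by rewrite -!mulrA; congr (_ * _); rewrite mulrA -cphi -mulrA corner_idem.
- by apply: (cj_inj (c := c)); rewrite fE rmorph1 mul1r.
have psic a : c (psi a) = phi a * e by rewrite psiE fE.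
exists psi; split=> //; split=> [a x|].
  apply: (cj_inj (c := c)); rewrite !cjM psic -mulrA corner_l.
  by rewrite mulrA -cphi -mulrA corner_r.
have [|h hE] := @linear_of k (restr psi B^o) (restr phi A^o) c.
  move=> a x y; rewrite cjD [c (_ *: x)]cjM psic -mulrA corner_l //.
apply: noeth_fg; apply: (chain_cond_inj (i := h)); last first.
  exact: (algebra_chain_cond (phi := phi) ak fA true (fg_ring A)).
by move=> x y; rewrite !hE; apply: (cj_inj (c := c)).
Qed.

Variable psi : {rmorphism k -> B}.
Hypotheses (psic : forall a, c (psi a) = phi a * e) (fB : finite_algebra psi).

Lemma fg_emod (M : lmodType A) : finitely_generated M -> finitely_generated (emod c M).
Proof.
have [|h hE] := @linear_of k (restr psi (emod c M)) (restr phi M) (@eval _ _ c M).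
  move=> a x y; rewrite evalD; congr (_ + _).
  by rewrite [LHS]evalZ psic -scalerA evalP.
apply: (fg_algebra_sub ak fA (j := h)) => x y; by rewrite !hE; apply: (@eval_inj _ _ c M x y).
Qed.

(** Evaluation at generators of eA embeds coind(N) over [k] in a finite power of [N]. *)
Lemma fg_coind (N : lmodType B) : finitely_generated N -> finitely_generated (coind c N).
Proof.
move=> fN; have [n [s sE]] := fg_emod (fg_ring A).
have [cphi _] := fA.
have ev i : {h : {linear restr phi (coind c N) -> restr psi N} |
    forall x, h x = coind_fun x (s i)}.
  apply: linear_of => a x y.
  transitivity (coind_fun x (rmule c (phi a) (s i)) + coind_fun y (s i)) => //.
  transitivity (psi a *: coind_fun x (s i) + coind_fun y (s i)) => //.
  rewrite -linearZ; congr (coind_fun x _ + _); apply: eval_inj.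
  by rewrite rmuleE evalZ psic -scalerA evalP -cphi.
apply: (@fg_unrestr k A phi); apply: noeth_fg.
apply: (@chain_cond_cogen _ true (restr psi N)); last exact: algebra_chain_cond.
exists n, (fun i => sval (ev i)) => h h0; apply: homm_ext => y.
have [b ->] := sE y; rewrite linear_sum big1 // => i _; rewrite linearZ /=.
by have := h0 i; rewrite (svalP (ev i)) => hi; rewrite (hi : hom_fun h (s i) = 0) scaler0.
Qed.

End CornerFinite.

Section Star.
Variables (k : comPzRingType) (A B : pzRingType) (c : corner_of A B).
Variables (phi : {rmorphism k -> A}) (psi : {rmorphism k -> B}).
Hypotheses (ak : artin k^o) (fA : finite_algebra phi) (fB : finite_algebra psi).
Hypothesis psic : forall a, c (psi a) = phi a * c 1.
Local Notation e := (c 1).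
Implicit Types M N X Y : lmodType A.

Definition killed M : Prop := forall x : M, e *: x = 0.

Hypothesis killed_pdfin : forall M, finitely_generated M -> killed M -> pdfin M.
Variable d : nat.
Hypothesis pd_eA : pd d (emod c A^o).

Let aA : finite_over_artin A. Proof. by exists k, phi. Qed.

(** Finitely generated projectives become summands of powers of eA, of dimension at most [d], and
    each syzygy adds one. *)
Lemma pd_emod n M : finitely_generated M -> pd n M -> pd (n + d) (emod c M).
Proof.
elim: n M => [|n IHn] M fM pM.
  apply: pd_fin_retract (emod_fin_retract c _) pd_eA.
  exact: projective_fin_retract.
have [m [p ps]] := iffLR (fg_free M) fM; have [K [i si]] := ses_ker ps.
have [ii _ _] := si; have fF := fg_free_mod A m.
have fK : finitely_generated K := fg_sub aA ii fF.
apply: (pd_cok (emap_ses c si)); last exact/IHn/pd_proj/(@free_projective A).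
by apply: IHn => //; apply: pd_ker (@free_projective A m) si pM.
Qed.

Lemma pdfin_emod M : finitely_generated M -> pdfin M -> pdfin (emod c M).
Proof. by move=> fM [n pM]; exists (n + d)%N; apply: pd_emod. Qed.

(** The kernel and the cokernel of [g] are killed by [e], hence of finite projective dimension. *)
Lemma pdfin_eiso X Y (g : {linear X -> Y}) : finitely_generated X ->
  finitely_generated Y -> bijective (emap c g) -> pdfin X -> pdfin Y.
Proof.
move=> fX fY gb pX; have [I [p [i [ps ii ipE]]]] := im_exists g.
have [K [j sj]] := ses_ker ps; have [Q [q sq]] := ses_cok ii.
have [ji _ _] := sj; have [_ qs _] := sq.
have pK : pdfin K.
  apply: killed_pdfin => [|x]; first exact: (fg_sub aA ji fX).
  apply: ji; rewrite linear0; have [y yE] := emod_of (corner_idemZ c (j x)).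
  rewrite linearZ /= -yE -[RHS](eval0 c); congr eval; apply: (bij_inj gb).
  apply: eval_inj; rewrite linear0 evalE yE linearZ /= -ipE.
  by rewrite (ses_comp0 _ sj) linear0 scaler0.
apply: (pdfin_ext sq); first exact: pdfin_cok sj pK pX.
apply: killed_pdfin => [|x]; first exact: fg_surj qs fY.
have [y <-] := qs x; have [z zE] := emod_of (corner_idemZ c y).
have [t tE] := bij_surj gb z.
rewrite -linearZ /= -zE -tE evalE -ipE; exact: ses_comp0 sq.
Qed.

(* [U] behaves like a power of the projective module Ae, so that maps out of [U] are *)
(* determined by, and can be prescribed on, its corner eU.                           *)
Definition corner_free U : Prop :=
  [/\ finitely_generated U, projective U, projective (emod c U),
      forall N (F G : {linear U -> N}),
        (forall z, emap c F z = emap c G z) -> forall z, F z = G z &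
      forall N (t : {linear emod c U -> emod c N}),
        exists F : {linear U -> N}, forall z, emap c F z = t z].

Lemma corner_free0 : corner_free (free A 0).
Proof.
have F0 : zero_module (free A 0) := @zero_module_free0 A.
have E0 : zero_module (emod c (free A 0)) by move=> x; apply: eval_inj; apply: F0.
split; [exact: fg_zero|exact: projective_zero|exact: projective_zero| |].
  by move=> N F G _ z; rewrite (F0 z) !linear0.
by move=> N t; exists \0 => z; rewrite (E0 z) !linear0.
Qed.

Lemma corner_free_prod U V : corner_free U -> corner_free V -> corner_free (U * V)%type.
Proof.
move=> [fU pU peU uU exU] [fV pV peV uV exV].
have [i iE] := pair_map (idfun : {linear U -> U}) (\0 : {linear U -> V}).
have [j jE] := pair_map (\0 : {linear V -> U}) (idfun : {linear V -> V}).
split; [exact: fg_prod|exact: projective_prod| | |].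
- exact: projective_iso (emod_iso_prod c U V) (projective_prod peU peV).
- move=> N F G FG [x y].
  have -> : (x, y) = i x + j y by rewrite iE jE; congr pair; rewrite /= ?addr0 ?add0r.
  rewrite !linearD /=; congr (_ + _).
    apply: (uU _ (F \o i) (G \o i)) => z; apply: eval_inj; rewrite !evalE /=.
    exact: (congr1 (@eval _ _ c N) (FG (emap c i z))).
  apply: (uV _ (F \o j) (G \o j)) => z; apply: eval_inj; rewrite !evalE /=.
  exact: (congr1 (@eval _ _ c N) (FG (emap c j z))).
move=> N t; have [F FE] := exU _ (t \o emap c i); have [G GE] := exV _ (t \o emap c j).
exists ((F \o fst) \+ (G \o snd)) => z; apply: eval_inj; rewrite evalE /=.
rewrite -[F _]/(eval (emap c F (emap c fst z))) -[G _]/(eval (emap c G (emap c snd z))).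
rewrite FE GE -evalD /= -linearD; congr (eval (t _)); apply: eval_inj.
rewrite evalD !evalE iE jE /= [RHS]surjective_pairing.
by congr pair; rewrite /= ?addr0 ?add0r.
Qed.

(** [U] is the left ideal Ae and [u] its generator [e]; the corner eU = eAe is free of rank one over
    [B]. *)
Lemma corner_free_eA : exists (U : lmodType A) (u : emod c U), corner_free U /\
  forall M (x : emod c M), exists f : {linear U -> M}, emap c f u = x.
Proof.
have ri : submodule (fun x : A^o => (x : A) * e = x).
  split=> [|a x y xe ye]; first exact: mul0r.
  by rewrite [LHS]mulrDl -mulrA xe ye.
have [U [i [ii iE]]] := submod_exists ri.
have /iE[u0 u0E] : e * e = e := corner_idem c.
have ie x : (i x : A) * e = i x by apply/iE; exists x.
have [|u uE] := @emod_of _ _ c _ u0.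
  by apply: ii; rewrite linearZ /= u0E; apply: (corner_idem c).
have gen x : x = (i x : A) *: u0.
  by apply: ii; rewrite linearZ /= u0E; apply/esym/ie.
have rU : retract U A^o.
  have [r rE] := free_map (fun _ : 'I_1 => u0).
  have [|g gE] := @linear_of A A^o U (fun x => (x : A) *: u0).
    by move=> a x y; rewrite scalerDl scalerA.
  by exists i, g => x; rewrite gE -gen.
have euB (x : emod c U) : exists b, x = b *: u.
  have [|b bE] := @cj_img _ _ c (i (eval x)).
    rewrite -mulrA ie -[LHS]/(e *: (i (eval x) : A^o)) -linearZ /=.
    by rewrite evalP.
  by exists b; apply: eval_inj; rewrite evalZ uE bE -gen.
have uB b : b *: u = 0 -> b = 0.
  move=> /(congr1 (fun z => i (eval z))); rewrite evalZ uE linearZ u0E eval0 linear0 => cb.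
  by apply: (cj_inj (c := c)); rewrite corner0 -(corner_r c b).
exists U, u; split; last first.
  move=> M x; have [|g gE] := @linear_of A U M (fun y => (i y : A) *: eval x).
    by move=> a y z; rewrite linearP scalerDl scalerA.
  by exists g; apply: eval_inj; rewrite evalE gE uE u0E evalP.
split.
- exact: fg_retract rU (fg_ring A).
- exact: projective_retract rU (@projective_ring A).
- have [|g gE] := @linear_of B B^o (emod c U) (fun b => (b : B) *: u).
    by move=> a x y; rewrite scalerDl scalerA.
  apply: (projective_iso _ (@projective_ring B)); exists g; apply: inj_surj_bij.
    by apply: inj_ker0 => b; rewrite gE => /uB.
  by move=> x; have [b ->] := euB x; exists b; rewrite gE.
- move=> N F G FG z; rewrite [z]gen !linearZ; congr (_ *: _).
  by rewrite -uE; apply: (congr1 (@eval _ _ c N) (FG u)).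
move=> N t; have [|g gE] := @linear_of A U N (fun y => (i y : A) *: eval (t u)).
  by move=> a y z; rewrite linearP scalerDl scalerA.
exists g => z; have [b ->] := euB z; rewrite !linearZ; congr (_ *: _).
by apply: eval_inj; rewrite evalE gE uE u0E evalP.
Qed.

Lemma corner_free_cover M : finitely_generated M ->
  exists (U : lmodType A) (f : {linear U -> M}), corner_free U /\ surjective (emap c f).
Proof.
move=> fM; have [n [s sE]] := fg_emod ak fA psic fM.
have [V [v [cV Vmap]]] := corner_free_eA.
suff [U [f [cU fs]]] : exists (U : lmodType A) (f : {linear U -> M}), corner_free U /\
    forall i, exists x, emap c f x = s i.
  exists U, f; split=> // x; have [b ->] := sE x; have [t tE] := choice fs.
  exists (\sum_i b i *: t i); rewrite linear_sum; apply: eq_bigr => i _.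
  by rewrite linearZ /= tE.
elim: n s {sE} => [|n IHn] s.
  by exists (free A 0), \0; split=> [|[]//]; apply: corner_free0.
have [U [f [cU fs]]] := IHn (fun i => s (lift ord0 i)).
have [g gE] := Vmap M (s ord0).
exists (V * U)%type, ((g \o fst) \+ (f \o snd)); split; first exact: corner_free_prod.
move=> i; case: (unliftP ord0 i) => [j|] ->.
  have [x xE] := fs j; have [|z zE] := @emod_of _ _ c (V * U)%type (0, eval x).
    by congr pair; rewrite /= ?scaler0 ?evalP.
  by exists z; apply: eval_inj; rewrite evalE zE /= linear0 add0r -xE.
have [|z zE] := @emod_of _ _ c (V * U)%type (eval v, 0).
  by congr pair; rewrite /= ?scaler0 ?evalP.
by exists z; apply: eval_inj; rewrite evalE zE /= linear0 addr0 -gE.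
Qed.

(** Induction on the dimension of eM, with covers by powers of Ae. These are surjective only on
    corners, and [pdfin_eiso] absorbs the difference. *)
Lemma pd_emod_pdfin n M : finitely_generated M -> pd n (emod c M) -> pdfin M.
Proof.
elim: n M => [|n IHn] M fM pM.
  have [U [f [[fU pU peU uU exU] fs]]] := corner_free_cover fM.
  have [s sE] := projective_section pM fs.
  (* The idempotent of eU splitting off eM lifts to an idempotent [F] of [U]. Its image is
     projective and maps to [M] isomorphically on corners. *)
  have [F FE] := exU _ (s \o emap c f).
  have FF z : F (F z) = F z.
    apply: (uU _ (F \o F) F) => x; have -> : emap c (F \o F) x = emap c F (emap c F x).
      exact: eval_inj.
    by rewrite !FE /= sE.
  have fF z : f (F z) = f z.
    apply: (uU _ (f \o F) f) => x; have -> : emap c (f \o F) x = emap c f (emap c F x).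
      exact: eval_inj.
    by rewrite FE /= sE.
  have [Q [p [i [ps ii ipE]]]] := im_exists F.
  have piE x : p (i x) = x.
    by have [y <-] := ps x; apply: ii; rewrite !ipE FF.
  have rQ : retract Q U by exists i, p.
  apply: (@pdfin_eiso Q M (f \o i)) => //; first exact: fg_retract rQ fU.
    apply: inj_surj_bij => [|x].
      apply: inj_ker0 => x x0; apply: eval_inj; apply: ii; rewrite linear0.
      have iE : i (eval x) = eval (emap c F (emap c i x)) by rewrite !evalE -ipE piE.
      rewrite iE FE /= (_ : emap c f (emap c i x) = 0) ?linear0 //.
      by rewrite -x0; apply: eval_inj.
    have [z <-] := fs x; exists (emap c p z); apply: eval_inj.
    by rewrite !evalE /= ipE fF.
  by exists 0%N; apply: projective_retract rQ pU.
have [U [f [[fU pU peU uU exU] fs]]] := corner_free_cover fM.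
have [I [p [i [ps ii ipE]]]] := im_exists f.
have [K [j sj]] := ses_ker ps; have [ji _ _] := sj.
have sf : ses (emap c j) (emap c f).
  have [h1 h2 h3] := emap_ses c sj; split=> // y; rewrite -h3.
  split=> /(congr1 (@eval _ _ c _)); rewrite !evalE !eval0 => h; apply: eval_inj; rewrite evalE.
    by apply: ii; rewrite ipE h linear0.
  by rewrite -ipE h linear0.
have fK : finitely_generated K := fg_sub aA ji fU.
have pK : pdfin K by apply: IHn fK _; apply: pd_ker peU sf pM.
have pI : pdfin I by apply: pdfin_cok sj pK _; exists 0%N.
apply: (@pdfin_eiso I M i) => //; first exact: fg_surj ps fU.
apply: inj_surj_bij => [|x].
  by apply: inj_ker0 => x /(congr1 (@eval _ _ c _)); rewrite evalE eval0 => /(ker0_inj ii) ?; apply: eval_inj.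
have [z <-] := fs x; exists (emap c p z); apply: eval_inj.
by rewrite !evalE ipE.
Qed.

Lemma pdfin_emodE M : finitely_generated M -> pdfin (emod c M) <-> pdfin M.
Proof. by move=> fM; split=> [[n]|]; [apply: pd_emod_pdfin | apply: pdfin_emod]. Qed.

Lemma Pfin_emod M : Pfin M -> Pfin (emod c M).
Proof.
move=> /PfinE[fM pM]; apply/PfinE; split; last exact: pdfin_emod.
exact: (fg_emod ak fA psic fM).
Qed.

Lemma Pfin_of_emod M : finitely_generated M -> Pfin (emod c M) -> Pfin M.
Proof. by move=> fM /PfinE[_ pM]; apply/PfinE; split=> //; apply/pdfin_emodE. Qed.

Lemma Pfin_coind (N : lmodType B) : Pfin N -> Pfin (coind c N).
Proof.
move=> pN; apply: Pfin_of_emod.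
  by have /PfinE[fN _] := pN; apply: (fg_coind ak fA psic fB fN).
apply: Pfin_iso pN; apply: iso_sym.
by exists (coind_ev c : {linear emod c (coind c N) -> N}); apply: coind_ev_bij.
Qed.

(** Since both adjoint functors preserve P^<oo, approximations of coind(N) restrict to corners, and
    approximations of eM induce ones of [M] by pulling back along the unit. *)
Theorem contravariantly_finite_corner :
  contravariantly_finite A <-> contravariantly_finite B.
Proof.
split=> cf.
  move=> N fN; have [X [p [pX pl]]] := cf _ (fg_coind ak fA psic fB fN).
  exists (emod c X), (coind_ev c \o emap c p : {linear emod c X -> N}).
  split=> [|Y f pY]; first exact: Pfin_emod.
  (* To factor [f], factor coind(f) through the approximation of coind(N) and take corners. *)
  have [F FE] := coind_map c f; have [h hE] := pl _ F (Pfin_coind pY).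
  have [g gK gK'] := linear_inverse (coind_ev_bij c Y).
  exists (emap c h \o g) => y /=; rewrite -[y in RHS]gK' -FE.
  by congr (coind_ev c _); apply: eval_inj; rewrite !evalE hE.
move=> M fM; have [N [p [pN pl]]] := cf _ (fg_emod ak fA psic fM).
have [q qE] := coind_map c p.
(* [u] is the unit M -> coind(eM), and [X] its pullback with coind(p). *)
have [u uE] := coind_adj (idfun : {linear emod c M -> emod c M}).
have [X [a [b pb]]] := pullback_exists u q; have [ub ex inj] := pb.
have fX : finitely_generated X.
  have [h hE] := pair_map a b; have /PfinE[fN _] := pN.
  apply: (fg_sub aA (i := h)); last exact: fg_prod fM (fg_coind ak fA psic fB fN).
  by apply: inj_ker0 => x; rewrite hE => -[]; apply: inj.
(* The unit is an isomorphism on corners, so the pullback has the same corner as coind(N), namely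
   [N]. *)
have eX : isomorphic (emod c X) N.
  exists (coind_ev c \o emap c b : {linear emod c X -> N}); apply: inj_surj_bij => [|n].
    apply: inj_ker0 => x /= /(ker0_inj (@coind_ev_inj _ _ c N)) bx.
    have b0 : b (eval x) = 0 := congr1 (@eval _ _ c _) bx.
    have a0 : emap c a x = 0.
      rewrite -[LHS]uE (_ : emap c u _ = 0) ?linear0 //.
      by apply: eval_inj; rewrite !evalE ub b0 linear0.
    by apply: eval_inj; apply: inj => //; apply: (congr1 (@eval _ _ c _) a0).
  have [y yE] := bij_surj (coind_ev_bij c N) n.
  have uq : emap c u (p n) = emap c q y.
    by apply: coind_ev_inj; rewrite uE qE yE.
  have [z [za zb]] := ex (eval (p n)) (eval y) (congr1 (@eval _ _ c _) uq).
  have [x xE] := emod_of (corner_idemZ c z); exists x; rewrite -yE /=.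
  by congr (coind_ev c _); apply: eval_inj; rewrite evalE xE linearZ /= zb evalP.
exists X, a; split; first exact: Pfin_of_emod fX (Pfin_iso (iso_sym eX) pN).
move=> Y f pY; have [h hE] := pl _ (emap c f) (Pfin_emod pY).
have [H HE] := coind_adj h.
have uf : forall y, u (f y) = q (H y).
  apply: (@coind_map_eq _ _ c Y _ (u \o f) (q \o H)) => y.
  transitivity (coind_ev c (emap c u (emap c f y))); first by congr (coind_ev c _); apply: eval_inj.
  rewrite uE /= -hE -HE -qE; congr (coind_ev c _); exact: eval_inj.
have [g gE] := choice (fun y => ex _ _ (uf y)).
have inj2 x y : a x = a y -> b x = b y -> x = y.
  move=> axy bxy; apply/eqP; rewrite -subr_eq0; apply/eqP/inj.
    by rewrite linearB /= axy subrr.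
  by rewrite linearB /= bxy subrr.
have [|g' g'E] := @linear_of A Y X g.
  move=> r x y; apply: inj2; first by rewrite linearP !(gE _).1 linearP.
  by rewrite linearP !(gE _).2 linearP.
by exists g' => y; rewrite g'E (gE y).1.
Qed.

End Star.

(** * Homomorphisms into a module, over its endomorphism ring *)

Section HomOverEndo.
Variables (R S : pzRingType) (W : lmodType R) (psi : {rmorphism S -> endo W}).
Implicit Types X Y Z N : lmodType R.

Section Module.
Variable X : lmodType R.

(** [S] acts on values through [psi]. Keeping [psi] abstract lets [S] be the converse of an opposite
    ring, or a corner identified with an endomorphism ring. *)
Definition hom_mod (_ : {rmorphism S -> endo W}) : Type := homm X W.
HB.instance Definition _ := GRing.Zmodule.on (hom_mod psi).

Let scale (s : S) (f : hom_mod psi) : hom_mod psi :=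
  ((psi s : {linear W -> W}) \o hom_fun f : {linear X -> W}).

Fact hom_mod_scaleA a b f : scale a (scale b f) = scale (a * b) f.
Proof. by apply: homm_ext => x; rewrite /scale rmorphM. Qed.
Fact hom_mod_scale1 : left_id 1 scale.
Proof. by move=> f; apply: homm_ext => x; rewrite /scale rmorph1. Qed.
Fact hom_mod_scaleDr : right_distributive scale +%R.
Proof. by move=> a f g; apply: homm_ext => x; apply: linearD. Qed.
Fact hom_mod_scaleDl f : {morph scale^~ f : a b / a + b}.
Proof. by move=> a b; apply: homm_ext => x; rewrite /scale rmorphD. Qed.
HB.instance Definition _ := GRing.Zmodule_isLmodule.Build S (hom_mod psi)
  hom_mod_scaleA hom_mod_scale1 hom_mod_scaleDr hom_mod_scaleDl.

Definition hval (f : hom_mod psi) : {linear X -> W} := hom_fun f.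

Lemma hvalD f g x : hval (f + g) x = hval f x + hval g x. Proof. by []. Qed.
Lemma hvalZ a f x : hval (a *: f) x = endo_fun (psi a) (hval f x). Proof. by []. Qed.
Lemma hval0 x : hval 0 x = 0. Proof. by []. Qed.
Lemma hval_ext f g : (forall x, hval f x = hval g x) -> f = g.
Proof. exact: homm_ext. Qed.

End Module.

Lemma hmap_exists X Y (f : {linear X -> Y}) :
  exists h : {linear hom_mod Y psi -> hom_mod X psi},
    forall u x, hval (h u) x = hval u (f x).
Proof.
have [|h hE] := @linear_of S (hom_mod Y psi) (hom_mod X psi)
  (fun u => (hval u \o f : {linear X -> W})).
  by move=> a u v; apply: hval_ext.
by exists h => u x; rewrite hE.
Qed.

Lemma hom_retract X Y : retract X Y -> retract (hom_mod X psi : lmodType S) (hom_mod Y psi).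
Proof.
move=> [f [g gf]]; have [h hE] := hmap_exists f; have [k kE] := hmap_exists g.
by exists k, h => u; apply: hval_ext => x; rewrite hE kE gf.
Qed.

(** Surjectivity of the restriction map is exactly the extension property [ext1]. *)
Lemma hom_ses X Y Z (i : {linear X -> Y}) (p : {linear Y -> Z}) : ses i p -> ext1 Z W ->
  exists (p' : {linear hom_mod Z psi -> hom_mod Y psi})
    (i' : {linear hom_mod Y psi -> hom_mod X psi}), ses p' i'.
Proof.
move=> si e; have [ii ps ei] := si.
have [p' pE] := hmap_exists p; have [i' iE] := hmap_exists i.
exists p', i'; split=> [u v uv|u|u].
- apply: hval_ext => z; have [y <-] := ps z.
  by rewrite -!pE uv.
- have [h hE] := e _ _ _ _ si (hval u); exists (h : hom_mod Y psi).
  by apply: hval_ext => x; rewrite iE -hE.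
split=> [u0|[v <-]]; last first.
  by apply: hval_ext => x; rewrite iE pE (ses_comp0 _ si) linear0.
have [|h hE] := @factor_surj _ _ _ _ p (hval u) ps.
  by move=> y /ei[x <-]; rewrite -iE u0.
by exists (h : hom_mod Z psi); apply: hval_ext => y; rewrite pE -hE.
Qed.

Hypothesis psi_bij : bijective psi.

Lemma projective_hom_self : projective (hom_mod W psi).
Proof.
have [|h hE] := @linear_of S S^o (hom_mod W psi) (fun s => psi s : {linear W -> W}).
  by move=> a x y; rewrite rmorphD rmorphM; apply: hval_ext.
apply: (projective_iso _ (@projective_ring S)); exists h.
have [psi' pK pK'] := psi_bij.
apply: (Bijective (g := fun u : hom_mod W psi => psi' (hval u))) => x; rewrite hE.
  exact: pK.
exact: pK'.
Qed.

Lemma projective_hom_mpow n : projective (hom_mod (mpow W n) psi).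
Proof.
elim: n => [|n IHn] /=.
  apply: projective_zero => u; apply: hval_ext => x.
  by rewrite (@zero_module_free0 R x) linear0.
apply: projective_iso (projective_prod projective_hom_self IHn).
have [i iE] := pair_map (idfun : {linear W -> W}) (\0 : {linear W -> mpow W n}).
have [j jE] := pair_map (\0 : {linear mpow W n -> W}) (idfun : {linear mpow W n -> mpow W n}).
have [i' i'E] := hmap_exists i; have [j' j'E] := hmap_exists j.
have [h hE] := pair_map i' j'; apply: iso_sym; exists h; apply: inj_surj_bij.
  apply: inj_ker0 => u; rewrite hE => -[ui uj]; apply: hval_ext => -[x y].
  have -> : (x, y) = i x + j y by rewrite iE jE; congr pair; rewrite /= ?addr0 ?add0r.
  by rewrite linearD /= -i'E -j'E ui uj !hval0 addr0.
move=> [u v]; exists (((hval u \o fst) \+ (hval v \o snd)) : {linear (W * mpow W n)%type -> W}).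
by rewrite hE; congr pair; apply: hval_ext => x; rewrite ?i'E ?j'E ?iE ?jE /hval /= linear0 ?addr0 ?add0r.
Qed.

Hypothesis aR : finite_over_artin R.

Lemma Pfin_cover N : Pfin N -> exists n (p : {linear free R n -> N}) (K : lmodType R)
  (i : {linear K -> free R n}),
  [/\ ses i p, Pfin K & forall m, pd m.+1 N -> pd m K].
Proof.
move=> pN; have /PfinE[fN _] := pN; have [n [p ps]] := iffLR (fg_free N) fN.
have [K [i si]] := ses_ker ps; exists n, p, K, i; split=> //.
  apply: (Pfin_ker aR si) pN; apply/PfinE; split; first exact: fg_free_mod.
  by exists 0%N; apply: free_projective.
by move=> m; apply: pd_ker si; apply: free_projective.
Qed.

Hypothesis W_Pfin : Pfin W.
Hypothesis W_ext : forall N, Pfin N -> ext1 N W.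
Hypothesis W_cogen : forall N, Pfin N -> fin_cogen W N.
Variable d : nat.
Hypothesis findim : forall N, Pfin N -> pd d N.

(** [n] counts the cosyzygies already taken and [j] those remaining. The hypothesis on [Y] is void
    of content for n = 0 and means Ext-injectivity in P^<oo for n = d. *)
Lemma pd_hom_step n j Y : (n + j)%N = d -> Pfin Y ->
  (forall N, Pfin N -> pd n N -> ext1 N Y) -> pd j (hom_mod Y psi).
Proof.
elim: j n Y => [|j IHj] n Y nd pY eY.
all: have [k [i ii]] := fin_cogen_mpow (W_cogen pY).
all: have [Y' [p si]] := ses_cok ii.
all: have pY' : Pfin Y' := Pfin_cok si pY (Pfin_mpow k W_Pfin).
  (* For j = 0 the cokernel [Y'] has dimension at most n = d, so the embedding of [Y] in a power of
     [W] splits. *)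
  have [|r rE] := ext1_retraction _ si; first by apply: eY => //; rewrite -[n]addn0 nd; apply: findim.
  apply: (@projective_retract _ (hom_mod (mpow W k) psi)); last exact: projective_hom_mpow.
  by apply: hom_retract; exists i, r.
have eW N : Pfin N -> ext1 N (mpow W k) by move=> pN; apply/ext1_mpow/W_ext.
have [p' [i' si']] := hom_ses si (W_ext pY').
apply: pd_cok si' _ _; last exact/pd_proj/projective_hom_mpow.
(* Dimension shift: Ext^1(N, Y') is Ext^2(N, Y), which is Ext^1 of a syzygy of [N] with [Y].
   Concretely, a map from the syzygy to [Y'] lifts to W^k, extends to the free cover, and is
   projected back to [Y']. *)
apply: (IHj n.+1) => // [|N pN dN]; first by rewrite addSnnS.
have [m [q [K [l [sl pK dK]]]]] := Pfin_cover pN.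
apply: (ext1_of_pres (@free_projective R m) sl) => f.
have [g gE] := ext1_lift (eY _ pK (dK _ dN)) si f.
have [h hE] := eW _ pN _ _ _ _ sl g.
by exists (p \o h) => x /=; rewrite hE gE.
Qed.

Theorem pdfin_hom Y : Pfin Y -> pdfin (hom_mod Y psi).
Proof.
by move=> pY; exists d; apply: (pd_hom_step (n := 0)) => // N _; apply: ext1_proj.
Qed.

End HomOverEndo.

(** * A bound on finite projective dimensions from the tilting coresolution *)

Section FinitisticDimension.
Variables (R : pzRingType) (T : lmodType R).
Hypotheses (aR : finite_over_artin R) (T_ext : forall N, Pfin N -> ext1 N T).
Implicit Types M N : lmodType R.

Definition syzygy M N : Prop :=
  exists n (p : {linear free R n -> M}) (i : {linear N -> free R n}), ses i p.

(** A relation, since syzygies depend on the chosen free covers; chains can then be cut and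
    concatenated freely. *)
Inductive iter_syzygy : nat -> lmodType R -> lmodType R -> Prop :=
| IterSyzygy0 M : iter_syzygy 0 M M
| IterSyzygyS j M N X : iter_syzygy j M N -> syzygy N X -> iter_syzygy j.+1 M X.

Lemma syzygy_Pfin M N : syzygy M N -> Pfin M -> Pfin N.
Proof.
move=> [n [p [i si]]] pM; apply: (Pfin_ker aR si) pM; apply/PfinE; split; first exact: fg_free_mod.
by exists 0%N; apply: free_projective.
Qed.

Lemma iter_syzygy_Pfin j M N : iter_syzygy j M N -> Pfin M -> Pfin N.
Proof. by elim=> // {}j {}M {}N X _ IH sX /IH; apply: syzygy_Pfin. Qed.

Lemma syzygy_exists M : Pfin M -> exists N, syzygy M N.
Proof.
by move=> /(Pfin_cover aR)[n [p [K [i [si _ _]]]]]; exists K, n, p, i.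
Qed.

Lemma iter_syzygy_exists j M : Pfin M -> exists N, iter_syzygy j M N.
Proof.
move=> pM; elim: j => [|j [N jN]]; first by exists M; constructor.
have [X sX] := syzygy_exists (iter_syzygy_Pfin jN pM).
by exists X; econstructor; eassumption.
Qed.

Lemma iter_syzygy_split a b M N : iter_syzygy (a + b) M N ->
  exists2 X, iter_syzygy a M X & iter_syzygy b X N.
Proof.
elim: b N => [|b IHb] N; first by rewrite addn0 => h; exists N => //; constructor.
rewrite addnS => h; inversion h as [|j M' X N' h1 h2]; subst.
have [Y aY bY] := IHb _ h1; exists Y => //; econstructor; eassumption.
Qed.

Lemma iter_syzygy_cat a b M X N :
  iter_syzygy a M X -> iter_syzygy b X N -> iter_syzygy (a + b) M N.
Proof.
move=> aX bN; elim: bN aX => [Y|j Y Z V _ IH sV] aX; first by rewrite addn0.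
by rewrite addnS; econstructor; [apply: IH|].
Qed.

Lemma iter_syzygy_pd j M N m : iter_syzygy j M N -> pd m N -> pd (m + j) M.
Proof.
move=> jN; elim: jN m => [X|{}j {}M {}N X _ IH [n [p [i si]]]] m pX; first by rewrite addn0.
by rewrite addnS -addSn; apply: IH; exists (free R n), p, X, i; split=> //; apply: free_projective.
Qed.

(* Dimension shifting, in both variables at once. *)
Lemma ext1_shift (K0 X K1 : lmodType R) (a : {linear K0 -> X}) (b : {linear X -> K1}) M N :
  ses a b -> ext1 M K1 -> syzygy M N -> ext1 N X -> ext1 N K0.
Proof.
move=> sab eM [n [p [i si]]] eN K Z j q sjq f.
have [ai bs eab] := sab; have [ji qs ejq] := sjq.
have [h hE] := eN _ _ _ _ sjq (a \o f).
have [|g gE] := @factor_surj _ _ _ _ q (b \o h) qs.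
  by move=> z /ejq[x <-] /=; rewrite hE /= (ses_comp0 _ sab).
have [g1 g1E] := eM _ _ _ _ si g.
have [g2 g2E] := @free_projective R n _ _ b g1 bs.
have [|r rE] := @factor_inj _ K0 X Z a (h \- (g2 \o i \o q) : {linear Z -> X}) ai.
  by move=> z; apply/eab; rewrite /= linearB /= g2E g1E gE subrr.
exists r => x; apply: ai.
by rewrite rE /= (ses_comp0 _ sjq) !linear0 addr0 hE.
Qed.

(** By induction the first syzygy is projective, thus a summand of a power of [R], so the free cover
    of [N] splits. *)
Lemma projective_of_ext1 n N : Pfin N -> pd n N ->
  (forall j X, iter_syzygy j N X -> ext1 X R^o) -> projective N.
Proof.
elim: n N => [//|n IHn] N pN nN eN.
have [m [p [K [i [si pK dK]]]]] := Pfin_cover aR pN.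
have sK : syzygy N K by exists m, p, i.
have prK : projective K.
  apply: IHn => // [|j X jX]; first exact: dK.
  apply: (eN (1 + j)%N); apply: iter_syzygy_cat jX.
  by econstructor; [constructor|].
have [|r rE] := ext1_retraction _ si.
  apply: (@ext1_fin_retract _ N R^o); last by apply: (eN 0%N); constructor.
  by apply: projective_fin_retract => //; have /PfinE[] := pK.
apply: projective_retract (@free_projective R m).
apply: retract_trans (retract_iso (ses_retract_iso si rE)).
apply: retract_trans (retract_iso (iso_prodC _ _)); exact: retract_prod.
Qed.

(** Let [K i] be the cosyzygies of [R] in the coresolution. Shifting along them shows that Ext^1 of
    an (s+1)-st syzygy with [R] vanishes. Further syzygies are again (s+1)-st syzygies, so
    [projective_of_ext1] applies. *)
Lemma findim_bound : add_coresolution T -> exists s, forall N, Pfin N -> pd s N.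
Proof.
move=> [s [X [eta [d [XT X0 ei e0 eS]]]]].
have kex i : exists K : {K : lmodType R & {linear K -> X i}},
    injective (projT2 K) /\ exact_at (projT2 K) (d i).
  by have [K [k kP]] := ker_exists (d i); exists (existT _ K k).
pose K i : lmodType R := projT1 (sval (cid (kex i))).
pose k i : {linear K i -> X i} := projT2 (sval (cid (kex i))).
have kP i : injective (k i) /\ exact_at (k i) (d i) := svalP (cid (kex i)).
have sK i : exists q : {linear X i -> K i.+1}, ses (k i) q.
  have [ki ke] := kP i; have [ki' ke'] := kP i.+1.
  have [|q qE] := @factor_inj _ (K i.+1) _ _ (k i.+1) (d i) ki'.
    by move=> x; apply/ke'/eS; exists x.
  exists q; split=> // [y|x].
    have /eS[x xE] : d i.+1 (k i.+1 y) = 0 by apply/ke'; exists y.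
    by exists x; apply: ki'; rewrite qE.
  by rewrite -ke -qE; split=> [->|/(ker0_inj ki')//]; rewrite linear0.
have K0 : retract R^o (K 0).
  have [ki ke] := kP 0%N.
  have [|f fE] := @factor_inj _ (K 0%N) _ _ (k 0%N) eta ki.
    by move=> x; apply/ke/e0; exists x.
  apply: retract_iso; exists f; apply: inj_surj_bij => [x y /(congr1 (k 0%N))|y].
    by rewrite !fE => /ei.
  have /e0[x xE] : d 0%N (k 0%N y) = 0 by apply/ke; exists y.
  by exists x; apply: ki; rewrite fE.
have eX N i : Pfin N -> ext1 N (X i).
  by move=> pN; apply: ext1_fin_retract (in_add_fin_retract (XT i)) (T_ext pN).
(* The recursion starts at [K s.+1], zero because [X s.+1] is, and ends for j = s + 1 at [K 0],
   which is isomorphic to [R]. *)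
have shift j M N : (j <= s.+1)%N -> Pfin M -> iter_syzygy j M N -> ext1 N (K (s.+1 - j)%N).
  move=> js pM jN; elim: jN js pM => {j M N} [M _ _|j M N Y jN IH sY js pM].
    apply: ext1_zero => x; have [ki _] := kP (s.+1 - 0)%N; apply: ki.
    by rewrite linear0; apply: X0; rewrite subn0.
  have [q sq] := sK (s.+1 - j.+1)%N; apply: (ext1_shift sq _ sY).
    by rewrite -subSn // subSS; apply: IH => //; apply: ltnW.
  apply: eX; apply: syzygy_Pfin sY _; exact: iter_syzygy_Pfin jN pM.
exists s.+1 => N pN; have [N' sN'] := iter_syzygy_exists s.+1 pN.
have pN' := iter_syzygy_Pfin sN' pN; have /PfinE[_ [n nN']] := pN'.
apply: (iter_syzygy_pd (m := 0) sN'); apply: projective_of_ext1 pN' nN' _ => j Y jY.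
(* The [j]-th syzygy of the (s+1)-st is regrouped as the (s+1)-st syzygy of a [j]-th one. *)
have := iter_syzygy_cat sN' jY; rewrite addnC => /iter_syzygy_split[M jM sM].
have := shift _ _ _ (leqnn _) (iter_syzygy_Pfin jM pN) sM.
by rewrite subnn; apply: ext1_retract.
Qed.

End FinitisticDimension.

(** * Simple modules over a basic ring *)

Section LocalTops.
Variables (R : pzRingType) (p : idempotent_elt R).

Lemma ltop_proj : exists q : {linear R^o -> ltop p}, surjective q /\
  forall a, q a = 0 <-> exists2 j : R, jacobson j & (a : R) * (p : R) = j * (p : R).
Proof.
have inP (a : R^o) : ((a : R) * (p : R) : R^o) \in lproj_pred p.
  by rewrite unfold_in -mulrA idemP.
pose y a : lproj p := exist (fun x => x \in lproj_pred p) _ (inP a).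
have [|q qE] := @linear_of R R^o (ltop p)
    (fun a => \pi_(Quotient.quot (@lproj_rad R p)) (y a)).
  move=> a u v; pose Q := Quotient.quot (@lproj_rad R p).
  transitivity (ltop_scale a (\pi_Q (y u)) + \pi_Q (y v)) => //.
  rewrite ltop_scale_pi -raddfD.
  congr (\pi_(Quotient.quot (@lproj_rad R p)) _); apply: val_inj; rewrite /= mulrDl -mulrA //.
exists q; split.
  elim/quotW => x; exists (val x); rewrite qE; congr (\pi_(Quotient.quot (@lproj_rad R p)) _); apply: val_inj.
  exact/eqP/(valP x).
move=> a; rewrite qE; have pi0 : \pi_(Quotient.quot (@lproj_rad R p)) (0 : lproj p) = 0.
  by rewrite raddf0.
rewrite -{1}pi0; split=> [/eqP|[j Jj aj]].
  by rewrite -Quotient.idealrBE subr0 => /asboolP.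
by apply/eqP; rewrite -Quotient.idealrBE subr0; apply/asboolP; exists j.
Qed.

End LocalTops.

Section Jacobson.
Variable R : pzRingType.

(** The annihilator of a nonzero element of a simple module is a maximal left ideal. *)
Lemma jacobson_simple (S : lmodType R) (j : R) (x : S) :
  simple_mod S -> jacobson j -> j *: x = 0.
Proof.
move=> sS Jj; have [->|/eqP x0] := eqVneq x 0; first by rewrite scaler0.
apply: (Jj (fun a : R^o => (a : R) *: x = 0)); split.
- split=> [|a u v ux vx]; first by rewrite scale0r.
  by rewrite scalerDl -scalerA ux vx scaler0 addr0.
- move=> /(congr1 (fun A => A 1)) h; apply: x0.
  by rewrite -[x]scale1r h.
move=> I Is AI; have [|h hE] := @linear_of R R^o S (fun a => (a : R) *: x).
  by move=> a u v; rewrite scalerDl scalerA.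
have [_ /(_ _ (submodule_image h Is))[h0|h1]] := sS.
  left; apply/predeqP => a; split=> [Ia|]; last exact: AI.
  by rewrite -hE; apply: h0; exists a.
right; apply/predeqP => a; split=> // _; have [b Ib bx] := h1 x.
have I1 : I (1 : R^o).
  rewrite -(subrK b 1) [_ + b]addrC; apply: submoduleD => //; apply: AI.
  by rewrite scalerBl scale1r -hE bx subrr.
by rewrite -[a]mulr1; apply: (submoduleZ (a : R) Is I1).
Qed.

(** If p <> 0, some maximal left ideal contains 1 - p, by the maximum condition; it also contains
    [p], hence 1. *)
Lemma jacobson_idem (p : idempotent_elt R) : noeth R^o -> jacobson (p : R) -> (p : R) = 0.
Proof.
move=> nR Jp; apply: contrapT => p0.
pose q := 1 - (p : R); have pq : q * (p : R) = 0 by rewrite mulrBl mul1r idemP subrr.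
pose F (I : set R^o) := [/\ submodule I, ~ I (1 : R) & I q].
have [| |I [[Is I1 Iq] Imax]] := nR F.
- by move=> I [].
- exists (fun a : R^o => (a : R) * (p : R) = 0); split=> //; last by rewrite mul1r.
  split=> [|a u v up vp]; first exact: mul0r.
  by rewrite [LHS]mulrDl -mulrA up vp mulr0 addr0.
have mI : maximal_left_ideal I.
  split=> // [IT|I' Is' II']; first by apply: I1; rewrite IT.
  have [I'1|nI'1] := pselect (I' (1 : R)).
    right; apply/predeqP => a; split=> // _; rewrite -[a]mulr1.
    exact: (submoduleZ (a : R) Is' I'1).
  left; apply/predeqP => a; apply: iff_sym; apply: Imax => //.
  by split=> //; apply: II'.
apply: I1; rewrite -[1](subrK (p : R)); apply: (submoduleD Is Iq); exact: Jp.
Qed.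

End Jacobson.

Section BasicRing.
Variable R : pzRingType.
Variables (n : nat) (D : 'I_n -> nzRingType) (f : forall i, {rmorphism R -> D i}).
Hypothesis Ddiv : forall i, division_ring (D i).
Hypothesis fJ : forall x, jacobson x <-> forall i, f i x = 0.
Hypothesis f_surj : forall y : (forall i, D i), exists x, forall i, f i x = y i.

Lemma division_mul0 (i : 'I_n) (x y : D i) : x * y = 0 -> x = 0 \/ y = 0.
Proof.
move=> xy; have [->|x0] := eqVneq x 0; [by left | right].
by have [z [zx _]] := Ddiv x0; rewrite -[y]mul1r -zx -mulrA xy mulr0.
Qed.

Lemma division_idem (i : 'I_n) (p : idempotent_elt R) : f i (p : R) = 0 \/ f i (p : R) = 1.
Proof.
have h : f i (p : R) * (1 - f i (p : R)) = 0 by rewrite mulrBr mulr1 -rmorphM idemP subrr.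
by case: (division_mul0 h) => [|/eqP]; [left | rewrite subr_eq0 => /eqP <-; right].
Qed.

Lemma component_exists (i : 'I_n) : exists c : R, f i c = 1 /\ forall j, j != i -> f j c = 0.
Proof.
have [c cE] := f_surj (fun j => (j == i)%:R); exists c; split=> [|j /negPf ji].
  by rewrite cE eqxx.
by rewrite cE ji.
Qed.

(* Over R/J = \prod D_i every simple module is the i-th factor for a unique i. *)
Lemma simple_component (S : lmodType R) (x : S) : simple_mod S -> x <> 0 ->
  exists i, forall a : R, a *: x = 0 <-> f i a = 0.
Proof.
move=> sS x0; have [c cP] := choice component_exists.
have [i cx] : exists i, c i *: x <> 0.
  apply: contrapT => nc; apply: x0.
  have J1 : jacobson (1 - \sum_i c i).
    apply/fJ => i; rewrite rmorphB rmorph1 rmorph_sum (bigD1 i) //= (cP i).1.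
    by rewrite big1 ?addr0 ?subrr // => j ij; apply: (cP j).2; rewrite eq_sym.
  have := jacobson_simple x sS J1; rewrite scalerBl scale1r => /eqP.
  rewrite subr_eq0 => /eqP ->; rewrite scaler_suml big1 // => i _.
  by apply: contrapT => cx; apply: nc; exists i.
have JS (a : R) (y : S) : (forall j, f j a = 0) -> a *: y = 0.
  by move=> h; apply: (jacobson_simple y sS); apply/fJ.
have comm (a : R) (y : S) : c i *: (a *: y) = a *: (c i *: y).
  apply/eqP; rewrite -subr_eq0 !scalerA -scalerBl; apply/eqP/JS => j.
  rewrite rmorphB !rmorphM; have [->|ji] := eqVneq j i.
    by rewrite (cP i).1 mul1r mulr1 subrr.
  by rewrite (cP i).2 // mul0r mulr0 subrr.
have [|h hE] := @linear_of R S S (fun y => c i *: y).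
  by move=> a y z; rewrite scalerDr comm.
have [h0|hi] := simple_inj h sS; first by case: cx; rewrite -hE.
have cxx : c i *: x = x.
  apply: hi; rewrite !hE; apply/eqP; rewrite -subr_eq0 scalerA -scalerBl; apply/eqP/JS => j.
  rewrite rmorphB rmorphM; have [->|ji] := eqVneq j i.
    by rewrite (cP i).1 mul1r subrr.
  by rewrite (cP i).2 // mul0r subrr.
exists i => a; split=> [ax|fa].
  apply: contrapT => /eqP fa; have [z [zf _]] := Ddiv fa.
  (* [y] has [i]-th component the inverse [z] of [f i a] and all others zero, so [c i * y * a]
     agrees with [c i] modulo the radical. *)
  have [y yE] := f_surj (fun j => (j == i)%:R * (if i =P j is ReflectT e then ecast j (D j) e z else 0)).
  have yi : f i y = z by rewrite yE eqxx mul1r; case: eqP => // e; rewrite (eq_axiomK e).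
  apply: x0; rewrite -[x]cxx.
  rewrite (_ : c i *: x = (c i * y * a) *: x); first by rewrite -!scalerA ax !scaler0.
  apply/eqP; rewrite -subr_eq0 -scalerBl; apply/eqP/JS => j.
  rewrite rmorphB !rmorphM; have [->|ji] := eqVneq j i.
    by rewrite (cP i).1 mul1r yi zf subrr.
  by rewrite (cP i).2 // !mul0r subrr.
rewrite -cxx scalerA; apply: JS => j; rewrite rmorphM; have [->|ji] := eqVneq j i.
  by rewrite fa mul0r.
by rewrite (cP i).2 // mulr0.
Qed.

(** [S] is the factor D_i for an index where [f i p = 1]. The element [c] supported at [i] defines
    the inclusion ay |-> [ac] of [S = Ry] into Rp/Jp, and [a] |-> ay retracts it. *)
Lemma simple_retract_ltop (S : lmodType R) (x : S) (p : idempotent_elt R) :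
  simple_mod S -> (p : R) *: x <> 0 -> retract S (ltop p).
Proof.
move=> sS px; pose y : S := (p : R) *: x.
have [i iE] := simple_component sS px; have [c [c1 c0]] := component_exists i.
have [q [qs qE]] := ltop_proj p.
have fp : f i (p : R) = 1.
  have [/iE|//] := division_idem i p; by rewrite scalerA idemP.
have [|h hE] := @linear_of R R^o S (fun a => (a : R) *: y).
  by move=> a u v; rewrite scalerDl scalerA.
have hs : surjective h.
  by move=> z; have [a aE] := simple_gen z sS px; exists a; rewrite hE.
have [|u uE] := @linear_of R R^o (ltop p) (fun a : R^o => q ((a : R) * c : R^o)).
  by move=> a v w; rewrite -linearP; congr (q _); rewrite [LHS]mulrDl -mulrA.
have [|s sE] := @factor_surj _ _ _ _ h u hs.
  move=> a; rewrite hE => /iE fa; rewrite uE; apply/qE.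
  exists ((a : R) * c) => //; apply/fJ => j; rewrite rmorphM.
  have [->|ji] := eqVneq j i; first by rewrite fa mul0r.
  by rewrite c0 ?mulr0.
have [|t tE] := @factor_surj _ _ _ _ q h qs.
  move=> a /qE[j Jj aj]; rewrite hE /y scalerA aj -scalerA.
  exact: jacobson_simple.
exists s, t => z; have [a <-] := hs z; rewrite sE uE tE !hE -scalerA; congr (_ *: _).
apply/eqP; rewrite -subr_eq0 -{2}[y]scale1r -scalerBl; apply/eqP/iE.
by rewrite rmorphB c1 rmorph1 subrr.
Qed.

(** In each division ring D_i one of the images of [p] and [q] is zero, so qap lies in the radical
    for every [a]. *)
Lemma ltop_orth (p q : idempotent_elt R) (y : ltop p) : (q : R) * (p : R) = 0 ->
  (q : R) *: y = 0.
Proof.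
move=> qp; have [r [rs rE]] := ltop_proj p; have [a <-] := rs y; rewrite -linearZ.
apply/rE; exists ((q : R) * a * (p : R)); last by rewrite -mulrA idemP.
apply/fJ => i; rewrite !rmorphM.
have : f i (q : R) * f i (p : R) = 0 by rewrite -rmorphM qp rmorph0.
by case/division_mul0 => ->; rewrite ?mulr0 ?mul0r.
Qed.

Lemma ltop_nzero (p : idempotent_elt R) : noeth R^o -> (p : R) <> 0 -> ~ zero_module (ltop p).
Proof.
move=> nR p0 z; apply: p0; apply: jacobson_idem nR _.
have [r [rs rE]] := ltop_proj p; have /rE[j Jj] := z (r (1 : R^o)).
rewrite mul1r => ->; apply/fJ => i; rewrite rmorphM.
by have /fJ -> := Jj; rewrite mul0r.
Qed.

End BasicRing.

(** * Cogeneration and torsion *)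

Section Cogeneration.
Variable R : pzRingType.
Implicit Types M N S V X Y Z : lmodType R.

Lemma fg_dsum n (M : 'I_n -> lmodType R) :
  (forall i, finitely_generated (M i)) -> finitely_generated (dsum M).
Proof.
move=> fM; pose m i := sval (cid (fM i)).
pose s i : 'I_(m i) -> M i := sval (cid (svalP (cid (fM i)))).
have sE i : forall x, exists c : 'I_(m i) -> R, x = \sum_j c j *: s i j :=
  svalP (cid (svalP (cid (fM i)))).
have [p [q [_ _ _ qp]]] := dsum_maps M.
apply: (@fg_family _ _ {i : 'I_n & 'I_(m i)} (fun u => q (tag u) (s (tag u) (tagged u)))).
move=> x; pose c i := sval (cid (sE i (p i x))).
have cE i : p i x = \sum_j c i j *: s i j := svalP (cid (sE i (p i x))).
exists (fun u => c (tag u) (tagged u)).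
rewrite -(sig_big_dep xpredT (fun=> xpredT) (fun i j => c i j *: q i (s i j))) /=.
rewrite {1}[x]qp; apply: eq_bigr => i _; rewrite {1}cE linear_sum.
by apply: eq_bigr => j _; rewrite linearZ.
Qed.

Lemma fin_cogen_zero V X : zero_module X -> fin_cogen V X.
Proof. by move=> X0; exists 0%N, (fun=> \0) => x _; apply: X0. Qed.

(* A map from M to a module cogenerated by V, with minimal kernel, is injective. *)
Lemma fin_cogen_of_simple V M : artin M ->
  (forall S (i : {linear S -> M}), simple_mod S -> injective i ->
     exists Y (h : {linear M -> Y}), fin_cogen V Y /\ exists s, h (i s) <> 0) ->
  fin_cogen V M.
Proof.
move=> aM hM; pose F (K : set M) := exists Y (h : {linear M -> Y}),
  fin_cogen V Y /\ forall x, K x <-> h x = 0.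
have [| |K [[Y [h [cY hK]]] Kmin]] := aM F.
- move=> K [Y [h [_ hK]]]; have [h0 hS] := submodule_ker h.
  split=> [|a x y]; first exact/hK.
  by move=> /hK hx /hK hy; apply/hK/hS.
- exists (fun=> True), (free R 0), \0; split=> //.
  by apply: fin_cogen_zero; apply: zero_module_free0.
apply: (fin_cogen_inj (f := h) _ cY); apply: inj_ker0.
have [L [j [ji jh]]] := ker_exists h.
have [L0|nL] := pselect (zero_module L).
  by move=> x /jh[y <-]; rewrite (L0 y) linear0.
have [S [i [sS ii]]] := artin_simple (chain_cond_inj ji aM) nL.
have [Y' [h' [cY' [s hs]]]] := hM S (j \o i) sS (inj_comp ji ii).
have [g gE] := pair_map h h'.
case: hs; have : (fun x => g x = 0) (j (i s)).
  apply/(Kmin (fun x => g x = 0)).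
  - by exists (Y * Y')%type, g; split=> //; apply: fin_cogen_prod.
  - by move=> x gx; apply/hK; move: gx; rewrite gE => -[].
  - by apply/hK/jh; exists (i s).
by rewrite gE => -[].
Qed.

(** Each factor of a nontrivial decomposition is a proper quotient, so [noeth_ind] splits [D] down
    to indecomposables. *)
Lemma fin_cogen_indecomposables V D : noeth D ->
  (forall X, indecomposable X -> in_add D X -> fin_cogen V X) -> fin_cogen V D.
Proof.
move=> nD hV; move: (in_add_refl D); move: {-2}D nD.
apply: noeth_ind => M IH DM.
have [M0|nM0] := pselect (zero_module M); first exact: fin_cogen_zero.
have [iM|niM] := pselect (indecomposable M); first exact: hV.
have [X [Y [XY [nX nY]]]] : exists X Y, isomorphic M (X * Y)%type /\
    ~ zero_module X /\ ~ zero_module Y.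
  apply: contrapT => nXY; apply: niM; split=> // X Y XY.
  apply: contrapT => /not_orP[nX nY]; apply: nXY; by exists X, Y.
have [f fb] := XY; have fs := bij_surj fb; have [f' fK f'K] := linear_inverse fb.
have DXY := in_add_iso XY DM.
have cX : fin_cogen V X.
  apply: (IH X (fst \o f)) (in_add_summand DXY).
    by move=> x; have [z zE] := fs (x, 0); exists z; rewrite /= zE.
  move=> fi; apply: nY => y; have : f' (0, y) = 0 by apply: fi; rewrite /= f'K linear0.
  by move/(congr1 f); rewrite f'K linear0 => -[].
have cY : fin_cogen V Y.
  apply: (IH Y (snd \o f)) (in_add_summand (in_add_iso (iso_prodC _ _) DXY)).
    by move=> y; have [z zE] := fs (0, y); exists z; rewrite /= zE.
  move=> fi; apply: nX => x; have : f' (x, 0) = 0 by apply: fi; rewrite /= f'K linear0.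
  by move/(congr1 f); rewrite f'K linear0 => -[].
by apply: fin_cogen_inj (bij_inj fb) _; apply: fin_cogen_prod.
Qed.

End Cogeneration.

Section Killed.
Variables (A B : pzRingType) (c : corner_of A B).
Hypothesis aA : finite_over_artin A.
Local Notation e := (c 1).
Implicit Types I K M N S V X Y : lmodType A.

(** Split off a simple submodule and pass to the proper quotient. *)
Lemma killed_of_simple :
  (forall S, simple_mod S -> killed c S -> pdfin S) ->
  forall M, finitely_generated M -> killed c M -> pdfin M.
Proof.
move=> hS M fM; have nM := artin_algebra_chain_cond aA true fM; move: M nM fM.
apply: noeth_ind => M IH fM kM.
have [M0|nM] := pselect (zero_module M); first by exists 0%N; apply: pd_zero.
have [S [i [sS ii]]] := artin_simple (artin_algebra_chain_cond aA false fM) nM.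
have [Q [q sq]] := ses_cok ii; have [_ qs _] := sq.
apply: (pdfin_ext sq).
  by apply: hS => // s; apply: ii; rewrite linearZ linear0; apply: kM.
apply: (IH Q q) => //; last 1 first.
- by move=> x; have [y <-] := qs x; rewrite -linearZ (kM y) linear0.
- move=> qi; have [/nzero_exists[s s0] _] := sS; apply: s0; apply: ii; rewrite linear0.
  by apply: qi; rewrite (ses_comp0 _ sq) linear0.
- exact: fg_surj qs fM.
Qed.

Definition torsion_free V : Prop :=
  forall S (f : {linear S -> V}), simple_mod S -> killed c S -> forall s, f s = 0.

Lemma torsion_free_cogen V X : fin_cogen V X -> torsion_free V -> torsion_free X.
Proof.
move=> [n [f fE]] tV S g sS kS s; apply: fE => i.
exact: (tV S (f i \o g)).
Qed.

Lemma torsion_free_dsum n (M : 'I_n -> lmodType A) :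
  (forall i, torsion_free (M i)) -> torsion_free (dsum M).
Proof.
move=> tM S f sS kS s; have [p [q [_ _ _ qp]]] := dsum_maps M.
rewrite [f s]qp big1 // => i _; have /= -> := tM i S (p i \o f) sS kS s.
exact: linear0.
Qed.

Lemma torsion_free_coind (N : lmodType B) : torsion_free (coind c N).
Proof.
move=> S f sS kS s; apply: coind_faithful => a.
by rewrite -!linearZ /= kS linear0.
Qed.

Lemma killed_torsion_free0 V K (i : {linear K -> V}) : torsion_free V ->
  finitely_generated K -> injective i -> killed c K -> zero_module K.
Proof.
move=> tV fK ii kK; apply: contrapT => nK.
have [S [j [sS ji]]] := artin_simple (artin_algebra_chain_cond aA false fK) nK.
have [/nzero_exists[s s0] _] := sS; apply: s0; apply: (ker0_inj ji); apply: ii; rewrite linear0.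
by apply: (tV S (i \o j)) => // t; apply: ji; rewrite linearZ linear0; apply: kK.
Qed.

(* If a simple Pfin submodule S were in the kernel of a minimal approximation phi,    *)
(* then phi would factor through A/S, producing a non-injective u with phi u = phi.   *)
Lemma minimal_approximation_torsion_free X (E : lmodType A) I (phi : {linear X -> E})
    (iota : {linear I -> E}) :
  minimal_approximation phi -> injective_envelope iota ->
  (forall y : I, e *: y = y) ->
  (forall S, simple_mod S -> killed c S -> Pfin S) -> torsion_free X.
Proof.
move=> [[pX lift] mphi] [_ iotai ess] eI pS S f sS kS.
have [//|fi] := simple_inj f sS.
have [phif|phifi] := simple_inj (phi \o f) sS; last first.
  have [/nzero_exists[s s0] _] := sS.
  have [|y [iy [t tE]]] := ess _ (submodule_range (phi \o f)).
    move=> /(congr1 (fun Z : set E => Z (phi (f s)))) h; apply: s0; apply: phifi.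
    by rewrite linear0 /=; have : [set 0]%classic (phi (f s)) by rewrite -h; exists s.
  by case: iy; rewrite -(eI y) linearZ -tE -linearZ (kS t) linear0.
have [Q [q sq]] := ses_cok fi; have [_ qs exq] := sq.
have [|g gE] := @factor_surj _ _ _ _ q phi qs.
  by move=> x /exq[z <-]; apply: phif.
have [h hE] := lift Q g (Pfin_cok sq (pS _ sS kS) pX).
have /bij_inj ui := mphi (h \o q) (fun x => etrans (hE _) (gE x)).
move=> s; apply: ui; by rewrite /= (ses_comp0 _ sq) !linear0.
Qed.

End Killed.

(** * Torsion-free modules and their corners *)

Section TorsionFreeCorner.
Variables (k : comPzRingType) (A B : pzRingType) (c : corner_of A B).
Variables (phi : {rmorphism k -> A}) (psi : {rmorphism k -> B}).
Hypotheses (ak : artin k^o) (fA : finite_algebra phi) (fB : finite_algebra psi).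
Hypothesis psic : forall a, c (psi a) = phi a * c 1.
Local Notation e := (c 1).
Implicit Types M X Y : lmodType A.
Hypothesis killed_pdfin : forall M, finitely_generated M -> killed c M -> pdfin M.
Variable d : nat.
Hypothesis pd_eA : pd d (emod c A^o).

Let aA : finite_over_artin A. Proof. by exists k, phi. Qed.
Let aB : finite_over_artin B. Proof. by exists k, psi. Qed.

(** Instantiated by T' over Lambda. *)
Variable V : lmodType A.
Hypotheses (V_Pfin : Pfin V) (V_ext : forall N, Pfin N -> ext1 N V).
Hypothesis V_tf : torsion_free c V.
Hypothesis V_cogen : forall M, Pfin M ->
  (forall (S : lmodType A) (i : {linear S -> M}), simple_mod S -> injective i -> ~ killed c S) ->
  fin_cogen V M.

Let fV : finitely_generated V. Proof. by have /PfinE[] := V_Pfin. Qed.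

(* The unit of the adjunction is injective since V is torsion-free; its cokernel is   *)
(* killed by e, so it splits, and the complement vanishes as coind is torsion-free.   *)
Lemma coind_unit_bij : exists u : {linear V -> coind c (emod c V)},
  bijective u /\ forall x, coind_ev c (emap c u x) = x.
Proof.
have [u uE] := coind_adj (idfun : {linear emod c V -> emod c V}).
exists u; split=> //.
have ei x : emap c u x = 0 -> x = 0 by move=> ux; rewrite -[x]uE ux linear0.
have ui : injective u.
  have [K [i [ii iu]]] := ker_exists u.
  have K0 : zero_module K.
    apply: (killed_torsion_free0 aA V_tf (fg_sub aA ii fV) ii) => x.
    apply: ii; rewrite linear0; have [y yE] := emod_of (corner_idemZ c (i x)).
    rewrite linearZ /= -yE (ei y) //; apply: eval_inj.
    have ix : u (i x) = 0 by apply/iu; exists x.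
    by rewrite evalE yE linearZ /= ix scaler0.
  by apply: inj_ker0 => x /iu[y <-]; rewrite (K0 y) linear0.
apply: (inj_surj_bij ui); have [Q [q sq]] := ses_cok ui; have [_ qs exq] := sq.
have uee x : emap c u (coind_ev c x) = x.
  by apply: coind_ev_inj; rewrite uE.
have fC := fg_coind ak fA psic fB (fg_emod ak fA psic fV).
have fQ := fg_surj qs fC.
have kQ : killed c Q.
  move=> z; have [y <-] := qs z; rewrite -linearZ /=.
  have [x xE] := emod_of (corner_idemZ c y); rewrite -xE -(uee x) evalE.
  exact: (ses_comp0 _ sq).
have [r rE] := ext1_retraction (V_ext (iffRL (PfinE _) (conj fQ (killed_pdfin fQ kQ)))) sq.
move=> y; exists (r y); apply/eqP; rewrite -subr_eq0; apply/eqP; apply: coind_faithful => a.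
pose z := u (r y) - y; have rz : r z = 0 by rewrite linearB /= rE subrr.
have [x xE] := emod_of (corner_idemZ c (a *: z)); rewrite -/z -xE -(uee x) evalE.
suff -> : eval (coind_ev c x) = 0 by rewrite linear0.
by rewrite -[LHS]rE -evalE uee xE !linearZ /= rz !scaler0.
Qed.

(** [V] is coinduced from eV, so by adjunction, and together with [emap_determines], Hom_A(X, V) =
    Hom_B(eX, eV). *)
Lemma emap_extend X (t : {linear emod c X -> emod c V}) :
  exists F : {linear X -> V}, forall x, emap c F x = t x.
Proof.
have [u [ub uE]] := coind_unit_bij; have [v uK vK] := linear_inverse ub.
have [F FE] := coind_adj t; exists (v \o F) => x.
rewrite -[LHS]uE -FE; congr (coind_ev c _); apply: eval_inj.
by rewrite !evalE /= vK.
Qed.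

Lemma emap_determines X (F G : {linear X -> V}) :
  (forall x, emap c F x = emap c G x) -> forall x, F x = G x.
Proof.
have [u [ub uE]] := coind_unit_bij => FG x; apply: (bij_inj ub).
apply: (@coind_map_eq _ _ c X _ (u \o F) (u \o G)) => y.
congr (coind_ev c _); apply: eval_inj; rewrite !evalE /=.
by congr (u _); apply: (congr1 (@eval _ _ c V) (FG y)).
Qed.

Let pe M := @Pfin_emod k A B c phi psi ak fA psic d pd_eA M.
Let pc N := @Pfin_coind k A B c phi psi ak fA fB psic killed_pdfin d pd_eA N.

Lemma coind_iso (N : lmodType B) : isomorphic (emod c (coind c N)) N.
Proof.
by exists (coind_ev c : {linear emod c (coind c N) -> N}); apply: coind_ev_bij.
Qed.

(** Coinduce a presentation K -> F -> N. The map coind(K) -> coind(F) stays injective and its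
    cokernel [Q] has corner [N], so [Q] is in P^<oo. A map K -> eV therefore coinduces to one that
    extends to coind(F). *)
Lemma ext1_emod (N : lmodType B) : Pfin N -> ext1 N (emod c V).
Proof.
move=> pN; have [m [p [K [i [si pK _]]]]] := Pfin_cover aB pN; have [ii ps eip] := si.
apply: (ext1_of_pres (@free_projective B m) si) => f.
have [i' i'E] := coind_map c i.
have i'i : injective i'.
  apply: inj_ker0 => x ix; apply: coind_faithful => a.
  have [y yE] := emod_of (corner_idemZ c (a *: x)); rewrite -yE.
  suff -> : y = 0 by [].
  apply: coind_ev_inj; apply: ii; rewrite !linear0 -i'E.
  rewrite (_ : emap c i' y = 0) ?linear0 //; apply: eval_inj.
  by rewrite evalE yE !linearZ /= ix !scaler0.
have [Q [q sq]] := ses_cok i'i; have [_ qs exq] := sq.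
have fF := fg_free_mod B m.
have eQ : isomorphic N (emod c Q).
  have [qi' qs' exq'] := emap_ses c sq.
  have [v vK Kv] := linear_inverse (coind_ev_bij c (free B m)).
  have [|w wE] := @factor_surj _ _ _ _ p (emap c q \o v) ps.
    move=> y /eip[x <-]; have [z zx] := bij_surj (coind_ev_bij c K) x.
    apply/exq'; exists z; apply: coind_ev_inj.
    by rewrite i'E zx Kv.
  exists w; apply: inj_surj_bij => [|y].
    apply: inj_ker0 => x; have [y <-] := ps x; rewrite wE => /exq'[z zE].
    apply/eip; exists (coind_ev c z).
    by rewrite -i'E zE Kv.
  by have [z <-] := qs' y; exists (p (coind_ev c z)); rewrite wE /= vK.
have pQ : Pfin Q.
  apply: (Pfin_of_emod ak fA psic killed_pdfin pd_eA); last exact: Pfin_iso eQ pN.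
  exact: fg_surj qs (fg_coind ak fA psic fB fF).
have [u [ub uE]] := coind_unit_bij; have [v uK vK] := linear_inverse ub.
have [f' f'E] := coind_map c f.
have [h hE] := V_ext pQ sq (v \o f').
have [w wK Kw] := linear_inverse (coind_ev_bij c (free B m)).
exists (emap c h \o w) => x; have [z zx] := bij_surj (coind_ev_bij c K) x.
transitivity (emap c h (emap c i' z)); first by rewrite /= -zx -i'E wK.
transitivity (emap c (v \o f') z); first by apply: eval_inj; rewrite !evalE hE.
rewrite -[LHS]uE -zx -f'E; congr (coind_ev c _); apply: eval_inj.
by rewrite !evalE /= vK.
Qed.

(** coind(N) has no simple submodule killed by [e], so it embeds in a power of [V]; then take
    corners. *)
Lemma fin_cogen_emod (N : lmodType B) : Pfin N -> fin_cogen (emod c V) N.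
Proof.
move=> pN; have [f fb] := iso_sym (coind_iso N).
apply: fin_cogen_inj (bij_inj fb) _.
have [|n [g gE]] := V_cogen (pc pN).
  move=> S i sS ii kS; have [/nzero_exists[s s0] _] := sS; apply: s0; apply: (ker0_inj ii).
  exact: torsion_free_coind.
exists n, (fun j => emap c (g j)) => x gx; apply: eval_inj; apply: gE => j.
exact: (congr1 (@eval _ _ c V) (gx j)).
Qed.

Variable s : nat.
Hypothesis findim : forall N : lmodType A, Pfin N -> pd s N.

Lemma findim_corner (N : lmodType B) : Pfin N -> pd (s + d) N.
Proof.
move=> pN; apply: pd_iso (coind_iso N) _.
have pC := pc pN; have /PfinE[fC _] := pC.
exact: (pd_emod ak fA pd_eA fC (findim pC)).
Qed.

Lemma pdfin_hom_emod (S : pzRingType) (chi : {rmorphism S -> endo (emod c V)}) Y :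
  bijective chi -> Pfin Y -> pdfin (hom_mod (emod c Y) chi).
Proof.
move=> chib pY.
exact: (pdfin_hom chib aB (pe V_Pfin) ext1_emod fin_cogen_emod findim_corner (pe pY)).
Qed.

Section EndoCorner.
Variables (T : lmodType A) (E F : pzRingType) (psiT : {rmorphism E -> endo T}).
Variable cE : corner_of E F.
Hypotheses (psiT_bij : bijective psiT) (pT : Pfin T).
Variables (i : {linear V -> T}) (r : {linear T -> V}).
Hypotheses (ri : forall x, r (i x) = x)
  (idemE : forall t, endo_fun (psiT (cE 1)) t = i (r t)).

Let cut (a : E) : {linear V -> V} := r \o (psiT a : {linear T -> T}) \o i.

Let cutE a x : cut a x = r (endo_fun (psiT a) (i x)). Proof. by []. Qed.

Let idem_l a : cE 1 * a = a -> forall t, i (r (endo_fun (psiT a) t)) = endo_fun (psiT a) t.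
Proof. by move=> ea t; rewrite -{2}ea rmorphM -idemE. Qed.

(** The corner of End(T) at the projection [i \o r] is End(V), which equals End(eV) because [V] is
    coinduced. *)
Lemma endo_corner_morphism : exists chi : {rmorphism F -> endo (emod c V)},
  bijective chi /\ forall b, endo_fun (chi b) =1 emap c (cut (cE b)).
Proof.
have [|||chi chiE] := @rmorphism_of F (endo (emod c V))
    (fun b => emap c (cut (cE b)) : {linear emod c V -> emod c V}).
- move=> a b; apply: endo_ext => x; apply: eval_inj.
  by rewrite evalE cutE cjD rmorphD linearD.
- move=> a b; apply: endo_ext => x; apply: eval_inj.
  rewrite evalE cutE cjM rmorphM.
  transitivity (r (endo_fun (psiT (cE a)) (endo_fun (psiT (cE b)) (i (eval x))))) => //.
  by rewrite -(idem_l (corner_l cE b)).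
- by apply: endo_ext => x; apply: eval_inj; rewrite evalE cutE idemE !ri.
have chi_fun b : endo_fun (chi b) =1 emap c (cut (cE b)) by move=> x; rewrite chiE.
exists chi; split=> //; have [psi' pK pK'] := psiT_bij.
have cinj : injective chi.
  move=> b b' /(congr1 (@endo_fun _ _)) bb'.
  have cutbb : forall x, cut (cE b) x = cut (cE b') x.
    by apply: emap_determines => x; rewrite -!chi_fun bb'.
  apply: (cj_inj (c := cE)); apply: (can_inj pK); apply: endo_ext => t.
  rewrite -[cE b]corner_r -[cE b']corner_r !rmorphM.
  rewrite -[LHS]/(endo_fun (psiT (cE b)) (endo_fun (psiT (cE 1)) t)).
  rewrite -[RHS]/(endo_fun (psiT (cE b')) (endo_fun (psiT (cE 1)) t)) idemE.
  rewrite -[LHS]idem_l ?corner_l // -[RHS]idem_l ?corner_l //.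
  by rewrite -!cutE cutbb.
suff csurj t : exists b, chi b = t.
  have [g gK] := choice csurj; exists g => // x; apply: cinj; exact: gK.
have [G GE] := emap_extend (t : {linear emod c V -> emod c V}).
pose a := psi' (i \o G \o r : {linear T -> T}).
have aE x : endo_fun (psiT a) x = i (G (r x)) by rewrite /a pK'.
have [|b bE] := @cj_img _ _ cE a.
  apply: (can_inj pK); apply: endo_ext => x; rewrite !rmorphM.
  rewrite -[LHS]/(endo_fun (psiT (cE 1)) (endo_fun (psiT a) (endo_fun (psiT (cE 1)) x))).
  by rewrite !idemE !aE !ri.
exists b; apply: endo_ext => x; rewrite chi_fun -[RHS]GE; apply: eval_inj.
by rewrite !evalE cutE bE aE !ri.
Qed.

(** The right ideal of the endomorphisms of [T] with image in [V] is Hom(T, V) = Hom(eT, eV), to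
    which [pdfin_hom] applies over [B]. *)
Lemma pdfin_endo_corner : pdfin (emod cE E^o).
Proof.
have [chi [chib chiE]] := endo_corner_morphism; have [psi' pK pK'] := psiT_bij.
apply: pdfin_iso (pdfin_hom_emod chib pT); apply: iso_sym.
pose h0 (a : E) : {linear T -> V} := r \o (psiT a : {linear T -> T}).
have [|h hE] := @linear_of F (emod cE E^o) (hom_mod (emod c T) chi)
    (fun a => emap c (h0 (eval a))).
  move=> b x y; have xe : cE 1 * eval x = eval x := evalP x.
  have hD z : h0 (cE b * eval x + eval y) z = cut (cE b) (h0 (eval x) z) + h0 (eval y) z.
    transitivity (r (endo_fun (psiT (cE b * eval x + eval y)) z)) => //.
    rewrite rmorphD rmorphM cutE -[h0 (eval x) z]/(r (endo_fun (psiT (eval x)) z)).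
    by rewrite (idem_l xe) -[RHS]linearD.
  apply: hval_ext => t; rewrite hvalD hvalZ chiE; apply: eval_inj; exact: hD.
exists h; apply: inj_surj_bij => [|u].
  apply: inj_ker0 => a; rewrite hE => a0; apply: eval_inj.
  have xe : cE 1 * eval a = eval a := evalP a.
  have h00 : forall t, h0 (eval a) t = (\0 : {linear T -> V}) t.
    apply: emap_determines => t; have := congr1 (fun v => hval v t) a0.
    by rewrite /hval /= => ->; apply: eval_inj.
  apply: (can_inj pK); rewrite rmorph0; apply: endo_ext => t.
  by rewrite -(idem_l xe) -[r _]/(h0 (eval a) t) h00 linear0.
have [G GE] := emap_extend (hval u).
pose a := psi' (i \o G : {linear T -> T}).
have aE x : endo_fun (psiT a) x = i (G x) by rewrite /a pK'.
have [|b bE] := @emod_of _ _ cE E^o a.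
  apply: (can_inj pK); apply: endo_ext => x; rewrite rmorphM.
  rewrite -[LHS]/(endo_fun (psiT (cE 1)) (endo_fun (psiT a) x)).
  by rewrite idemE aE ri.
exists b; rewrite hE; apply: hval_ext => t; rewrite -GE; apply: eval_inj.
by rewrite -[LHS]/(r (endo_fun (psiT (eval b)) (eval t))) bE aE ri.
Qed.
End EndoCorner.
End TorsionFreeCorner.

(** * Modules over the endomorphism ring *)

Section EndoAlgebra.
Variables (k : comPzRingType) (R : pzRingType) (phi : {rmorphism k -> R}).
Hypotheses (ak : artin k^o) (fR : finite_algebra phi).
Variables (T : lmodType R) (E : pzRingType) (psi : {rmorphism E -> endo T}).
Hypothesis psi_bij : bijective psi.

(** Evaluation at generators embeds End(T) in a finite power of [T] over [k], which is
    noetherian. *)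
Lemma endo_algebra : finitely_generated T ->
  exists chi : {rmorphism k -> E}, finite_algebra chi.
Proof.
move=> fT; have [cphi _] := fR; have [psi' pK pK'] := psi_bij.
have sc a : {f : {linear T -> T} | forall x, f x = phi a *: x}.
  by apply: linear_of => b x y; rewrite scalerDr !scalerA cphi.
pose f a : E := psi' (sval (sc a)).
have fE a t : endo_fun (psi (f a)) t = phi a *: t.
  by rewrite /f pK' -(svalP (sc a)).
have [|||chi chiE] := @rmorphism_of k E f.
- move=> a b; apply: (can_inj pK); apply: endo_ext => t.
  by rewrite rmorphD -[RHS]/(endo_fun (psi (f a)) t + endo_fun (psi (f b)) t) !fE rmorphD scalerDl.
- move=> a b; apply: (can_inj pK); apply: endo_ext => t.
  by rewrite rmorphM -[RHS]/(endo_fun (psi (f a)) (endo_fun (psi (f b)) t)) !fE rmorphM scalerA.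
- apply: (can_inj pK); apply: endo_ext => t.
  by rewrite rmorph1 fE rmorph1 scale1r.
exists chi; split=> [a x|].
  apply: (can_inj pK); apply: endo_ext => t; rewrite chiE !rmorphM.
  rewrite -[LHS]/(endo_fun (psi (f a)) (endo_fun (psi x) t)).
  rewrite -[RHS]/(endo_fun (psi x) (endo_fun (psi (f a)) t)) !fE.
  by rewrite -[RHS]/((psi x : {linear T -> T}) _) linearZ.
apply: noeth_fg; have [n [s sE]] := fT.
have ev i : {h : {linear restr chi E^o -> restr phi T} | forall x, h x = endo_fun (psi x) (s i)}.
  apply: linear_of => a x y; rewrite rmorphD.
  rewrite -[LHS]/(endo_fun (psi (chi a * x)) (s i) + endo_fun (psi y) (s i)) rmorphM.
  rewrite -[endo_fun (_ * _) _]/(endo_fun (psi (chi a)) (endo_fun (psi x) (s i))).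
  by rewrite chiE fE.
apply: (@chain_cond_cogen _ true (restr phi T)); last exact: algebra_chain_cond.
exists n, (fun i => sval (ev i)) => x x0; apply: (can_inj pK); apply: endo_ext => t.
have [c ->] := sE t; rewrite rmorph0 -[LHS]/((psi x : {linear T -> T}) _) linear_sum big1 //.
move=> i _; rewrite linearZ /=; have := x0 i; rewrite (svalP (ev i)) => xi.
by rewrite (xi : (psi x : {linear T -> T}) (s i) = 0) scaler0.
Qed.

Let aR : finite_over_artin R. Proof. by exists k, phi. Qed.

Hypotheses (pT : Pfin T) (T_ext : forall N, Pfin N -> ext1 N T).

(* For simple Pfin S, any nonzero S -> T is a monomorphism with Pfin cokernel, so all  *)
(* maps S -> T factor through it.                                                      *)
Lemma simple_hom_gen (S : lmodType R) (u v : hom_mod S psi) :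
  simple_mod S -> Pfin S -> u <> 0 -> exists b, b *: u = v.
Proof.
move=> sS pS u0; have [uz|ui] := simple_inj (hval u) sS.
  by case: u0; apply: hval_ext.
have [Q [q sq]] := ses_cok ui.
have [h hE] := T_ext (Pfin_cok sq pS pT) sq (hval v).
have [psi' pK pK'] := psi_bij; exists (psi' h); apply: hval_ext => x.
by rewrite hvalZ pK' -hE.
Qed.

(* X is the simple module Hom(S, T): Fitting's lemma shows that an endomorphism of T   *)
(* vanishing on S kills x.                                                             *)
Lemma simple_endo_iso (X : lmodType E) (V S : lmodType R) (i : {linear V -> T})
    (r : {linear T -> V}) (s : {linear S -> V}) (a : E) (x : X) :
  simple_mod X -> (forall v, r (i v) = v) -> (forall t, endo_fun (psi a) t = i (r t)) ->
  a *: x <> 0 -> indecomposable V -> noeth V -> artin V ->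
  simple_mod S -> Pfin S -> injective s -> isomorphic (hom_mod S psi : lmodType E) X.
Proof.
move=> sX ri aE ax iV nV aV sS pS si; have [psi' pK pK'] := psi_bij.
have psiM b b' t : endo_fun (psi (b * b')) t = endo_fun (psi b) (endo_fun (psi b') t).
  by rewrite rmorphM.
have ii : injective i by apply: can_inj ri.
pose u : hom_mod S psi := (i \o s : {linear S -> T}).
have [/nzero_exists[t0 t0n] _] := sS.
have u0 : u <> 0.
  move=> /(congr1 (fun w => hval w t0)) h; apply: t0n; apply: si; apply: ii.
  by rewrite !linear0; apply: h.
have sH : simple_mod (hom_mod S psi : lmodType E).
  by apply: gen_simple u0 _ => v w v0; apply: simple_hom_gen.
pose y := a *: x; have ay : a *: y = y.
  rewrite /y scalerA; congr (_ *: _); apply: (can_inj pK); apply: endo_ext => t.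
  by rewrite psiM !aE ri.
have [|p pE] := @linear_of E E^o (hom_mod S psi) (fun b => (b : E) *: u).
  by move=> b v w; rewrite scalerDl scalerA.
have [|q qE] := @linear_of E E^o X (fun b => (b : E) *: y).
  by move=> b v w; rewrite scalerDl scalerA.
have ps : surjective p.
  by move=> v; have [b bE] := simple_gen v sH u0; exists b; rewrite pE.
(* Both Hom(S, T) and [X] are cyclic, generated by [u] and [y]; sending [u] to [y] is well defined
   once bu = 0 implies by = 0. *)
have [|h hE] := @factor_surj _ _ _ _ p q ps.
  move=> b; rewrite pE qE => bu; apply: contrapT => by0.
  have [b' b'E] := simple_gen y sX by0.
  pose h : {linear V -> V} := r \o (psi (b' * b) : {linear T -> T}) \o i.
  have hE v : h v = r (endo_fun (psi (b' * b)) (i v)) by [].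
  have [|n hn] := fitting (h := h) nV aV iV.
    move=> hi; apply: t0n; apply: si; apply: hi; rewrite !linear0 hE psiM.
    have -> : endo_fun (psi b) (i (s t0)) = 0.
      exact: (congr1 (fun w : hom_mod S psi => hval w t0) bu).
    by rewrite -[endo_fun _ 0]/((psi b' : {linear T -> T}) 0) !linear0.
  (* Otherwise b'b fixes [y] while its compression [h] to [V] kills [S] and so is nilpotent. The
     elements [z] realize the powers of [h] inside End(T) and still fix [y], a contradiction once
     the power is zero. *)
  have [z [zy zE]] : exists z, z *: y = y /\
      forall t, endo_fun (psi z) t = i (iter n h (r t)).
    elim: n {hn} => [|n [z [zy zE]]]; first by exists a.
    exists (a * (b' * b) * a * z); rewrite -!scalerA zy ay b'E ay; split=> // t.
    by rewrite !psiM zE !aE ri -psiM -hE.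
  apply: ax; rewrite -/y -zy (_ : z = 0) ?scale0r //; apply: (can_inj pK).
  by apply: endo_ext => t; rewrite zE hn linear0 rmorph0.
exists h; have hu : h u = y by rewrite -[u]scale1r -pE hE qE scale1r.
have [h0|hi] := simple_inj h sH; first by case: ax; rewrite -/y -hu h0.
have [h0|hs] := simple_surj h sX; first by case: ax; rewrite -/y -hu h0.
exact: inj_surj_bij.
Qed.

End EndoAlgebra.

Section CornerRing.
Variables (L : pzRingType) (e : idempotent_elt L).

Lemma corner_corner_of : exists c : corner_of L (corner e), forall b, c b = val b.
Proof.
have img (x : L) : val (1 : corner e) * x * val (1 : corner e) = x ->
    exists b : corner e, val b = x.
  move=> xe; have xP : x \in peirce_pred e e by apply/eqP.
  by exists (exist (fun z => z \in peirce_pred e e) x xP).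
by exists (@CornerOf L (corner e) val (fun x y => erefl) (fun x y => erefl) val_inj img).
Qed.

(* eR = eRe + eR(1 - e) *)
Lemma pdfin_emod_ring (c : corner_of L (corner e)) : (forall b, c b = val b) ->
  pdfin (peirce e (idem_compl e)) -> pdfin (emod c L^o).
Proof.
move=> cE pP; have c1 : c 1 = (e : L) by rewrite cE.
have iex (y : peirce e (idem_compl e)) : {z : emod c L^o | eval z = val y}.
  by apply: emod_of; rewrite c1; apply: (peirce_l y).
have pex (y : emod c L^o) : exists b : corner e, c b = (eval y : L) * (e : L).
  apply: cj_img; rewrite c1 -mulrA -mulrA idemP mulrA; congr (_ * _).
  by rewrite -{2}[eval y](evalP y) c1.
have [pf pfE] := choice pex.
have [|i iE] := @linear_of (corner e) (peirce e (idem_compl e)) (emod c L^o)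
    (fun y => sval (iex y)).
  by move=> b y z; apply: eval_inj; rewrite evalD evalZ !(svalP (iex _)) cE.
have [|p pE] := @linear_of (corner e) (emod c L^o) (corner e)^o pf.
  move=> b y z; apply: (cj_inj (c := c)); rewrite cjD [c (b *: _)]cjM !pfE.
  by rewrite evalD evalZ mulrDl -mulrA.
have evi y : eval (i y) = val y by rewrite iE (svalP (iex y)).
apply: (pdfin_ext (i := i) (p := p)) => //; last first.
  by exists 0%N; apply: projective_ring.
split=> [y z /(congr1 (@eval _ _ c _))|b|y].
- by rewrite !evi; apply: val_inj.
- have [|y yE] := @emod_of _ _ c L^o (c b); first exact: (corner_l c b).
  exists y; apply: (cj_inj (c := c)); rewrite pE pfE yE -c1; exact: (corner_r c b).
rewrite pE; split=> [/(congr1 c)|[z <-]].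
  rewrite pfE corner0 => ye.
  have yP : (eval y : L) \in peirce_pred e (idem_compl e).
    apply/eqP; rewrite /= -c1 (evalP y : c 1 * eval y = eval y) mulrBr mulr1 c1 ye subr0 //.
  exists (exist (fun z => z \in peirce_pred e (idem_compl e)) (eval y : L) yP).
  by apply: eval_inj; rewrite evi.
apply: (cj_inj (c := c)); rewrite pfE evi corner0 -(peirce_r z) -mulrA.
by rewrite mulrBl mul1r idemP subrr mulr0.
Qed.

End CornerRing.

(** * The two conditions of the corner criterion for End(T) *)

Theorem corollary5p5 (L : pzRingType) (e : idempotent_elt L)
  (hartin : artin_algebra L)
  (hbasic : basic_ring L)
  (hpd1 : pdim_finite (ltop (idem_compl e)))
  (hpd2 : pdim_finite (peirce e (idem_compl e)))
  (hcf : contravariantly_finite (corner e))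
  (* the primitive idempotents e_1, ..., e_m and e_(m+1), ..., e_(m+l) *)
  (m l : nat) (eps : 'I_(m + l) -> idempotent_elt L)
  (hprim : forall i, primitive (eps i))
  (horth : forall i j, i != j -> (eps i : L) * (eps j : L) = 0)
  (he : (e : L) = \sum_(i < m) (eps (lshift l i) : L))
  (hec : 1 - (e : L) = \sum_(j < l) (eps (rshift m j) : L))
  (* injective envelopes of the S_i and their minimal approximations A_i *)
  (E A : 'I_(m + l) -> lmodType L)
  (iota : forall i, {linear ltop (eps i) -> E i})
  (hE : forall i, injective_envelope (iota i))
  (phi : forall i, {linear A i -> E i})
  (hA : forall i, minimal_approximation (phi i))
  (* the indecomposable modules T_i *)
  (Ti : 'I_(m + l) -> lmodType L)
  (hT1 : represent_indecomposables (dsum (fun i : 'I_m => A (lshift l i)))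
                                   (fun i : 'I_m => Ti (lshift l i)))
  (hT2 : forall j : 'I_l,
     [/\ indecomposable (Ti (rshift m j)),
         embeds_in_socle (ltop (eps (rshift m j))) (Ti (rshift m j)) &
         exists U : lmodType L,
           in_add (dsum (fun i : 'I_m => Ti (lshift l i))) U /\
           isomorphic (A (rshift m j)) (Ti (rshift m j) * U)%type])
  (* the basic strong tilting module T, identified with T' + T'' through g *)
  (T : lmodType L)
  (hTbasic : basic_module T)
  (hTtilt : strong_tilting T)
  (g : {linear T -> (dsum (fun i : 'I_m => Ti (lshift l i)) *
                     dsum (fun j : 'I_l => Ti (rshift m j)))%type})
  (hg : bijective g)
  (* the projection of T onto T' along T'' *)
  (et : idempotent_elt (endo_op T))
  (het : forall t : T, g (endo_fun (et : endo_op T) t) = ((g t).1, 0)) :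
  contravariantly_finite_right (endo_op T) <->
  contravariantly_finite_right (corner et).
Proof.
have [k [kphi [ak fL]]] := artin_algebra_finite hartin.
have aL : finite_over_artin L by exists k, kphi.
have nL : noeth L^o := artin_algebra_chain_cond aL true (fg_ring L).
have [n0 [D [f [Ddiv fJ fsurj]]]] := hbasic.
have [c cE] := corner_corner_of e.
have c1 : c 1 = (e : L) by rewrite cE.
have eeps i : (e : L) * (eps (lshift l i) : L) = (eps (lshift l i) : L).
  rewrite he mulr_suml (bigD1 i) //= idemP big1 ?addr0 // => j ji.
  by apply: horth; rewrite (inj_eq (@lshift_inj _ _)).
have eeps0 j : (e : L) * (eps (rshift m j) : L) = 0.
  rewrite he mulr_suml big1 // => i _; apply: horth.
  by rewrite eq_lrshift.
have simple_fg (S : lmodType L) : simple_mod S -> finitely_generated S.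
  move=> sS; have [/nzero_exists[x x0] _] := sS.
  have [|h hE'] := @linear_of L L^o S (fun a => (a : L) *: x).
    by move=> a u v; rewrite scalerDl scalerA.
  apply: (fg_surj (p := h)) (fg_ring L) => y.
  by have [a aE] := simple_gen y sS x0; exists a; rewrite hE'.
(* On such [S] the idempotent 1 - e acts as the identity, so [S] is a summand of the top of Lambda(1
   - e). *)
have simple_killed (S : lmodType L) : simple_mod S -> killed c S -> pdfin S.
  move=> sS kS; have [/nzero_exists[x x0] _] := sS.
  apply: pdfin_retract (iffLR (pdim_finiteE _) hpd1).
  apply: (simple_retract_ltop Ddiv fJ fsurj (x := x) sS) => /=.
  by rewrite scalerBl scale1r -c1 kS subr0.
have simple_Pfin (S : lmodType L) : simple_mod S -> killed c S -> Pfin S.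
  by move=> sS kS; apply/PfinE; split; [apply: simple_fg | apply: simple_killed].
have kpd := killed_of_simple aL simple_killed.
have [psi [psic fB]] := corner_algebra c ak fL.
have [d dE] : pdfin (emod c L^o).
  exact: pdfin_emod_ring cE (iffLR (pdim_finiteE _) hpd2).
(* For i <= m the simple S_i is fixed by [e], as required of the envelope. *)
have tfA i : torsion_free c (A (lshift l i)).
  apply: (minimal_approximation_torsion_free (hA _) (hE _)) simple_Pfin => y.
  have := ltop_orth Ddiv fJ (p := eps (lshift l i)) (q := idem_compl e) y.
  rewrite /= mulrBl mul1r eeps subrr scalerBl scale1r c1 => /(_ erefl)/eqP.
  by rewrite subr_eq0 => /eqP.
pose Tp := dsum (fun i : 'I_m => Ti (lshift l i)).
pose Tpp := dsum (fun j : 'I_l => Ti (rshift m j)).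
pose DA := dsum (fun i : 'I_m => A (lshift l i)).
have [hT1a _ hT1c] := hT1.
have tfT : torsion_free c Tp.
  apply: torsion_free_dsum => i; have [_ /in_add_fin_retract/fin_retract_cogen h] := hT1a i.
  by apply: torsion_free_cogen h _; apply: torsion_free_dsum.
have [[pT _ Tcor] T_strong] := hTtilt.
have T_ext N : Pfin N -> ext1 N T.
  by move=> pN; apply: (ext1_vanish _ (T_strong _ pN 1%N isT)); have /PfinE[] := pN.
have [g' gK gK'] := linear_inverse hg.
have [j1 j1E] := pair_map (idfun : {linear Tp -> Tp}) (\0 : {linear Tp -> Tpp}).
have [j2 j2E] := pair_map (\0 : {linear Tpp -> Tp}) (idfun : {linear Tpp -> Tpp}).
pose i1 : {linear Tp -> T} := g' \o j1; pose r1 : {linear T -> Tp} := fst \o g.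
pose i2 : {linear Tpp -> T} := g' \o j2; pose r2 : {linear T -> Tpp} := snd \o g.
have r1i x : r1 (i1 x) = x by rewrite /r1 /i1 /= gK' j1E.
have r2i x : r2 (i2 x) = x by rewrite /r2 /i2 /= gK' j2E.
have etE t : endo_fun (et : endo_op T) t = i1 (r1 t).
  by apply: (can_inj gK); rewrite het /i1 /= gK' j1E.
have i12 t : t = i1 (r1 t) + i2 (r2 t).
  apply: (can_inj gK); rewrite linearD /i1 /i2 /= !gK' j1E j2E [LHS]surjective_pairing.
  by congr pair; rewrite /= ?addr0 ?add0r.
have rT : retract Tp T by exists i1, r1.
have pTp : Pfin Tp := Pfin_retract rT pT.
have Tp_ext N : Pfin N -> ext1 N Tp by move=> /T_ext; apply: ext1_retract.
have [pTi [qTi [_ pqTi _ _]]] := dsum_maps (fun i : 'I_m => Ti (lshift l i)).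
have [pTj [qTj [_ pqTj _ qpTj]]] := dsum_maps (fun j : 'I_l => Ti (rshift m j)).
have [pA [qA [_ pqA _ _]]] := dsum_maps (fun i : 'I_m => A (lshift l i)).
have PfinA i : Pfin (A i) by have [[]] := hA i.
(* Every indecomposable summand of the sum of the A_i with i <= m is isomorphic to one of the
   summands of T'. *)
have cogDA : fin_cogen Tp DA.
  apply: fin_cogen_indecomposables => [|X iX addX].
    apply: artin_algebra_chain_cond aL _ _ _; apply: fg_dsum => i.
    by have /PfinE[] := PfinA (lshift l i).
  have [i [h hb]] := hT1c X iX addX.
  apply: (fin_cogen_inj (f := qTi i \o h)) (fin_cogen_refl _).
  by apply: inj_comp (bij_inj hb); apply: can_inj (pqTi i).
have cogA i : fin_cogen Tp (A (lshift l i)).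
  by apply: (fin_cogen_inj (f := qA i)) cogDA; apply: can_inj (pqA i).
have TTp : fin_cogen T Tp.
  by apply: (fin_cogen_inj (f := i1)) (fin_cogen_refl _); apply: can_inj r1i.
have cogT i : fin_cogen T (A i).
  case: (split_ordP i) => [i' ->|j ->]; first exact: fin_cogen_trans TTp (cogA i').
  have [_ _ [U [addU [h hb]]]] := hT2 j.
  apply: (fin_cogen_inj (bij_inj hb)); apply: fin_cogen_prod.
    apply: (fin_cogen_inj (f := i2 \o qTj j)) (fin_cogen_refl _).
    by apply: inj_comp (can_inj r2i) (can_inj (pqTj j)).
  exact: fin_cogen_trans TTp (fin_retract_cogen (in_add_fin_retract addU)).
(* A simple submodule [S] on which [eps j] acts nontrivially is a summand of S_j. Its embedding in
   E(S_j) extends to [M] by injectivity and lifts to A_j by approximation, giving a map M -> A_j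
   that does not vanish on [S]. *)
have envelopes (V M : lmodType L) : Pfin M ->
    (forall (S : lmodType L) (i : {linear S -> M}), simple_mod S -> injective i ->
       exists j (s : S), (eps j : L) *: s <> 0 /\ fin_cogen V (A j)) -> fin_cogen V M.
  move=> pM h; have /PfinE[fM _] := pM.
  apply: fin_cogen_of_simple => [|S i sS ii].
    exact: (artin_algebra_chain_cond aL false fM).
  have [j [s [js cj]]] := h S i sS ii; have [u [v vu]] := simple_retract_ltop Ddiv fJ fsurj sS js.
  have [Einj iotai _] := hE j; have [[_ lift] _] := hA j.
  have [h1 h1E] := Einj _ _ i (iota j \o u) ii.
  have [h2 h2E] := lift _ h1 pM; exists (A j), h2; split=> //; exists s => hs.
  have us : u s = 0.
    by apply: iotai; rewrite linear0 -[LHS]/((iota j \o u) s) -h1E -h2E hs linear0.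
  by apply: js; rewrite -(vu s) us linear0 scaler0.
(* If [e] does not kill [S], neither does some [eps i] with i <= m, so only the A_i cogenerated by
   T' occur. *)
have Tp_cogen (M : lmodType L) : Pfin M ->
    (forall (S : lmodType L) (i : {linear S -> M}), simple_mod S -> injective i -> ~ killed c S) ->
    fin_cogen Tp M.
  move=> pM nk; apply: envelopes => // S i sS ii.
  have /existsNP[s es] := nk S i sS ii.
  apply: contrapT => nj; apply: es; rewrite c1 he scaler_suml big1 // => i' _.
  by apply: contrapT => js; apply: nj; exists (lshift l i'), s.
have T_cogen (M : lmodType L) : Pfin M -> fin_cogen T M.
  move=> pM; apply: envelopes => // S i sS ii; have [/nzero_exists[s s0] _] := sS.
  apply: contrapT => nj; apply: s0; rewrite -[s]scale1r -(subrK (e : L) 1) hec {1}he scalerDl.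
  rewrite !scaler_suml !big1 ?addr0 // => i' _; apply: contrapT => js; apply: nj.
    by exists (lshift l i'), s.
  by exists (rshift m i'), s.
have [s findim] := findim_bound aL T_ext Tcor.
(* The double converse of End(T) is End(T) itself; [psiT] is the identity map. *)
have [psiT [psiTb psiTE]] : exists psiT : {rmorphism (endo_op T)^c -> endo T},
    bijective psiT /\ forall a, psiT a = a.
  have [|||psiT psiTE] := @rmorphism_of (endo_op T)^c (endo T) (fun a => a) => //.
  by exists psiT; split=> //; exists (fun a : endo T => (a : (endo_op T)^c)) => a; rewrite psiTE.
(* Passing to converses commutes with taking the corner at [et]; only the order of the factors
   changes. *)
have [cT [cTE cT1]] : exists cT : corner_of (endo_op T)^c (corner et)^c,
    (forall b, cT b = val (b : corner et)) /\ cT 1 = (et : endo_op T).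
  pose e' : (endo_op T)^c := (et : endo_op T).
  have img (x : (endo_op T)^c) : e' * x * e' = x -> exists b : corner et, val b = x.
    move=> xe; have xP : x \in peirce_pred et et.
      apply/eqP; rewrite -[RHS]xe -[RHS]/((et : endo_op T) * ((x : endo_op T) * (et : endo_op T))).
      by rewrite mulrA.
    by exists (exist (fun z => z \in peirce_pred et et) x xP).
  by exists (@CornerOf (endo_op T)^c (corner et)^c (fun b => val (b : corner et))
    (fun x y => erefl) (fun x y => erefl) val_inj img).
have idemE t : endo_fun (psiT (cT 1)) t = i1 (r1 t) by rewrite psiTE cT1 -etE.
have fT : finitely_generated T by have /PfinE[] := pT.
have [chiT fE] := endo_algebra ak fL psiTb fT.
have aE : finite_over_artin (endo_op T)^c by exists k, chiT.
have [chiF [chiFc fF]] := corner_algebra cT ak fE.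
have [d' dE'] := pdfin_endo_corner ak fL fB psic kpd dE pTp Tp_ext tfT Tp_cogen findim
  psiTb pT r1i idemE.
apply: (contravariantly_finite_corner ak fE fF chiFc _ dE').
(* The condition left is that simple End(T)-modules killed by [et] have finite projective
   dimension. *)
apply: (killed_of_simple aE) => X sX kX.
have [psi' pK pK'] := psiTb.
pose ij j : {linear Ti (rshift m j) -> T} := i2 \o qTj j.
pose rj j : {linear T -> Ti (rshift m j)} := pTj j \o r2.
have rij j v : rj j (ij j v) = v by rewrite -[LHS]/(pTj j (r2 (i2 (qTj j v)))) r2i pqTj.
pose a j : (endo_op T)^c := psi' (ij j \o rj j : {linear T -> T}).
have aE' j t : endo_fun (psiT (a j)) t = ij j (rj j t) by rewrite /a pK'.
(* Decompose the identity of T by the projections onto T' and onto the summands of T''. As [et]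
   kills [X], some [a j] acts nontrivially on it. *)
have a1 : 1 = cT 1 + \sum_j a j.
  apply: (can_inj pK); apply: endo_ext => t.
  have sumE : endo_fun (psiT (\sum_j a j)) t = i2 (r2 t).
    rewrite [in RHS](qpTj (r2 t)) linear_sum rmorph_sum.
    have ev (F : 'I_l -> endo T) : endo_fun (\sum_j F j) t = \sum_j endo_fun (F j) t.
      by elim/big_ind2: _ => // x1 x2 y1 y2 <- <-.
    by rewrite ev; apply: eq_bigr => j _; rewrite aE'.
  rewrite rmorph1 rmorphD -[RHS]/(endo_fun (psiT (cT 1)) t + endo_fun (psiT (\sum_j a j)) t).
  by rewrite idemE sumE -i12.
have [/nzero_exists[x x0] _] := sX.
have [j ajx] : exists j, a j *: x <> 0.
  apply: contrapT => nj; apply: x0; rewrite -[x]scale1r a1 scalerDl kX add0r scaler_suml big1 // => j _.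
  by apply: contrapT => ax; apply: nj; exists j.
have [iTj [sj sji _] _] := hT2 j.
have [q [qs _]] := ltop_proj (eps (rshift m j)).
have altop : artin (ltop (eps (rshift m j))).
  exact: (artin_algebra_chain_cond aL false (fg_surj qs (fg_ring L))).
have nltop : ~ zero_module (ltop (eps (rshift m j))).
  by apply: (ltop_nzero fJ nL); have [] := hprim (rshift m j).
(* [S] is a simple submodule of the top of the projective at [eps (rshift m j)]. That top is killed
   by [e] and embeds in the socle of the [j]-th summand of T'', so [simple_endo_iso] identifies
   Hom(S, T) with [X]. *)
have [S [i0 [sS i0i]]] := artin_simple altop nltop.
have kS : killed c S.
  move=> s0; apply: i0i; rewrite linearZ linear0 c1.
  by apply: (ltop_orth Ddiv fJ) (eeps0 j).
have pS := simple_Pfin S sS kS.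
have fTj : finitely_generated (Ti (rshift m j)).
  by apply: fg_retract fT; exists (ij j), (rj j).
apply: pdfin_iso (pdfin_hom psiTb aL pT T_ext T_cogen findim pS).
apply: (simple_endo_iso psiTb pT T_ext sX (rij j) (aE' j) ajx iTj _ _ sS pS).
- exact: (artin_algebra_chain_cond aL true fTj).
- exact: (artin_algebra_chain_cond aL false fTj).
- exact: inj_comp sji i0i.
Qed.
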